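(* For every $\gamma\in(0,\min\{\alpha,1\}]$, the phase transition locus $\mathcal{PT}(\gamma)$ is a topological submanifold of $C^\gamma(\mathbb{R})$ of co-dimension $1$. Furthermore, this submanifold is homeomorphic to a vector subspace of $C^\gamma(\mathbb{R})$ of co-dimension $1$, but it is not an affine subspace of $C^\gamma(\mathbb{R})$.
   Context: Fix $\alpha\in(0,+\infty)$ and let $f\colon[0,1]\to[0,1]$ be the intermittent map given by $f(x)=x(1+x^{\alpha})$ if $x(1+x^{\alpha})\le 1$, and $f(x)=x(1+x^{\alpha})-1$ otherwise. Let $\mathscr{M}$ be the set of Borel probability measures on $[0,1]$ invariant by $f$; for $\nu\in\mathscr{M}$ let $h_\nu$ be its measure-theoretic entropy. For $\gamma\in(0,1]$, $C^{\gamma}(\mathbb{R})$ is the Banach space of real-valued $\gamma$-Hölder continuous functions on $[0,1]$ with norm $\|\varphi\|_\gamma=\|\varphi\|+|\varphi|_\gamma$, where $\|\varphi\|=\sup_{[0,1]}|\varphi|$ and $|\varphi|_\gamma=\sup_{x\ne y}|\varphi(x)-\varphi(y)|/|x-y|^\gamma$. For a continuous $\varphi\colon[0,1]\to\mathbb{R}$ (a potential), the pressure is $P(\varphi)=\sup\{h_\nu+\int\varphi\,d\nu:\nu\in\mathscr{M}\}$, and a Gibbs state of $f$ for $\varphi$ is a measure in $\mathscr{M}$ attaining this supremum. $\delta_0$ is the Dirac mass at $0$. A measure $\nu\in\mathscr{M}$ is exponentially mixing if there are $C\in(0,+\infty)$ and $\rho\in(0,1)$ such that for every bounded measurable $\psi\colon[0,1]\to\mathbb{R}$,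 every Lipschitz $\tilde\psi\colon[0,1]\to\mathbb{R}$ and every $n\in\mathbb{N}$, $|\int\psi\circ f^n\cdot\tilde\psi\,d\nu-\int\psi\,d\nu\int\tilde\psi\,d\nu|\le C\|\psi\|\,|\tilde\psi|_1\,\rho^n$. The intermittent phase $\mathcal{I}(\gamma)$ is the set of $\varphi\in C^\gamma(\mathbb{R})$ for which there is an exponentially mixing Gibbs state of strictly positive entropy. The stationary phase $\mathcal{S}(\gamma)$ is the interior in $C^\gamma(\mathbb{R})$ of the set of $\varphi$ for which $\delta_0$ is the unique Gibbs state. For $\gamma\in(0,\min\{\alpha,1\}]$, the phase transition locus $\mathcal{PT}(\gamma)$ is the common boundary $\partial\mathcal{I}(\gamma)=\partial\mathcal{S}(\gamma)$ in $C^\gamma(\mathbb{R})$ (these two boundaries coincide). A subset $S$ of a Banach space $X$ is a topological submanifold of co-dimension $1$ if every point of $S$ has an open neighborhood $U$ in $X$ with a homeomorphism from $U$ onto an open subset $V$ of $X$ mapping $U\cap S$ onto $V\cap K$, for some closed vector subspace $K$ of $X$ of co-dimension $1$. *)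

(* Defs.v *)
From HB Require Import structures.
From mathcomp Require Import all_boot all_order all_algebra.
From mathcomp Require Import ring lra.
From mathcomp Require Import all_classical all_reals all_analysis.
Set Implicit Arguments.
Unset Strict Implicit.
Unset Printing Implicit Defensive.
Import Order.TTheory GRing.Theory Num.Theory.
Import numFieldNormedType.Exports.
Local Open Scope classical_set_scope.
Local Open Scope ring_scope.

Section UnitInterval.
Variable R : realType.

Lemma zero_in01 : (0 : R) \in `[0, 1]%classic.
Proof. by rewrite inE /= in_itv /= lexx ler01. Qed.

HB.instance Definition _ :=
  isPointed.Build (set_type (`[0, 1]%classic : set R)) (exist _ 0 zero_in01).

(* The Borel sigma-algebra of [0,1] is the one generated by the open sets of
   the subspace topology carried by [set_type]. *)
Definition I01 : Type :=
  g_sigma_algebraType (@open (set_type (`[0, 1]%classic : set R))).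

HB.instance Definition _ := Measurable.on I01.

Definition I01_zero : I01 := exist _ 0 zero_in01.

End UnitInterval.

Section HolderSpace.
Variables (R : realType) (gamma : R).
Local Notation I := (I01 R).
Implicit Types (phi psi : I -> R).

Definition supnorm phi : R := sup [set `|phi x| | x in [set: I]].

Definition holder_seminorm phi : R :=
  sup [set `|phi z.1 - phi z.2| / `|val z.1 - val z.2| `^ gamma
      | z in [set z : I * I | z.1 != z.2]].

(* Boundedness is automatic for [0 <= gamma]; requiring it makes the norm below
   finite, hence the type [holder gamma] a normed space, for every real [gamma]. *)
Definition is_holder phi : Prop :=
  (exists M, forall x, `|phi x| <= M) /\
  (exists M, forall x y, `|phi x - phi y| <= M * `|val x - val y| `^ gamma).

Definition holder_pred : {pred I -> R^o} := fun phi => `[< is_holder phi >].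

Lemma holder_submod_closed : submod_closed holder_pred.
Proof.
split=> [|a u v /asboolP[[M uM] [N uN]] /asboolP[[M' vM] [N' vN]]].
  apply/asboolP; split; first by exists 0 => x; rewrite normr0.
  by exists 0 => x y; rewrite subrr normr0 mul0r.
apply/asboolP; split.
  exists (`|a| * M + M') => x; apply: (le_trans (ler_normD _ _)).
  by rewrite lerD// normrM ler_wpM2l.
exists (`|a| * N + N') => x y.
have -> : (a *: u + v) x - (a *: u + v) y = a * (u x - u y) + (v x - v y).
  change (a * u x + v x - (a * u y + v y) = a * (u x - u y) + (v x - v y)).
  by rewrite mulrBr opprD addrACA.
rewrite (le_trans (ler_normD _ _))// mulrDl lerD// normrM -mulrA.
by rewrite ler_wpM2l.
Qed.

HB.instance Definition _ :=
  GRing.isSubmodClosed.Build R (I -> R^o) holder_pred holder_submod_closed.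

Record holder : Type := Holder {
  holder_fun :> I -> R^o;
  holder_funP : holder_fun \in holder_pred }.

HB.instance Definition _ := [isSub for holder_fun].
HB.instance Definition _ := [Choice of holder by <:].
HB.instance Definition _ := [SubChoice_isSubLmodule of holder by <:].

Definition holder_norm (phi : holder) : R := supnorm phi + holder_seminorm phi.

Lemma supnorm_ge (phi : holder) x : `|phi x| <= supnorm phi.
Proof.
have /asboolP[[M phiM] _] := holder_funP phi.
by apply: ub_le_sup; [exists M => _ [y _ <-]|exists x].
Qed.

Lemma supnorm_le phi M : (forall x, `|phi x| <= M) -> supnorm phi <= M.
Proof.
move=> phiM; apply: ge_sup => [|_ [x _ <-]//].
by exists `|phi (I01_zero R)|, (I01_zero R).
Qed.

Lemma I01_powR_gt0 (x y : I) : x != y -> 0 < `|val x - val y| `^ gamma.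
Proof.
move=> xy; apply: powR_gt0; rewrite normr_gt0 subr_eq0.
by apply: contra xy => /eqP /val_inj ->.
Qed.

Lemma one_in01 : (1 : R) \in `[0, 1]%classic.
Proof. by rewrite inE /= in_itv /= lexx ler01. Qed.

Definition I01_one : I := exist _ 1 one_in01.

Lemma I01_one_neq0 : I01_one != I01_zero R.
Proof. by apply/eqP => /(congr1 val) /= /eqP; rewrite oner_eq0. Qed.

Lemma holder_seminorm_ge_quot (phi : holder) x y : x != y ->
  `|phi x - phi y| / `|val x - val y| `^ gamma <= holder_seminorm phi.
Proof.
have /asboolP[_ [M phiM]] := holder_funP phi.
move=> xy; apply: ub_le_sup; last by exists (x, y).
by exists M => _ [z /= zz <-]; rewrite ler_pdivrMr ?I01_powR_gt0.
Qed.

Lemma holder_seminorm_ge0 (phi : holder) : 0 <= holder_seminorm phi.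
Proof.
apply: le_trans (holder_seminorm_ge_quot phi I01_one_neq0).
by rewrite divr_ge0 ?powR_ge0.
Qed.

Lemma holder_seminorm_ge (phi : holder) x y :
  `|phi x - phi y| <= holder_seminorm phi * `|val x - val y| `^ gamma.
Proof.
have [->|xy] := eqVneq x y.
  by rewrite subrr normr0 mulr_ge0 ?powR_ge0// holder_seminorm_ge0.
by rewrite -ler_pdivrMr ?I01_powR_gt0// holder_seminorm_ge_quot.
Qed.

Lemma holder_seminorm_le phi M :
  (forall x y, `|phi x - phi y| <= M * `|val x - val y| `^ gamma) ->
  holder_seminorm phi <= M.
Proof.
move=> phiM; apply: ge_sup; last first.
  by move=> _ [z /= zz <-]; rewrite ler_pdivrMr ?I01_powR_gt0.
by eexists; exists (I01_one, I01_zero R) => //=; exact: I01_one_neq0.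
Qed.

Lemma holder_normD (phi psi : holder) :
  holder_norm (phi + psi) <= holder_norm phi + holder_norm psi.
Proof.
rewrite /holder_norm addrACA lerD//.
  apply: supnorm_le => x.
  by rewrite (le_trans (ler_normD _ _))// lerD// supnorm_ge.
apply: holder_seminorm_le => x y.
have -> : (phi + psi) x - (phi + psi) y = (phi x - phi y) + (psi x - psi y).
  change (phi x + psi x - (phi y + psi y) = phi x - phi y + (psi x - psi y)).
  by rewrite opprD addrACA.
by rewrite (le_trans (ler_normD _ _))// mulrDl lerD// holder_seminorm_ge.
Qed.

Lemma holder_normZ_le (a : R) (phi : holder) :
  holder_norm (a *: phi) <= `|a| * holder_norm phi.
Proof.
rewrite /holder_norm mulrDr lerD//.
  by apply: supnorm_le => x; rewrite normrM ler_wpM2l// supnorm_ge.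
apply: holder_seminorm_le => x y.
have -> : (a *: phi) x - (a *: phi) y = a * (phi x - phi y) by rewrite mulrBr.
by rewrite normrM -mulrA ler_wpM2l// holder_seminorm_ge.
Qed.

Lemma holder_normZ (a : R) (phi : holder) :
  holder_norm (a *: phi) = `|a| * holder_norm phi.
Proof.
apply/eqP; rewrite eq_le holder_normZ_le /=.
have [->|a0] := eqVneq a 0.
  rewrite normr0 mul0r addr_ge0//.
    by rewrite (le_trans _ (supnorm_ge _ (I01_zero R))).
  exact: holder_seminorm_ge0.
rewrite -[X in `|a| * holder_norm X](scalerK a0).
rewrite (le_trans (ler_wpM2l _ (holder_normZ_le _ _)))//.
by rewrite mulrA -normrM divff// normr1 mul1r.
Qed.

Lemma holder_norm_eq0 (phi : holder) : holder_norm phi = 0 -> phi = 0.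
Proof.
move=> phi0; apply/val_inj/funext => x.
apply/eqP; rewrite -normr_le0 -phi0 (le_trans (supnorm_ge phi x))//.
by rewrite lerDl holder_seminorm_ge0.
Qed.

HB.instance Definition _ := Lmodule_isNormed.Build R holder
  holder_normD holder_normZ holder_norm_eq0.

Lemma holder_normE (phi : holder) :
  `|phi| = supnorm phi + holder_seminorm phi.
Proof. by []. Qed.

Lemma holder_complete (F : set_system holder) :
  ProperFilter F -> cauchy F -> cvg F.
Proof.
move=> FF /cauchyP cF.
have evE (phi psi : holder) x : `|phi x - psi x| <= `|phi - psi|.
  rewrite (le_trans (supnorm_ge (phi - psi) x))// holder_normE lerDl.
  exact: holder_seminorm_ge0.
have ev_cvg x : cvg ((fun phi : holder => phi x : R) @ F).
  apply: cauchy_cvg; apply: cauchy_exP => e e0.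
  have [phi Fphi] := cF e e0; exists (phi x).
  apply: (@filterS _ F _ _ _ _ Fphi) => psi /=; rewrite -!ball_normE /=.
  exact: le_lt_trans (evE _ _ _).
pose lphi x := lim ((fun phi : holder => phi x : R) @ F).
have evl x : (fun phi : holder => phi x : R) @ F --> lphi x by exact: ev_cvg.
have near_lim e : 0 < e -> exists2 phi : holder, F (ball phi e) &
    (forall x, `|phi x - lphi x| <= e) /\
    (forall x y, `|(phi x - lphi x) - (phi y - lphi y)|
                 <= e * `|val x - val y| `^ gamma).
  move=> e0; have [phi Fphi] := cF e e0; exists phi => //; split=> [x|x y].
    apply: (@cvgr_to_le holder F _ R (fun psi : holder => `|phi x - psi x : R|)).
      by apply: cvg_norm; apply: cvgB; [exact: cvg_cst|exact: evl].
    apply: (@filterS _ F _ _ _ _ Fphi) => psi; rewrite -ball_normE /= => /ltW.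
    exact: le_trans (evE _ _ _).
  apply: (@cvgr_to_le holder F _ R (fun psi : holder =>
    `|(phi x - psi x : R) - (phi y - psi y : R)|)).
    by apply: cvg_norm; apply: cvgB; apply: cvgB;
      (exact: cvg_cst || exact: evl).
  apply: (@filterS _ F _ _ _ _ Fphi) => psi; rewrite -ball_normE /= => /ltW phipsi.
  apply: (le_trans (holder_seminorm_ge (phi - psi) x y)).
  rewrite ler_wpM2r ?powR_ge0// (le_trans _ phipsi)// holder_normE lerDr.
  by rewrite (le_trans _ (supnorm_ge _ (I01_zero R))).
have lP : (lphi : I -> R^o) \in holder_pred.
  have [phi _ [b h]] := near_lim 1 ltr01.
  have dP : ((fun x => phi x - lphi x) : I -> R^o) \in holder_pred.
    by apply/asboolP; split; exists 1.
  suff -> : (lphi : I -> R^o) = (phi : I -> R^o) - (fun x => phi x - lphi x).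
    exact: rpredB (holder_funP phi) dP.
  by apply/funext => x; rewrite -[LHS](subKr (phi x)).
apply: (cvgP (Holder lP)); apply/cvgrPdist_le => e e0.
have e30 : 0 < e / 3 by rewrite divr_gt0.
have [phi Fphi [b h]] := near_lim _ e30.
apply: (@filterS _ F _ _ _ _ Fphi) => psi; rewrite -ball_normE /= => /ltW phipsi.
rewrite -(subrKA phi) (le_trans (ler_normD _ _))//.
have -> : e = e / 3 + e / 3 + e / 3 by field.
rewrite lerD// distrC holder_normE lerD//.
  exact: supnorm_le.
exact: holder_seminorm_le.
Qed.

HB.instance Definition _ := Uniform_isComplete.Build holder holder_complete.

End HolderSpace.

Section Entropy.
Variables (d : measure_display) (T : measurableType d) (R : realType).
Variables (f : T -> T) (nu : probability T R).

Definition invariant_measure : Prop :=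
  forall A, measurable A -> nu (f @^-1` A) = nu A.

(* Finite partitions are labelled, and may have empty or null atoms; these
   contribute nothing to the entropy, since [0 * ln 0 = 0]. *)
Definition finite_partition k (A : 'I_k -> set T) : Prop :=
  [/\ forall i, measurable (A i), trivIset setT A & \bigcup_i A i = setT].

(* The atom with itinerary [s] of the join of the partitions
   [A, f^-1 A, ..., f^-(n-1) A]. *)
Definition join_atom k (A : 'I_k -> set T) n (s : {ffun 'I_n -> 'I_k}) : set T :=
  [set x | forall i : 'I_n, A (s i) (iter i f x)].

Definition join_entropy k (A : 'I_k -> set T) n : R :=
  - \sum_(s : {ffun 'I_n -> 'I_k})
      fine (nu (join_atom A s)) * ln (fine (nu (join_atom A s))).

Definition partition_entropy k (A : 'I_k -> set T) : R :=
  limn (fun n => join_entropy A n / n%:R).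

Definition entropy : \bar R :=
  ereal_sup [set e | exists k (A : 'I_k -> set T),
    finite_partition A /\ e = (partition_entropy A)%:E].

End Entropy.

Section Thermodynamics.
Variables (R : realType) (alpha : R).
Local Notation I := (I01 R).

Definition intermittent_fun (x : R) : R :=
  let y := x * (1 + x `^ alpha) in if y <= 1 then y else y - 1.

Lemma intermittent_fun_in01 (t : R) : 0 < alpha ->
  t \in `[0, 1]%classic -> intermittent_fun t \in `[0, 1]%classic.
Proof.
rewrite !inE /= !in_itv /= /intermittent_fun => a0 /andP[t0 t1].
have p0 : 0 <= t `^ alpha by exact: powR_ge0.
have p1 : t `^ alpha <= 1.
  have <- : (1 : R) `^ alpha = 1 by rewrite powR1.
  by rewrite ge0_ler_powR// ?nnegrE// ltW.
have y0 : 0 <= t * (1 + t `^ alpha) by rewrite mulr_ge0// addr_ge0.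
have y2 : t * (1 + t `^ alpha) <= 1 * 2 by rewrite ler_pM//; lra.
by case: ifPn => [y1|]; rewrite -?ltNge => *; apply/andP; split; lra.
Qed.

(* The default value of [insubd] is never used when [0 < alpha]: see
   [val_intermittent_map]. *)
Definition intermittent_map (x : I) : I :=
  insubd (I01_zero R) (intermittent_fun (val x)).

Lemma val_intermittent_map (x : I) :
  0 < alpha -> val (intermittent_map x) = intermittent_fun (val x).
Proof.
by move=> a0; apply: insubdK; apply: intermittent_fun_in01 => //; exact: valP.
Qed.

Local Notation f := intermittent_map.
Implicit Types (phi : I -> R) (nu : probability I R).

Definition pressure phi : \bar R :=
  ereal_sup [set (entropy f nu + \int[nu]_x (phi x)%:E)%E
            | nu in [set nu : probability I R | invariant_measure f nu]].

Definition gibbs_state phi nu : Prop :=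
  invariant_measure f nu /\
  (entropy f nu + \int[nu]_x (phi x)%:E)%E = pressure phi.

Definition delta0 : probability I R := \d_(I01_zero R).

Definition delta0_unique_gibbs phi : Prop :=
  gibbs_state phi delta0 /\
  forall nu, gibbs_state phi nu -> forall A, measurable A -> nu A = delta0 A.

(* [holder R 1] is the space of Lipschitz functions. *)
Definition exponentially_mixing nu : Prop :=
  exists C rho : R, [/\ 0 < C, 0 < rho < 1 &
    forall (psi : I -> R) (psi' : holder 1) (n : nat),
      measurable_fun setT psi -> (exists M, forall x, `|psi x| <= M) ->
      `| (\int[nu]_x (psi (iter n f x) * psi' x))
         - (\int[nu]_x psi x) * (\int[nu]_x psi' x) |
      <= C * supnorm psi * holder_seminorm 1 psi' * rho ^+ n].

Section Phases.
Variable gamma : R.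

Definition intermittent_phase : set (holder gamma) :=
  [set phi | exists nu, [/\ gibbs_state phi nu, exponentially_mixing nu &
                            (0 < entropy f nu)%E]].

Definition stationary_phase : set (holder gamma) :=
  interior [set phi : holder gamma | delta0_unique_gibbs phi].

End Phases.
End Thermodynamics.

Arguments intermittent_phase {R} alpha gamma.
Arguments stationary_phase {R} alpha gamma.

Definition boundary (X : topologicalType) (S : set X) : set X :=
  closure S `\` interior S.

(* For [0 < gamma <= min(alpha, 1)] the two boundaries are equal; their
   intersection denotes this common boundary without favouring either side. *)
Definition phase_transition_locus (R : realType) (alpha gamma : R)
    : set (holder gamma) :=
  boundary (intermittent_phase alpha gamma) `&`
  boundary (stationary_phase alpha gamma).

Arguments phase_transition_locus {R} alpha gamma.

(* [g] restricts to a homeomorphism from [U] onto [V], for the subspace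
   topologies. *)
Definition homeo_onto (X Y : topologicalType) (U : set X) (V : set Y)
    (g : X -> Y) : Prop :=
  [/\ set_bij U V g, {within U, continuous g} &
     exists2 h : Y -> X, {in U, cancel g h} & {within V, continuous h}].

Definition homeomorphic (X Y : topologicalType) (U : set X) (V : set Y) : Prop :=
  exists g : X -> Y, homeo_onto U V g.

Section Submanifolds.
Variables (R : realType) (X : completeNormedModType R).
Implicit Types K S U V W : set X.

Definition vector_subspace K : Prop := submod_closed [in K].

Definition codim1_subspace K : Prop :=
  vector_subspace K /\
  exists2 v, ~ K v & forall x, exists t : R, K (x - t *: v).

Definition affine_subspace S : Prop :=
  exists a W, vector_subspace W /\ S = [set a + w | w in W].

Definition topological_submanifold_codim1 S : Prop :=
  forall p, S p -> exists U V K g,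
    [/\ open U /\ U p, open V, closed K /\ codim1_subspace K,
        homeo_onto U V g & g @` (U `&` S) = V `&` K].

End Submanifolds.

(* Main.v *)
(** Put [v x = x ^ gamma], and let [t phi] be the largest [t] such that
    [h_nu + \int (phi + t v) dnu <= phi 0] for every invariant [nu]. It is finite
    (the Dirac mass at [1] bounds it above, and a supersolution of the transfer
    operator shows that very negative multiples of [x ^ alpha] favour the fixed
    point [0]), it is 1-Lipschitz, and [t (phi + s v) = t phi - s]; thus [t = 0] is
    the graph of a continuous function over the hyperplane [phi 1 = phi 0].

    The stationary phase is [t > 0], because [\int v dnu = 0] only for the Dirac
    mass at [0]. If [t phi < 0], the resolvent of the transfer operator blows up at
    a parameter larger than [exp (phi 0)]; a resolvent function [h] is then an exact
    eigenfunction for a Hoelder potential close to [phi]. Normalizing by [h] gives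
    a Markov operator that contracts oscillations, whose stationary measure is
    an exponentially mixing Gibbs state of positive entropy. So the common
    boundary of the two phases is [t = 0].

    If it were affine, [t] would be affine on the line through [0] and
    [psi = x (1 - x)], and the variational inequality would force
    [(t psi - t 0) \int v dnu = psi 0 - \int psi dnu] for every invariant [nu].
    The Dirac mass at [1] gives [t psi = t 0], hence [\int psi dnu = 0] for all
    [nu], which fails as soon as [nu] charges the open interval. *)

From HB Require Import structures.
Require Import Defs.
From mathcomp Require Import all_boot all_order all_algebra.
From mathcomp Require Import ring lra.
From mathcomp Require Import all_classical all_reals all_analysis measurable_realfun.
Import Order.TTheory GRing.Theory Num.Theory.
Import numFieldNormedType.Exports.
Local Open Scope classical_set_scope.
Local Open Scope ring_scope.
Set Implicit Arguments.
Unset Strict Implicit.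
Unset Printing Implicit Defensive.

(** * Inverse branches of the intermittent map *)

(** The neutral fixed point 0, where the derivative of [f] is 1, denies the usual tools: inverse
    branches do not contract uniformly, and Birkhoff sums have only sublinear distortion. Bounded
    supersolutions of the transfer operator replace them. One supersolution bounds entropy plus
    integral for all invariant measures at once, with no reference measure. If [critical_exponent]
    exceeds [phi 0], convexity allows a small multiple of [x ^ alpha] to be subtracted from [phi]
    with a strict drop of the exponent; and the logarithmic contraction of an inverse branch has
    just this form. Hence a Hoelder bound on resolvent functions that is uniform as the parameter
    decreases to the critical exponent. No limit of these functions is taken: as they blow up, the
    inhomogeneous term 1 becomes relatively small and is absorbed into the potential. This yields
    density of the intermittent phase in [t < 0], enough to find the boundary. The weight has
    exponent [gamma] because the Hoelder norm controls [phi x - phi 0] by [x ^ gamma]. *)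

Section RealPowers.
Variable R : realType.
Implicit Types a g x y : R.

Lemma powR_le1 a x : 0 <= a -> 0 <= x <= 1 -> x `^ a <= 1.
Proof.
move=> a0 /andP[x0 x1]; have <- : (1 : R) `^ a = 1 by rewrite powR1.
by rewrite ge0_ler_powR// nnegrE.
Qed.

Lemma powR_le_powR a x y : 0 <= a -> 0 <= x -> x <= y -> x `^ a <= y `^ a.
Proof. by move=> a0 x0 xy; rewrite ge0_ler_powR// nnegrE// (le_trans x0). Qed.

Lemma powR_exp_le a g x : 0 < g -> g <= a -> 0 <= x <= 1 -> x `^ a <= x `^ g.
Proof.
move=> g0 ga /andP[x0 x1]; have [->|xn0] := eqVneq x 0.
  by rewrite !powR0 ?gt_eqF// (lt_le_trans g0).
by apply: ger_powR => //; rewrite x1 lt_def xn0 x0.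
Qed.

(** Each share [u / (x + y)] lies in [0, 1] and only grows when raised to a power [g <= 1]; the two
    shares add up to 1. *)
Lemma powR_subadd g x y : 0 < g <= 1 -> 0 <= x -> 0 <= y ->
  (x + y) `^ g <= x `^ g + y `^ g.
Proof.
move=> /andP[g0 g1] x0 y0; have [xy0|xyn0] := eqVneq (x + y) 0.
  by rewrite xy0 powR0 ?gt_eqF// addr_ge0 ?powR_ge0.
have t0 : 0 < x + y by rewrite lt_def xyn0 addr_ge0.
have part u : 0 <= u <= x + y -> u / (x + y) * (x + y) `^ g <= u `^ g.
  move=> /andP[u0 ut]; have [->|un0] := eqVneq u 0.
    by rewrite !mul0r powR_ge0.
  rewrite -[in leRHS](divfK xyn0 u) powRM ?divr_ge0 ?(ltW t0)//.
  rewrite ler_wpM2r ?powR_ge0// ger1_powR//.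
  have u1 : 0 < u by rewrite lt_def un0.
  by rewrite divr_gt0//= ler_pdivrMr// mul1r.
have := lerD (part x _) (part y _); rewrite -mulrDl -mulrDl divff// mul1r.
by apply; rewrite ?x0 ?y0 /= ?lerDl ?lerDr.
Qed.

Lemma powR_dist g x y : 0 < g <= 1 -> 0 <= x -> 0 <= y ->
  `|x `^ g - y `^ g| <= `|x - y| `^ g.
Proof.
move=> g01; wlog xy : x y / y <= x => [hw x0 y0|x0 y0].
  by have [|/ltW] := leP y x => h; [|rewrite distrC (distrC x)]; exact: hw.
have g0 : 0 <= g by have /andP[/ltW] := g01.
rewrite ger0_norm ?subr_ge0 ?powR_le_powR// ger0_norm ?subr_ge0//.
by rewrite lerBlDl -{1}(subrKC y x) powR_subadd// subr_ge0.
Qed.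

Lemma expr_lip n x y : 0 <= x <= 1 -> 0 <= y <= 1 ->
  `|x ^+ n - y ^+ n| <= n%:R * `|x - y|.
Proof.
move=> /andP[x0 x1] /andP[y0 y1]; elim: n => [|n ih].
  by rewrite subrr normr0 mul0r.
have -> : x ^+ n.+1 - y ^+ n.+1 = x * (x ^+ n - y ^+ n) + (x - y) * y ^+ n.
  by rewrite !exprS; ring.
rewrite (le_trans (ler_normD _ _))// -natr1 [leRHS]mulrDl mul1r lerD//.
  by rewrite normrM (le_trans _ ih)// (ger0_norm x0) ler_piMl.
by rewrite normrM ler_piMr// ger0_norm ?exprn_ge0// exprn_ile1.
Qed.

(* The exponents are compared through an integer [n >= a / g]: Bernoulli for
   [n] bounds [b ^ (a/g) - c ^ (a/g)] by [n (b - c)] when [0 <= c <= b <= 1]. *)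
Lemma powR_holder a g : 0 < g <= 1 -> g <= a ->
  exists2 M, 0 <= M & forall x y, 0 <= x <= 1 -> 0 <= y <= 1 ->
    `|x `^ a - y `^ a| <= M * `|x - y| `^ g.
Proof.
move=> g01 ga; have /andP[g0 g1] := g01.
pose n := (Num.truncn (a / g)).+1; exists n%:R => // x y.
have nag : a / g <= n%:R by rewrite ltW// truncnS_gt.
have b1 : 1 <= a / g by rewrite ler_pdivlMr// mul1r.
wlog xy : x y / y <= x => [hw x01 y01|/andP[x0 x1] /andP[y0 y1]].
  by have [|/ltW] := leP y x => h; [|rewrite distrC (distrC x)]; exact: hw.
have a0 : 0 < a by exact: lt_le_trans ga.
have [x00|xn0] := eqVneq x 0.
  have -> : y = x by apply/eqP; rewrite eq_le xy x00 y0.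
  by rewrite subrr normr0 mulr_ge0 ?powR_ge0.
have xg0 : 0 < x by rewrite lt_def xn0.
rewrite (le_trans _ (ler_wpM2l _ (powR_dist g01 x0 y0)))//.
rewrite !ger0_norm ?subr_ge0 ?powR_le_powR ?(ltW g0) ?(ltW a0)//.
pose r := (y / x) `^ g.
have yx01 : 0 <= y / x <= 1.
  by rewrite divr_ge0// ler_pdivrMr// mul1r.
have yE c : y `^ c = x `^ c * (y / x) `^ c.
  by rewrite -powRM ?divr_ge0// mulrC divfK.
have r01 : 0 <= r <= 1 by rewrite powR_ge0 powR_le1// ltW.
rewrite (yE a) (yE g) -/r.
have rn : r ^+ n <= (y / x) `^ a.
  rewrite -powR_mulrn ?powR_ge0// -powRrM.
  by apply: powR_exp_le => //; rewrite mulrC -ler_pdivrMr.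
have H1 : 1 - (y / x) `^ a <= n%:R * (1 - r).
  have := @expr_lip n 1 r; rewrite ler01 lexx => /(_ isT r01).
  have /andP[_ r1] := r01.
  rewrite ger0_norm ?subr_ge0 ?expr1n; last by rewrite exprn_ile1//; case/andP: r01.
  by rewrite ger0_norm ?subr_ge0//; apply: le_trans; rewrite lerD2l lerN2.
have -> : x `^ a - x `^ a * (y / x) `^ a = x `^ a * (1 - (y / x) `^ a) by ring.
have -> : n%:R * (x `^ g - x `^ g * r) = x `^ g * (n%:R * (1 - r)) by ring.
rewrite ler_pM ?powR_ge0// ?subr_ge0 ?powR_le1 ?(ltW a0)//.
by rewrite powR_exp_le// x0.
Qed.

(** Retracts the line onto [0, 1]. Through it, functions on the interval become continuous functions
    on the line, for the intermediate value theorem and for measurability. *)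
Definition clamp x : R := Num.max 0 (Num.min 1 x).

Lemma clamp01 x : 0 <= clamp x <= 1.
Proof. by rewrite /clamp le_max lexx /= ge_max ler01 /= ge_min lexx. Qed.

Lemma clamp_id x : 0 <= x <= 1 -> clamp x = x.
Proof. by move=> /andP[x0 x1]; rewrite /clamp min_r// max_r. Qed.

Lemma clamp_lip x y : `|clamp x - clamp y| <= `|x - y|.
Proof.
rewrite /clamp !maxEle !minEle.
have [h|h] := lerP 0 (x - y); [rewrite (ger0_norm h)|rewrite (ltr0_norm h)];
  case: (leP 1 x) => ?; case: (leP 1 y) => ?; rewrite ?ler01;
  repeat case: (leP 0 _) => ?; rewrite ler_norml; apply/andP; split; lra.
Qed.

Lemma holder_continuous (f : R -> R) g M : 0 < g ->
  (forall x y, `|f x - f y| <= M * `|x - y| `^ g) -> continuous f.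
Proof.
move=> g0 fM x; apply/cvgrPdist_lt => e e0.
have M1 : 0 < `|M| + 1 by rewrite ltr_wpDl.
pose d := (e / (`|M| + 1)) `^ g^-1.
have d0 : 0 < d by apply: powR_gt0; exact: divr_gt0.
near=> y; rewrite (le_lt_trans (fM _ _))//.
have xyd : `|x - y| < d by near: y; exact: cvgr_dist_lt.
apply: (@le_lt_trans _ _ (`|M| * `|x - y| `^ g)).
  by rewrite ler_wpM2r ?powR_ge0// ler_norm.
apply: (@le_lt_trans _ _ ((`|M|) * (e / (`|M| + 1)))).
  rewrite ler_wpM2l//; apply: (le_trans (powR_le_powR (ltW g0) _ (ltW xyd))) => //.
  by rewrite /d -powRrM mulVf ?gt_eqF// powRr1// divr_ge0// ltW.
by rewrite mulrCA gtr_pMr// ltr_pdivrMr// mul1r ltrDl.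
Unshelve. all: by end_near. Qed.

End RealPowers.

Section InverseBranches.
Variables (R : realType) (alpha : R).
Hypothesis alpha_gt0 : 0 < alpha.
Local Notation I := (I01 R).
Local Notation f := (@intermittent_map R alpha).

(** The map before reduction modulo 1. It increases from 0 to 2 on the interval, so a single inverse
    of it yields both inverse branches. *)
Definition lift_fun (x : R) : R := x * (1 + x `^ alpha).
Local Notation F := lift_fun.

Lemma lift_fun_gap x y : 0 <= x -> x <= y ->
  (y - x) * (1 + x `^ alpha) <= F y - F x.
Proof.
move=> x0 xy; have := powR_le_powR (ltW alpha_gt0) x0 xy.
have := powR_ge0 x alpha; rewrite /F => a0 ab.
have : 0 <= y * (y `^ alpha - x `^ alpha).
  by rewrite mulr_ge0 ?subr_ge0// (le_trans x0).
nra.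
Qed.

(** This makes 0 the worst place for the inverse: by [lift_inv_subadd], two points at distance [d]
    have inverse images at distance at most [lift_inv d]. *)
Lemma lift_fun_superadd x y : 0 <= x -> x <= y -> F (y - x) <= F y - F x.
Proof.
move=> x0 xy; have yx0 : 0 <= y - x by rewrite subr_ge0.
have := powR_le_powR (ltW alpha_gt0) x0 xy.
have := @powR_le_powR _ _ _ y (ltW alpha_gt0) yx0 ltac:(by rewrite gerBl).
rewrite /F => h1 h2.
have : 0 <= x * (y `^ alpha - x `^ alpha) by rewrite mulr_ge0 ?subr_ge0.
have : 0 <= (y - x) * (y `^ alpha - (y - x) `^ alpha).
  by rewrite mulr_ge0 ?subr_ge0.
nra.
Qed.

Lemma lift_fun0 : F 0 = 0. Proof. by rewrite /F mul0r. Qed.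

Lemma lift_fun1 : F 1 = 2. Proof. by rewrite /F powR1 mul1r. Qed.

Lemma lift_fun_le x y : 0 <= x -> x <= y -> F x <= F y.
Proof.
move=> x0 xy; rewrite -subr_ge0 (le_trans _ (lift_fun_gap x0 xy))//.
by rewrite mulr_ge0 ?subr_ge0// addr_ge0 ?powR_ge0.
Qed.

Lemma lift_fun_lt x y : 0 <= x -> x < y -> F x < F y.
Proof.
move=> x0 xy; rewrite -subr_gt0 (lt_le_trans _ (lift_fun_gap x0 (ltW xy)))//.
by rewrite mulr_gt0 ?subr_gt0// ltr_wpDr ?powR_ge0.
Qed.

Lemma lift_fun_inj x y : 0 <= x -> 0 <= y -> F x = F y -> x = y.
Proof.
move=> x0 y0 Fxy; case: (ltgtP x y) => // h.
  by have := lift_fun_lt x0 h; rewrite Fxy ltxx.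
by have := lift_fun_lt y0 h; rewrite Fxy ltxx.
Qed.

Lemma lift_fun_surj t : 0 <= t <= 2 -> exists x, 0 <= x <= 1 /\ F x = t.
Proof.
move=> t02.
(* [powR_holder] accepts exponents up to 1 only; hence the minimum. *)
have g01 : 0 < Num.min alpha 1 <= 1 by rewrite lt_min alpha_gt0 ltr01 ge_min lexx orbT.
have ga : Num.min alpha 1 <= alpha by rewrite ge_min lexx.
have [M M0 HM] := powR_holder g01 ga.
have cp : continuous (fun x : R => (clamp x) `^ alpha).
  apply: (@holder_continuous R _ (Num.min alpha 1) M) => [|x y].
    by case/andP: g01.
  apply: (le_trans (HM _ _ (clamp01 x) (clamp01 y))).
  by rewrite ler_wpM2l// powR_le_powR ?clamp_lip//; case/andP: g01 => /ltW.
pose F' x : R := x * (1 + (clamp x) `^ alpha).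
have cF : continuous F'.
  by move=> x; apply: cvgM => //; apply: cvgD => //; [exact: cvg_cst|exact: cp].
have FE x : 0 <= x <= 1 -> F' x = F x by move=> x01; rewrite /F' clamp_id.
have F0 : F' 0 = 0 by rewrite FE ?lift_fun0// lexx ler01.
have F1 : F' 1 = 2 by rewrite FE ?lift_fun1// lexx ler01.
have [||c cI <-] := @IVT _ F' 0 1 t ler01.
- exact: continuous_subspaceT.
- by rewrite F0 F1 min_l// max_r.
by exists c; move: cI; rewrite in_itv /= => cI; rewrite -FE.
Qed.

Definition lift_inv (t : R) : R := xget 0 [set x | 0 <= x <= 1 /\ F x = t].
Local Notation E := lift_inv.

Lemma lift_invP t : 0 <= t <= 2 -> 0 <= E t <= 1 /\ F (E t) = t.
Proof.
move=> /lift_fun_surj[x xP]; rewrite /E.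
by case: xgetP => [y _ //|/(_ x) /(_ xP)].
Qed.

Lemma lift_inv01 t : 0 <= t <= 2 -> 0 <= E t <= 1.
Proof. by move/lift_invP => []. Qed.

Lemma lift_invK t : 0 <= t <= 2 -> F (E t) = t.
Proof. by move/lift_invP => []. Qed.

Lemma lift_funK x : 0 <= x <= 1 -> E (F x) = x.
Proof.
move=> x01; have /andP[x0 x1] := x01.
have Fx : 0 <= F x <= 2.
  by rewrite -lift_fun1 lift_fun_le// andbT mulr_ge0// addr_ge0// powR_ge0.
have [/andP[e0 _] eE] := lift_invP Fx.
exact: lift_fun_inj eE.
Qed.

Lemma lift_inv_le s t : 0 <= s -> s <= t -> t <= 2 -> E s <= E t.
Proof.
move=> s0 st t2.
have [/andP[Es0 Es1] Es] := @lift_invP s ltac:(by rewrite s0 (le_trans st)).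
have [/andP[Et0 Et1] Et] := @lift_invP t ltac:(by rewrite (le_trans s0)).
by rewrite leNgt; apply/negP => /(lift_fun_lt Et0); rewrite Es Et ltNge st.
Qed.

Lemma lift_inv_lt s t : 0 <= s -> s < t -> t <= 2 -> E s < E t.
Proof.
move=> s0 st t2; rewrite lt_neqAle lift_inv_le ?(ltW st)// andbT.
apply/eqP => /(congr1 F); rewrite !lift_invK ?s0 ?(le_trans (ltW st))//.
  by move=> e; rewrite e ltxx in st.
by rewrite (le_trans s0 (ltW st)).
Qed.

Lemma lift_inv_gap s t : 0 <= s -> s <= t -> t <= 2 ->
  (E t - E s) * (1 + E s `^ alpha) <= t - s.
Proof.
move=> s0 st t2.
have [/andP[Es0 Es1] Es] := @lift_invP s ltac:(by rewrite s0 (le_trans st)).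
have [/andP[Et0 Et1] Et] := @lift_invP t ltac:(by rewrite (le_trans s0)).
by have := lift_fun_gap Es0 (lift_inv_le s0 st t2); rewrite Es Et.
Qed.

Lemma lift_inv_subadd s t : 0 <= s -> s <= t -> t <= 2 -> E t - E s <= E (t - s).
Proof.
move=> s0 st t2; have Est := lift_inv_le s0 st t2.
have [/andP[Es0 Es1] Es] := @lift_invP s ltac:(by rewrite s0 (le_trans st)).
have [/andP[Et0 Et1] Et] := @lift_invP t ltac:(by rewrite (le_trans s0)).
have ts2 : 0 <= t - s <= 2 by rewrite subr_ge0 st lerBlDr (le_trans t2)// lerDl.
have [/andP[u0 u1] Eu] := lift_invP ts2.
rewrite leNgt; apply/negP => /(lift_fun_lt u0); rewrite Eu ltNge => /negP; apply.
by have := lift_fun_superadd Es0 Est; rewrite Es Et.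
Qed.

Lemma lift_inv0 : E 0 = 0.
Proof. by rewrite -[in LHS]lift_fun0 lift_funK// lexx ler01. Qed.

Lemma lift_inv2 : E 2 = 1.
Proof. by rewrite -lift_fun1 lift_funK// lexx ler01. Qed.

Lemma lift_inv_le_id t : 0 <= t <= 2 -> E t <= t.
Proof.
move=> t02; have [/andP[e0 _] eE] := lift_invP t02.
by rewrite -[leRHS]eE /F ler_peMr// lerDl powR_ge0.
Qed.

Lemma I01P (x : I) : 0 <= val x <= 1.
Proof. by have := valP x; rewrite inE /= in_itv. Qed.

Definition toI (t : R) : I := insubd (I01_zero R) t.

Lemma val_toI t : 0 <= t <= 1 -> val (toI t) = t.
Proof. by move=> t01; apply: insubdK; rewrite inE /= in_itv. Qed.

Lemma toI_val (x : I) : toI (val x) = x.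
Proof. by apply: val_inj; rewrite val_toI// I01P. Qed.

Definition branch (b : bool) (x : I) : I := toI (E (b%:R + val x)).

Lemma branch_dom (b : bool) (x : I) : 0 <= b%:R + val x <= 2.
Proof.
have /andP[x0 x1] := I01P x.
have b1 : (b%:R : R) <= 1 by rewrite lern1 leq_b1.
by rewrite addr_ge0//= (le_trans (lerD b1 x1)).
Qed.
Hint Resolve branch_dom : core.

Lemma val_branch b (x : I) : val (branch b x) = E (b%:R + val x).
Proof. by rewrite val_toI// lift_inv01. Qed.

Lemma lift_branch b (x : I) : F (val (branch b x)) = b%:R + val x.
Proof. by rewrite val_branch lift_invK. Qed.

Lemma branch_le b (x y : I) : val x <= val y ->
  val (branch b x) <= val (branch b y).
Proof.
move=> xy; rewrite !val_branch lift_inv_le ?lerD2l//.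
  by have /andP[] := branch_dom b x.
by have /andP[] := branch_dom b y.
Qed.

Lemma branch_gap b (x y : I) : val x <= val y ->
  (val (branch b y) - val (branch b x)) * (1 + val (branch b x) `^ alpha) <=
  val y - val x.
Proof.
move=> xy; rewrite !val_branch.
have -> : val y - val x = (b%:R + val y) - (b%:R + val x) by ring.
have /andP[? ?] := branch_dom b x; have /andP[? ?] := branch_dom b y.
by apply: lift_inv_gap => //; rewrite lerD2l.
Qed.

Lemma branch_dist b (x y : I) :
  `|val (branch b x) - val (branch b y)| <= E `|val x - val y|.
Proof.
wlog xy : x y / val y <= val x => [hw|].
  by have [|/ltW] := leP (val y) (val x) => h; [|rewrite distrC (distrC (val x))]; exact: hw.
rewrite !ger0_norm ?subr_ge0 ?branch_le// !val_branch.
have -> : val x - val y = (b%:R + val x) - (b%:R + val y) by ring.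
have /andP[? ?] := branch_dom b x; have /andP[? ?] := branch_dom b y.
by apply: lift_inv_subadd => //; rewrite lerD2l.
Qed.

Lemma I01_dist1 (x y : I) : `|val x - val y| <= 1.
Proof.
have /andP[? ?] := I01P x; have /andP[? ?] := I01P y.
by rewrite ler_norml; apply/andP; split; lra.
Qed.

Lemma branch_lip b (x y : I) :
  `|val (branch b x) - val (branch b y)| <= `|val x - val y|.
Proof.
rewrite (le_trans (branch_dist b x y))// lift_inv_le_id// normr_ge0 /=.
by rewrite (le_trans (I01_dist1 x y))// ler1n.
Qed.

(** Strict, as in the map: the point with [lift_fun x = 1] belongs to the left half and is sent to
    1. *)
Definition right_half (x : I) : bool := 1 < F (val x).

Lemma val_map (x : I) : val (f x) = F (val x) - (right_half x)%:R.
Proof.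
rewrite val_intermittent_map// /intermittent_fun -/(F (val x)) /right_half.
by case: (ltP 1 (F (val x))) => _; rewrite ?subr0.
Qed.

Lemma branch_map (x : I) : branch (right_half x) (f x) = x.
Proof.
apply: val_inj; rewrite val_branch val_map.
by rewrite addrC subrK lift_funK// I01P.
Qed.

Lemma right_half_branch b (x : I) : 0 < val x -> right_half (branch b x) = b.
Proof.
move=> x0; rewrite /right_half lift_branch; case: b => /=.
  by rewrite ltrDl.
by rewrite add0r ltNge; have /andP[_ ->] := I01P x.
Qed.

(** At [x = 0] the right branch gives the point where the lift equals 1, which the map sends to 1
    and not to 0. This is why 0 has to be shown null later, in [mean_indic0]. *)
Lemma map_branch b (x : I) : 0 < val x -> f (branch b x) = x.
Proof.
move=> x0; apply: val_inj.
by rewrite val_map right_half_branch// lift_branch addrC addKr.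
Qed.

Lemma branch_gt0 b (x : I) : 0 < val x -> 0 < val (branch b x).
Proof.
move=> x0; rewrite val_branch -[ltLHS]lift_inv0 lift_inv_lt//.
  by rewrite (lt_le_trans x0)// lerDr.
by have /andP[] := branch_dom b x.
Qed.

Lemma branch_true_gt0 (x : I) : 0 < val (branch true x).
Proof.
rewrite val_branch -[ltLHS]lift_inv0 lift_inv_lt//.
  by rewrite ltr_wpDr//; have /andP[] := I01P x.
by have /andP[] := branch_dom true x.
Qed.

Lemma lift_inv1_gt0 : 0 < E 1.
Proof. by rewrite -lift_inv0 lift_inv_lt// ler1n. Qed.

Lemma branch_true_ge (x : I) : E 1 <= val (branch true x).
Proof.
have /andP[x0 x1] := I01P x.
by rewrite val_branch lift_inv_le ?lerDl//; case/andP: (branch_dom true x).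
Qed.

(** The length of the leftmost cylinder of order [n], which bounds the diameters of all cylinders of
    that order ([tword_dist]). *)
Definition cyl_diam (n : nat) : R := iter n E 1.

Lemma cyl_diam01 n : 0 <= cyl_diam n <= 1.
Proof.
elim: n => [|n /andP[ih0 ih1]] /=; first by rewrite ler01 lexx.
by rewrite lift_inv01// ih0 (le_trans ih1)// ler1n.
Qed.

(** Contraction is not exponential. But [cyl_diam n = lift_fun (cyl_diam n.+1)], so as long as the
    diameter stays above [e] each step removes at least [e * e ^ alpha], which can happen only
    finitely often. *)
Lemma cyl_diam_cvg0 e : 0 < e -> exists n0, forall n, (n0 <= n)%N -> cyl_diam n < e.
Proof.
move=> e0; pose c := e * e `^ alpha.
have c0 : 0 < c by rewrite mulr_gt0// powR_gt0.
have dec n : cyl_diam n.+1 <= cyl_diam n.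
  rewrite /= lift_inv_le_id//; have /andP[-> h] := cyl_diam01 n.
  by rewrite (le_trans h)// ler1n.
have step n : e <= cyl_diam n.+1 -> c <= cyl_diam n - cyl_diam n.+1.
  move=> en; have /andP[d0 d1] := cyl_diam01 n.
  have d02 : 0 <= cyl_diam n <= 2 by rewrite d0 (le_trans d1)// ler1n.
  rewrite -{1}(lift_invK d02) -/(cyl_diam n.+1) /F mulrDr mulr1 addrC addKr.
  rewrite /c ler_pM ?powR_ge0 ?(ltW e0)//.
  by rewrite powR_le_powR// ltW.
have tot n : e <= cyl_diam n -> cyl_diam n <= 1 - n%:R * c.
  elim: n => [|n ih] en; first by rewrite mul0r subr0.
  have := ih (le_trans en (dec n)); have := step _ en.
  by rewrite -nat1r mulrDl mul1r; lra.
pose n0 := (Num.truncn c^-1).+1; exists n0 => n n0n.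
apply: (@le_lt_trans _ _ (cyl_diam n0)).
  by move: n0n; apply: (nonincreasing_seqP _).1.
rewrite ltNge; apply/negP => /[dup] /tot h en.
have : 1 < n0%:R * c by rewrite -ltr_pdivrMr// mul1r truncnS_gt.
by move: (lt_le_trans e0 en); lra.
Qed.

End InverseBranches.

(** * Bounded measurable functions *)

Section BoundedMeasurable.
Variables (d : measure_display) (T : measurableType d) (R : realType).
Implicit Types (psi chi : T -> R) (A : set T).

Definition bmeas psi := measurable_fun setT psi /\ exists M, forall x, `|psi x| <= M.

Lemma bmeas_cst (c : R) : bmeas (fun=> c).
Proof. by split=> //; exists `|c|. Qed.

Lemma bmeasD psi chi : bmeas psi -> bmeas chi -> bmeas (fun x => psi x + chi x).
Proof.
move=> [mp [M pM]] [mc [N cN]]; split; first exact: measurable_funD.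
by exists (M + N) => x; rewrite (le_trans (ler_normD _ _))// lerD.
Qed.

Lemma bmeasM psi chi : bmeas psi -> bmeas chi -> bmeas (fun x => psi x * chi x).
Proof.
move=> [mp [M pM]] [mc [N cN]]; split; first exact: measurable_funM.
by exists (M * N) => x; rewrite normrM ler_pM.
Qed.

Lemma bmeasZ (c : R) psi : bmeas psi -> bmeas (fun x => c * psi x).
Proof. exact/bmeasM/bmeas_cst. Qed.

Lemma bmeasN psi : bmeas psi -> bmeas (fun x => - psi x).
Proof.
move=> [mp [M pM]]; split; first exact: measurable_funN.
by exists M => x; rewrite normrN.
Qed.

Lemma bmeasB psi chi : bmeas psi -> bmeas chi -> bmeas (fun x => psi x - chi x).
Proof. by move=> bp bc; apply: bmeasD => //; exact: bmeasN. Qed.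

Lemma bmeas_sum (J : Type) (s : seq J) (psi : J -> T -> R) :
  (forall j, bmeas (psi j)) -> bmeas (fun x => \sum_(j <- s) psi j x).
Proof.
move=> bp; elim: s => [|j s ih].
  by under [X in bmeas X]funext do rewrite big_nil; exact: bmeas_cst.
by under [X in bmeas X]funext do rewrite big_cons; exact: bmeasD.
Qed.

Lemma bmeas_indic A : measurable A -> bmeas (\1_A : T -> R).
Proof.
move=> mA; split; first exact: measurable_indic.
by exists 1 => x; rewrite indicE; case: (x \in A); rewrite ?normr0 ?normr1.
Qed.

Section Mean.
Variable nu : probability T R.
Local Notation mean psi := (\int[nu]_x psi x).

Lemma bmeas_integrable psi : bmeas psi -> nu.-integrable setT (EFin \o psi).
Proof.
move=> [mp [M pM]]; apply: measurable_bounded_integrable => //.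
  by rewrite [X in (X < _)%E](@probability_setT _ _ _ nu) ltry.
exists M; split; first exact: num_real.
by move=> N MN x _ /=; rewrite (le_trans (pM x))// ltW.
Qed.

Lemma mean_EFin psi : bmeas psi -> (\int[nu]_x (psi x)%:E)%E = (mean psi)%:E.
Proof.
by move=> /bmeas_integrable ip; rewrite /Rintegral fineK// integrable_fin_num.
Qed.

Lemma mean_cst (c : R) : mean (fun=> c) = c.
Proof.
by rewrite Rintegral_cst// [X in fine X](@probability_setT _ _ _ nu) mulr1.
Qed.

Lemma meanD psi chi : bmeas psi -> bmeas chi ->
  mean (fun x => psi x + chi x) = mean psi + mean chi.
Proof. by move=> bp bc; rewrite RintegralD//; exact: bmeas_integrable. Qed.

Lemma meanB psi chi : bmeas psi -> bmeas chi ->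
  mean (fun x => psi x - chi x) = mean psi - mean chi.
Proof. by move=> bp bc; rewrite RintegralB//; exact: bmeas_integrable. Qed.

Lemma meanZ (c : R) psi : bmeas psi -> mean (fun x => c * psi x) = c * mean psi.
Proof. by move=> bp; rewrite RintegralZl//; exact: bmeas_integrable. Qed.

Lemma mean_sum (J : Type) (s : seq J) (psi : J -> T -> R) :
  (forall j, bmeas (psi j)) ->
  mean (fun x => \sum_(j <- s) psi j x) = \sum_(j <- s) mean (psi j).
Proof.
move=> bp; elim: s => [|j s ih].
  rewrite big_nil -[RHS](mean_cst 0); apply: eq_Rintegral => x _.
  by rewrite big_nil.
rewrite big_cons -ih -meanD//; last exact: bmeas_sum.
by apply: eq_Rintegral => x _; rewrite big_cons.
Qed.

Lemma le_mean psi chi : bmeas psi -> bmeas chi ->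
  (forall x, psi x <= chi x) -> mean psi <= mean chi.
Proof. by move=> bp bc pc; apply: le_Rintegral => //; exact: bmeas_integrable. Qed.

Lemma mean_le psi c : bmeas psi -> (forall x, psi x <= c) -> mean psi <= c.
Proof. by move=> bp pc; rewrite -[leRHS]mean_cst le_mean//; exact: bmeas_cst. Qed.

Lemma mean_ge psi c : bmeas psi -> (forall x, c <= psi x) -> c <= mean psi.
Proof. by move=> bp pc; rewrite -[leLHS]mean_cst le_mean//; exact: bmeas_cst. Qed.

Lemma norm_mean_le psi c : bmeas psi -> (forall x, `|psi x| <= c) -> `|mean psi| <= c.
Proof.
move=> bp pc; rewrite ler_norml mean_ge ?mean_le// => x.
  by rewrite (le_trans (ler_norm _)).
by rewrite lerNl (le_trans _ (pc x))// -normrN ler_norm.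
Qed.

Lemma mean_indic A : measurable A -> mean (\1_A) = fine (nu A).
Proof. by move=> mA; rewrite /Rintegral integral_indic// setIT. Qed.

Lemma prob_fine A : measurable A -> nu A = (fine (nu A))%:E.
Proof. by move=> mA; rewrite fineK// fin_num_measure. Qed.

Lemma mean_cvg (psi_ : nat -> T -> R) psi M :
  (forall n, measurable_fun setT (psi_ n)) -> (forall n x, `|psi_ n x| <= M) ->
  (forall x, psi_ n x @[n --> \oo] --> psi x) ->
  bmeas psi /\ mean (psi_ n) @[n --> \oo] --> mean psi.
Proof.
move=> mp pM pc.
have mpsi : measurable_fun setT psi.
  by apply: (@measurable_fun_cvg _ _ _ setT psi_) => // x _; exact: pc.
have bp n : bmeas (psi_ n) by split=> //; exists M.
have pM' x : `|psi x| <= M.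
  have h : `|psi_ n x| @[n --> \oo] --> `|psi x| by apply: cvg_norm; exact: pc.
  by apply: (cvgr_to_le h); near=> n; exact: pM.
have bpsi : bmeas psi by split=> //; exists M.
split=> //.

have : (\int[nu]_x (psi_ n x)%:E)%E @[n --> \oo] --> (\int[nu]_x (psi x)%:E)%E.
  apply: (@dominated_cvg _ _ _ nu setT measurableT
     (fun n => EFin \o psi_ n) (EFin \o psi) (EFin \o (fun=> M))) => //.
  - by move=> n; apply/measurable_EFinP.
  - by move=> x _; apply: cvg_EFin; [near=> n|exact: pc].
  - exact/bmeas_integrable/bmeas_cst.
  - by move=> n x _ /=; rewrite lee_fin.
rewrite mean_EFin//; under eq_fun do rewrite mean_EFin//.
by move=> /fine_cvg.
Unshelve. all: by end_near. Qed.

Lemma mean_comp (f : T -> T) psi : measurable_fun setT f ->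
  invariant_measure f nu -> bmeas psi -> mean (psi \o f) = mean psi.
Proof.
move=> mf inv bp; congr fine.
rewrite -[RHS](@eq_measure_integral _ _ _ setT nu (pushforward nu f)); last first.
  by move=> A mA _; exact: inv.
rewrite integral_pushforward//.
- by apply/measurable_EFinP; case: bp.
- rewrite preimage_setT; apply: bmeas_integrable; case: bp => mp [M pM].
  by split; [exact: measurableT_comp|exists M => x; exact: pM].
Qed.

End Mean.

Section FiniteValued.
Variable W : choiceType.
Implicit Type X : T -> W.

(** Measurability of all preimages is required outright, so that words, pairs and finite functions
    can be values without carrying a sigma-algebra. *)
Definition finmeas X := (exists s : seq W, forall x, X x \in s) /\
  forall B : set W, measurable (X @^-1` B).

Lemma finmeas_fibers X (s : seq W) : (forall x, X x \in s) ->
  (forall w, measurable [set x | X x = w]) -> finmeas X.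
Proof.
move=> Xs mX; split; first by exists s.
move=> B; have -> : X @^-1` B =
    \big[setU/set0]_(w <- s) (if `[< B w >] then [set x | X x = w] else set0).
  apply/seteqP; split=> [x /= BX|x]; rewrite -bigcup_seq /=.
    by exists (X x) => /=; [exact: Xs|case: asboolP].
  by move=> [w /= ws]; case: asboolP => // Bw /= ->.
by apply: bigsetU_measurable => w _; case: asboolP => // _; exact: measurable0.
Qed.

Lemma bmeas_finmeas X (g : W -> R) : finmeas X -> bmeas (g \o X).
Proof.
move=> [[s Xs] mX]; split; first by move=> _ B mB; rewrite setTI comp_preimage.
exists (\sum_(w <- s) `|g w|) => x /=.
by rewrite (perm_big _ (perm_to_rem (Xs x))) big_cons lerDl sumr_ge0.
Qed.

End FiniteValued.

Lemma finmeas_comp (W V : choiceType) (X : T -> W) (g : W -> V) :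
  finmeas X -> finmeas (g \o X).
Proof.
move=> [[s Xs] mX]; split; last by move=> B; rewrite comp_preimage.
by exists (map g s) => x; apply/mapP; exists (X x).
Qed.

Lemma finmeas_pair (W V : choiceType) (X : T -> W) (Y : T -> V) :
  finmeas X -> finmeas Y -> finmeas (fun x => (X x, Y x)).
Proof.
move=> [[s Xs] mX] [[t Yt] mY].
apply: (@finmeas_fibers _ _ (allpairs pair s t)) => [x|[w v]].
  exact: allpairs_f.
have -> : [set x | (X x, Y x) = (w, v)] =
    (X @^-1` [set w]) `&` (Y @^-1` [set v]).
  by apply/seteqP; split=> x /= [-> ->].
by apply: measurableI.
Qed.

Lemma finmeas_precomp (W : choiceType) (X : T -> W) (f : T -> T) :
  measurable_fun setT f -> finmeas X -> finmeas (X \o f).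
Proof.
move=> mf [[s Xs] mX]; split; first by exists s => x; exact: Xs.
by move=> B; rewrite comp_preimage -[X in measurable X]setTI; apply: mf.
Qed.

Lemma finmeas_fin (J : finType) (X : T -> J) :
  (forall j, measurable [set x | X x = j]) -> finmeas X.
Proof. by apply: (@finmeas_fibers _ _ (enum J)) => x; rewrite mem_enum. Qed.

Lemma mean_finmeas (nu : probability T R) (J : finType) (X : T -> J) (g : J -> R) :
  finmeas X ->
  \int[nu]_x g (X x) = \sum_j g j * fine (nu [set x | X x = j]).
Proof.
move=> [_ mX]; have bi j : bmeas (\1_[set x | X x = j] : T -> R).
  exact/bmeas_indic/(mX [set j]).
transitivity (\int[nu]_x (\sum_j g j * \1_[set x | X x = j] x)).
  apply: eq_Rintegral => x _; rewrite (bigD1 (X x))//= indicE mem_set// mulr1.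
  rewrite big1 ?addr0// => j jX; rewrite indicE memNset ?mulr0//= => e.
  by rewrite e eqxx in jX.
rewrite mean_sum; last by move=> j; exact: bmeasZ.
by apply: eq_bigr => j _; rewrite meanZ// mean_indic//; exact: (mX [set j]).
Qed.

End BoundedMeasurable.

Section UnitIntervalMeasurability.
Variables (R : realType) (alpha : R).
Hypothesis alpha_gt0 : 0 < alpha.
Local Notation I := (I01 R).
Local Notation f := (@intermittent_map R alpha).

Lemma I01_open_preimage (U : set R) : open U ->
  measurable ((fun x : I => val x) @^-1` U).
Proof. by move=> oU; apply: sub_sigma_algebra; exists U. Qed.

Lemma measurable_val : measurable_fun setT (fun x : I => val x : R).
Proof.
apply: (measurability _ (RGenOpens.measurableE R)).
move=> _ [_ [a [b ->]] <-]; rewrite setTI; apply: I01_open_preimage.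
exact: interval_open.
Qed.

Lemma measurable_to_I01 d (T : measurableType d) (g : T -> I) :
  measurable_fun setT (fun x => val (g x) : R) -> measurable_fun setT g.
Proof.
move=> mg.
apply: (@measurability _ _ T I setT g (@open (set_type (`[0, 1]%classic : set R)))) => //.
move=> _ [_ [U oU <-] <-]; rewrite setTI.
have -> : g @^-1` (set_val @^-1` U) = (fun x => val (g x) : R) @^-1` U by [].
by rewrite -[X in measurable X]setTI; apply: mg => //; exact: open_measurable.
Qed.

Lemma measurable_comp_clamp (g : R -> R) (psi : I -> R) : continuous g ->
  (forall x, psi x = g (val x)) -> measurable_fun setT psi.
Proof.
move=> cg pg; rewrite (_ : psi = g \o (fun x : I => val x)); last exact/funext.
apply: measurableT_comp; last exact: measurable_val.
exact: continuous_measurable_fun.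
Qed.

Lemma holder_measurable g (psi : I -> R) : 0 < g -> is_holder g psi ->
  measurable_fun setT psi.
Proof.
move=> g0 [_ [M psiM]].
apply: (@measurable_comp_clamp (fun t => psi (toI (clamp t)))) => [|x]; last first.
  by rewrite clamp_id ?toI_val// I01P.
apply: (@holder_continuous R _ g (`|M|)) => // x y.
rewrite (le_trans (psiM _ _))// !val_toI ?clamp01//.
apply: (@le_trans _ _ (`|M| * `|clamp x - clamp y| `^ g)).
  by rewrite ler_wpM2r ?powR_ge0// ler_norm.
by rewrite ler_wpM2l// powR_le_powR ?clamp_lip// ltW.
Qed.

Lemma holder_bmeas g (psi : I -> R) : 0 < g -> is_holder g psi -> bmeas psi.
Proof. by move=> g0 hp; split; [exact: holder_measurable hp|case: hp]. Qed.

Lemma measurable_lift : measurable_fun setT (fun x : I => lift_fun alpha (val x)).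
Proof.
apply: (measurableT_comp (f := lift_fun alpha)); last exact: measurable_val.
by apply: measurable_funM => //; exact: measurable_funD.
Qed.

Lemma measurable_right_half : @measurable _ I [set x : I | right_half alpha x].
Proof.
rewrite (_ : [set _ | _] = (fun x : I => lift_fun alpha (val x)) @^-1` `]1, +oo[).
  by rewrite -[X in measurable X]setTI; apply: measurable_lift.
by apply/seteqP; split=> x /=; rewrite /right_half in_itv /= andbT.
Qed.

Lemma finmeas_right_half : finmeas (right_half alpha).
Proof.
have h := measurable_right_half; apply: finmeas_fin => -[]; first exact h.
rewrite (_ : [set x | _] = ~` [set x : I | right_half alpha x]).
  exact: measurableC h.
apply/seteqP; split=> x /=; first by move=> ->.
by move=> /negP /negbTE.
Qed.

Lemma measurable_map : measurable_fun setT f.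
Proof.
apply: measurable_to_I01.
rewrite (_ : (fun x => _) = (fun x : I => lift_fun alpha (val x) -
    (fun b : bool => b%:R : R) (right_half alpha x))); last first.
  by apply/funext => x; rewrite val_map.
apply: measurable_funB; first exact: measurable_lift.
by have [] := bmeas_finmeas (fun b : bool => b%:R : R) finmeas_right_half.
Qed.

Lemma measurable_iter_map n : measurable_fun setT (iter n f).
Proof.
elim: n => [|n ih] /=; first exact: measurable_id.
exact: measurableT_comp measurable_map ih.
Qed.

Lemma measurable_branch b : measurable_fun setT (branch alpha b).
Proof.
apply: measurable_to_I01; apply: (@holder_measurable 1) => //; split.
  by exists 1 => x; have /andP[? ?] := I01P (branch alpha b x); rewrite ger0_norm.
by exists 1 => x y; rewrite mul1r powRr1// branch_lip.
Qed.

Lemma bmeas_comp d (T : measurableType d) (h : T -> I) (psi : I -> R) :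
  measurable_fun setT h -> bmeas psi -> bmeas (psi \o h).
Proof.
move=> mh [mp [M pM]]; split; first exact: measurableT_comp.
by exists M => x; exact: pM.
Qed.

End UnitIntervalMeasurability.

(** * Itineraries *)

Section RealProbability.
Variables (d : measure_display) (T : measurableType d) (R : realType).
Variable nu : probability T R.
Implicit Types A B : set T.

Definition pr A : R := fine (nu A).

Lemma pr_ge0 A : 0 <= pr A.
Proof. by rewrite /pr fine_ge0. Qed.

Lemma pr_le A B : measurable A -> measurable B -> A `<=` B -> pr A <= pr B.
Proof.
move=> mA mB AB; apply: fine_le; rewrite ?fin_num_measure//.
by apply: le_measure; rewrite ?inE.
Qed.

Lemma pr_setU A B : measurable A -> measurable B -> pr (A `|` B) <= pr A + pr B.
Proof.
move=> mA mB; rewrite -lee_fin EFinD -!prob_fine//; last exact: measurableU.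
exact: measureU2.
Qed.

Lemma pr_setD A B : measurable A -> measurable B -> B `<=` A ->
  pr (A `\` B) = pr A - pr B.
Proof.
move=> mA mB BA; apply: EFin_inj; rewrite EFinB -!prob_fine//; last exact: measurableD.
rewrite measureD//; last by rewrite [X in (X < _)%E](prob_fine nu mA) ltry.
by rewrite (setIidr BA).
Qed.

Lemma pr_cvg_bigcup (F : nat -> set T) : (forall n, measurable (F n)) ->
  (forall n, F n `<=` F n.+1) -> forall e, 0 < e ->
  exists n, pr ((\bigcup_n F n) `\` F n) <= e.
Proof.
move=> mF FS e e0; have mU : measurable (\bigcup_n F n) by exact: bigcupT_measurable.
have ndF : nondecreasing_seq F.
  by apply/nondecreasing_seqP => n; apply/subsetPset; exact: FS.
have : (pr (F n))%:E @[n --> \oo] --> (pr (\bigcup_n F n))%:E.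
  rewrite -prob_fine//; under eq_fun do rewrite -prob_fine//.
  exact: (@nondecreasing_cvg_mu _ _ _ nu F mF mU ndF).
move=> /fine_cvg /= /cvgrPdist_le /(_ _ e0) [n _ /(_ n (leqnn n)) /= h].
exists n; rewrite pr_setD//; last exact: bigcup_sup.
exact: le_trans (ler_norm _) h.
Qed.

Lemma pr_bigsetU (J : Type) (s : seq J) (F : J -> set T) :
  (forall j, measurable (F j)) ->
  pr (\big[setU/set0]_(j <- s) F j) <= \sum_(j <- s) pr (F j).
Proof.
move=> mF; elim: s => [|j s ih]; first by rewrite !big_nil /pr measure0.
rewrite !big_cons (le_trans (pr_setU _ _))//; last by rewrite lerD2l.
exact: bigsetU_measurable.
Qed.

Lemma sum_pr (J : finType) (X : T -> J) : finmeas X ->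
  \sum_j pr [set x | X x = j] = 1.
Proof.
move=> fX; rewrite -[RHS](mean_cst nu) (@mean_finmeas _ _ _ nu _ X (fun=> 1))//.
by apply: eq_bigr => j _; rewrite mul1r.
Qed.

End RealProbability.

Section Itineraries.
Variables (R : realType) (alpha : R).
Hypothesis alpha_gt0 : 0 < alpha.
Local Notation I := (I01 R).
Local Notation f := (@intermittent_map R alpha).
Local Notation branch := (branch alpha).
Implicit Types (phi h : I -> R) (x y : I) (w : seq bool).

Fixpoint words n : seq (seq bool) :=
  if n is m.+1 then map (cons false) (words m) ++ map (cons true) (words m)
  else [:: [::]].

Lemma big_words n (F : seq bool -> R) : \sum_(w <- words n.+1) F w =
  \sum_(w <- words n) (F (false :: w) + F (true :: w)).
Proof. by rewrite /= big_cat /= !big_map -big_split. Qed.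

Fixpoint tword w x : I := if w is b :: w' then branch b (tword w' x) else x.

(** The Birkhoff sum over the inverse orbit of [x] coded by [w]. Unlike [birk], it keeps the word
    fixed while [x] varies, which is what distortion compares. *)
Fixpoint bsum phi w x : R :=
  if w is b :: w' then phi (branch b (tword w' x)) + bsum phi w' x else 0.

Fixpoint itin n x : seq bool :=
  if n is m.+1 then right_half alpha x :: itin m (f x) else [::].

Definition birk phi n x : R := \sum_(i < n) phi (iter i f x).

Definition transfer phi h x : R :=
  expR (phi (branch false x)) * h (branch false x) +
  expR (phi (branch true x)) * h (branch true x).

Lemma tword_itin n x : tword (itin n x) (iter n f x) = x.
Proof. by elim: n x => [//|n ih] x; rewrite iterSr /= ih branch_map. Qed.

Lemma size_itin n x : size (itin n x) = n.
Proof. by elim: n x => [//|n ih] x /=; rewrite ih. Qed.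

Lemma itin_words n x : itin n x \in words n.
Proof.
elim: n x => [//|n ih] x /=; rewrite mem_cat.
by case: right_half; rewrite map_f ?orbT.
Qed.

Lemma bsum_itin phi n x : bsum phi (itin n x) (iter n f x) = birk phi n x.
Proof.
rewrite /birk; elim: n x => [|n ih] x; first by rewrite big_ord0.
rewrite big_ord_recl iterSr /= ih tword_itin branch_map//; congr (_ + _).
by apply: eq_bigr => i _; rewrite -iterSr.
Qed.

Lemma drop_itin i n x : (i <= n)%N -> drop i (itin n x) = itin (n - i) (iter i f x).
Proof.
elim: i n x => [|i ih] n x; first by rewrite drop0 subn0.
by case: n => [//|n] lin; rewrite iterSr subSS /= ih.
Qed.

Lemma take_itin m n x : (m <= n)%N -> take m (itin n x) = itin m x.
Proof.
elim: m n x => [|m ih] n x; first by rewrite take0.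
by case: n => [//|n] lmn /=; rewrite ih.
Qed.

Lemma finmeas_itin n : finmeas (itin n).
Proof.
elim: n => [|n ih].
  split; first by exists [:: [::]] => x; rewrite inE.
  move=> B; rewrite preimage_cst; case: ifP => _; first exact: measurableT.
  exact: measurable0.
have := finmeas_pair (finmeas_right_half alpha) (finmeas_precomp (measurable_map alpha_gt0) ih).
exact: (@finmeas_comp _ _ _ _ _ (fun p : bool * seq bool => p.1 :: p.2)).
Qed.

Lemma tword_dist w x y : `|val (tword w x) - val (tword w y)| <= cyl_diam alpha (size w).
Proof.
elim: w => [|b w ih] /=; first exact: I01_dist1.
rewrite (le_trans (branch_dist _ _ _ _))// lift_inv_le//.
by have /andP[_ h] := cyl_diam01 alpha_gt0 (size w); rewrite (le_trans h)// ler1n.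
Qed.

Lemma itin_dist n x y : itin n x = itin n y ->
  `|val x - val y| <= cyl_diam alpha n.
Proof.
move=> xy; have := tword_dist (itin n x) (iter n f x) (iter n f y).
by rewrite size_itin tword_itin xy tword_itin.
Qed.

Lemma cesaro_small (a : nat -> R) : (forall n, 0 <= a n) ->
  (forall e, 0 < e -> exists n0, forall n, (n0 <= n)%N -> a n <= e) ->
  forall e, 0 < e -> exists n0, forall n, (n0 <= n)%N ->
    \sum_(j < n) a j <= e * n%:R.
Proof.
move=> a0 ha e e0; have [n1 h1] := ha (e / 2) ltac:(lra).
have bound n : \sum_(j < n) a j <= \sum_(j < n1) a j + e / 2 * n%:R.
  elim: n => [|n ih]; first by rewrite big_ord0 mulr0 addr0 sumr_ge0.
  have [lt|le] := ltnP n n1.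
    have /(_ _ _ lt) mono : nondecreasing_seq (fun n => \sum_(j < n) a j).
      by apply/nondecreasing_seqP => i; rewrite big_ord_recr lerDl.
    by rewrite (le_trans mono)// lerDl mulr_ge0// divr_ge0// ltW.
  by rewrite big_ord_recr /= -[n.+1%:R]natr1 mulrDr mulr1 addrA lerD// h1.
pose S := \sum_(j < n1) a j; have S0 : 0 <= S by exact: sumr_ge0.
exists (Num.truncn (S / (e / 2))).+1 => n nn.
rewrite (le_trans (bound n))// -/S.
have : S / (e / 2) <= n%:R by rewrite (le_trans (ltW (truncnS_gt _)))// ler_nat.
by rewrite ler_pdivrMr; [nra|lra].
Qed.

(** Without exponential contraction the distortion need not stay bounded. It is dominated by a sum
    of powers of cylinder diameters, whose terms tend to 0, so it is [o(n)]; that suffices for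
    entropy and pressure. *)
Lemma bsum_distortion g phi : 0 < g -> is_holder g phi ->
  exists D : nat -> R, [/\ forall n, 0 <= D n,
    forall w x y, `|bsum phi w x - bsum phi w y| <= D (size w) &
    forall e, 0 < e -> exists n0, forall n, (n0 <= n)%N -> D n <= e * n%:R].
Proof.
move=> g0 [_ [M0 phiM0]]; pose M := `|M0| + 1.
have M1 : 0 < M by rewrite ltr_wpDl.
have phiM x y : `|phi x - phi y| <= M * `|val x - val y| `^ g.
  rewrite (le_trans (phiM0 _ _))// ler_wpM2r ?powR_ge0//.
  by rewrite (le_trans (ler_norm _))// lerDl.
pose a n := M * cyl_diam alpha n.+1 `^ g.
have a0 n : 0 <= a n by rewrite mulr_ge0 ?powR_ge0// ltW.
exists (fun n => \sum_(j < n) a j); split=> [n|w x y|].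
- exact: sumr_ge0.
- elim: w => [|b w ih]; first by rewrite subrr normr0 big_ord0.
  rewrite big_ord_recr /= addrC.
  have -> : phi (branch b (tword w x)) + bsum phi w x -
      (phi (branch b (tword w y)) + bsum phi w y) =
      (phi (branch b (tword w x)) - phi (branch b (tword w y))) +
      (bsum phi w x - bsum phi w y) by ring.
  rewrite (le_trans (ler_normD _ _))// lerD// (le_trans (phiM _ _))//.
  rewrite ler_wpM2l ?(ltW M1)// powR_le_powR ?(ltW g0)//.
  exact: (tword_dist (b :: w)).
apply: cesaro_small => // e e0.
have [n0 hn0] := @cyl_diam_cvg0 _ _ alpha_gt0 ((e / M) `^ g^-1) ltac:(by apply: powR_gt0; exact: divr_gt0).
exists n0 => n nn0; rewrite /a mulrC -ler_pdivlMr//.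
have /ltW h := hn0 n.+1 (leq_trans nn0 (leqnSn n)).
have /andP[d0 _] := cyl_diam01 alpha_gt0 n.+1.
rewrite (le_trans (powR_le_powR (ltW g0) d0 h))// -powRrM mulVf ?gt_eqF//.
by rewrite powRr1// divr_ge0// ltW.
Qed.

(** The left side is the [n]-th iterate of the transfer operator on [h], expanded over inverse
    branches. *)
Lemma words_transfer phi h p n x : (forall y, transfer phi h y <= expR p * h y) ->
  \sum_(w <- words n) expR (bsum phi w x) * h (tword w x) <= expR (p * n%:R) * h x.
Proof.
move=> hp; elim: n => [|n ih].
  by rewrite big_seq1 /= expR0 mulr0 expR0 !mul1r.
rewrite big_words -natr1 mulrDr mulr1 expRD mulrAC [X in _ <= X]mulrC.
apply: (@le_trans _ _ (expR p * \sum_(w <- words n) expR (bsum phi w x) * h (tword w x))).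
  rewrite mulr_sumr; apply: ler_sum => w _ /=; rewrite !expRD.
  rewrite mulrCA; apply: le_trans (ler_wpM2l (expR_ge0 _) (hp _)).
  rewrite /transfer; move: (expR (bsum phi w x)) => s.
  move: (expR _) (expR _) (h _) (h _) => e0 e1 h0 h1.
  by rewrite mulrDr lerD// mulrCA mulrA.
by rewrite ler_wpM2l ?expR_ge0.
Qed.

End Itineraries.

(** * Approximation of measurable sets by unions of cylinders *)

Section Approximation.
Variables (R : realType) (alpha : R).
Hypothesis alpha_gt0 : 0 < alpha.
Local Notation I := (I01 R).
Local Notation f := (@intermittent_map R alpha).
Variable nu : probability I R.
Local Notation itin := (itin alpha).

Definition itin_error (A : set I) m (u : seq bool -> bool) : set I :=
  [set x | (x \in A) != u (itin m x)].

Definition itin_approximable (A : set I) : Prop := measurable A /\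
  forall e, 0 < e -> exists m u, pr nu (itin_error A m u) <= e.

Lemma measurable_itin_error (A : set I) m u : measurable A ->
  measurable (itin_error A m u).
Proof.
move=> mA; have fA : finmeas (fun x => x \in A).
  apply: finmeas_fin => -[].
    rewrite (_ : [set x | _] = A)//.
    by apply/seteqP; split=> x; [exact: set_mem|exact: mem_set].
  rewrite (_ : [set x | _] = ~` A); first exact: measurableC.
  apply/seteqP; split=> x /=; first by move=> h; rewrite -[_ x]inE h.
  by move=> h; exact: memNset.
have [_ /(_ [set p | p.1 != p.2])] := finmeas_pair fA
  (finmeas_comp u (finmeas_itin alpha_gt0 m)).
by [].
Qed.

Lemma itin_approximableU A B : itin_approximable A -> itin_approximable B ->
  itin_approximable (A `|` B).
Proof.
move=> [mA aA] [mB aB]; split; first exact: measurableU.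
move=> e e0; have e20 : 0 < e / 2 by lra.
have [m [u hu]] := aA _ e20; have [n [v hv]] := aB _ e20.
exists (maxn m n), (fun w => u (take m w) || v (take n w)).
have me := measurable_itin_error.
apply: le_trans (_ : pr nu (itin_error A m u `|` itin_error B n v) <= _).
  apply: pr_le; [by apply: me; exact: measurableU|by apply: measurableU; exact: me|].
  move=> x; rewrite /itin_error /= !take_itin ?leq_maxl ?leq_maxr//.
  have -> : (x \in A `|` B) = (x \in A) || (x \in B) by rewrite in_setU.
  by case: (x \in A); case: (x \in B); case: (u _); case: (v _) => //=; tauto.
rewrite (le_trans (pr_setU _ _ _))//; [exact: me|exact: me|lra].
Qed.

(** The approximable sets form a sigma-algebra, and an open set is the increasing union over [m] of
    the union of the cylinders of order [m] that it contains, because cylinder diameters tend to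
    0. *)
Lemma measurable_itin_approximable A : measurable A -> itin_approximable A.
Proof.
move=> mA; suff: (@measurable _ I) `<=` [set A | itin_approximable A] by exact.
apply: smallest_sub.
  split=> /=.
  - split; first exact: measurable0.
    move=> e e0; exists 0%N, (fun=> false).
    rewrite (_ : itin_error _ _ _ = set0) ?/pr ?measure0 ?(ltW e0)//.
    by rewrite -subset0 => x /=; rewrite /itin_error /= in_set0.
  - move=> B [mB aB]; rewrite setTD; split; first exact: measurableC.
    move=> e /aB[m [u hu]]; exists m, (fun w => ~~ u w).
    rewrite (_ : itin_error _ _ _ = itin_error B m u)//.
    apply/seteqP; split=> x; rewrite /itin_error /= in_setC;
      by case: (x \in B); case: (u _).
  - move=> F0 aF; pose F : nat -> set I := F0; rewrite -/F in aF *; have mF n : @measurable _ I (F n) by case: (aF n).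
    split; first exact: bigcupT_measurable.
    move=> e e0; have e20 : 0 < e / 2 by lra.
    pose G n : set I := \big[setU/set0]_(i < n.+1) F i.
    have aG n : itin_approximable (G n).
      rewrite /G; elim: n => [|n ih]; first by rewrite big_ord_recl big_ord0 setU0.
      by rewrite big_ord_recr; exact: itin_approximableU.
    have mG n : @measurable _ I (G n) by case: (aG n).
    have GF : \bigcup_n G n = \bigcup_n F n.
      apply/seteqP; split=> x [n _].
        by rewrite /G -bigcup_mkord => -[i /= _ Fx]; exists i.
      by move=> Fx; exists n => //; rewrite /G -bigcup_mkord; exists n => /=.
    have GS n : G n `<=` G n.+1 by rewrite /G [X in _ `<=` X]big_ord_recr /=; exact: subsetUl.
    have [n hn] := pr_cvg_bigcup nu mG GS e20; rewrite GF in hn.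
    have [_ /(_ _ e20)[m [u hu]]] := aG n; exists m, u.
    have mD : measurable ((\bigcup_n F n) `\` G n).
      by apply: measurableD => //; exact: bigcupT_measurable.
    apply: le_trans (_ : pr nu (((\bigcup_n F n) `\` G n) `|` itin_error (G n) m u) <= _).
      apply: pr_le.
      + by apply: measurable_itin_error; exact: bigcupT_measurable.
      + by apply: measurableU => //; exact: measurable_itin_error.
      move=> x; rewrite /itin_error /=.
      have [Gx|nGx] := pselect (G n x).
        have Fx : (\bigcup_n F n) x by rewrite -GF; exists n.
        by rewrite mem_set// => h; right; rewrite mem_set.
      have [Fx|nFx] := pselect ((\bigcup_n F n) x); first by left.
      by rewrite memNset// => h; right; rewrite memNset.
    rewrite (le_trans (pr_setU _ _ _))//; last lra.
    exact: measurable_itin_error.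
move=> _ [V oV <-]; set U := set_val @^-1` V.
have mU : measurable (U : set I) by exact: I01_open_preimage.
split=> // e e0.
pose C m : set I := [set x | forall y, itin m y = itin m x -> U y].
have mC m : measurable (C m).
  by have [_ /(_ [set w | forall y, itin m y = w -> U y])] := finmeas_itin alpha_gt0 m.
have CS m : C m `<=` C m.+1.
  move=> x Cx y yx; apply: Cx.
  by rewrite -(take_itin alpha y (leqnSn m)) yx take_itin.
have CU : \bigcup_m C m = U.
  apply/seteqP; split=> x; first by move=> [m _]; exact.
  move=> Ux; have : nbhs (val x : R) V by exact: open_nbhs_nbhs.
  move=> /nbhs_ballP[r /= r0 rV].
  have [n hn] := cyl_diam_cvg0 alpha_gt0 r0.
  exists n => // y yx; apply: rV; rewrite -ball_normE /= distrC.
  exact: le_lt_trans (itin_dist alpha_gt0 yx) (hn n (leqnn n)).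
have [n hn] := pr_cvg_bigcup nu mC CS e0; rewrite CU in hn.
exists n, (fun w => `[< forall y, itin n y = w -> U y >]).
rewrite (le_trans _ hn)// pr_le//; [exact: measurable_itin_error|exact: measurableD|].
move=> x; rewrite /itin_error /=; case: asboolP => Cx.
  by rewrite mem_set//; exact: Cx.
by have [Ux|nUx] := pselect (U x); [|rewrite memNset].
Qed.

(** Each of the [k] level sets is predicted up to [e / k], and [m] is the largest of the word
    lengths used. *)
Lemma approx_label k (a : I -> 'I_k) : finmeas a -> forall e, 0 < e ->
  exists m (c : seq bool -> 'I_k), pr nu [set x | c (itin m x) != a x] <= e.
Proof.
move=> [_ ma] e e0; pose A j : set I := [set x | a x = j].
have k0 : (0 < k)%N by case: k a {ma A} => [a|//]; have [] := a (I01_zero R).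
have ek0 : 0 < e / k%:R by rewrite divr_gt0// ltr0n.
have mA j : measurable (A j) by exact: (ma [set j]).
have /choice[mu hmu] j : exists mu : nat * (seq bool -> bool),
    pr nu (itin_error (A j) mu.1 mu.2) <= e / k%:R.
  have [_ /(_ _ ek0)[m [u hu]]] := measurable_itin_approximable (mA j).
  by exists (m, u).
pose m := \max_j (mu j).1.
(* Outside the union of the [k] error sets exactly the predictor of the true label fires; the
   default label matters only inside it. *)
pose c w := odflt (Ordinal k0) [pick j | (mu j).2 (take (mu j).1 w)].
exists m, c.
have mE (j : 'I_k) : measurable (itin_error (A j) (mu j).1 (mu j).2).
  exact: measurable_itin_error.
pose U := \big[setU/set0]_(j <- enum 'I_k) itin_error (A j) (mu j).1 (mu j).2.
apply: (@le_trans _ _ (pr nu U)).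
  apply: pr_le.
  - have fa : finmeas a by split=> //; exists (enum 'I_k) => x; rewrite mem_enum.
    have [_ /(_ [set p | p.1 != p.2])] := finmeas_pair
      (finmeas_comp c (finmeas_itin alpha_gt0 m)) fa.
    by [].
  - exact: bigsetU_measurable.
  move=> x /= cx; apply: contrapT => nx; move/negP: cx; apply.
  have ux j : (mu j).2 (itin (mu j).1 x) = (a x == j).
    have -> : (a x == j) = (x \in A j).
      by apply/eqP/idP => [h|/set_mem//]; exact: mem_set.
    apply/esym/eqP/negPn/negP => h; apply: nx.
    by rewrite /U -bigcup_seq; exists j => //=; rewrite mem_enum.
  apply/eqP; rewrite /c; case: pickP => [j|/(_ (a x))];
    by rewrite take_itin ?ux ?eqxx ?leq_bigmax// => /eqP.
apply: (le_trans (pr_bigsetU _ _ mE)).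
apply: (le_trans (ler_sum _ (fun j _ => hmu j))).
rewrite big_enum sumr_const card_ord -[leLHS]mulr_natr divfK//.
by rewrite pnatr_eq0 -lt0n.
Qed.

End Approximation.

(** * Entropy bounds from supersolutions *)

Section EntropyBounds.
Variables (R : realType) (alpha : R).
Hypothesis alpha_gt0 : 0 < alpha.
Local Notation I := (I01 R).
Local Notation f := (@intermittent_map R alpha).
Local Notation branch := (branch alpha).
Local Notation bsum := (@bsum R alpha).
Local Notation itin := (itin alpha).
Local Notation birk := (@birk R alpha).
Local Notation transfer := (@transfer R alpha).

(** Nonnegativity of relative entropy, from [ln (1 + x) <= x]; [Q] may have smaller total mass than
    [p]. *)
Lemma gibbs_inequality (J : finType) (p Q : J -> R) :
  (forall j, 0 <= p j) -> (forall j, 0 < Q j) ->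
  \sum_j Q j <= \sum_j p j ->
  - \sum_j p j * ln (p j) <= - \sum_j p j * ln (Q j).
Proof.
move=> p0 Q0 Qp; rewrite lerN2 -subr_ge0 -sumrB.
have : 0 <= \sum_j (p j - Q j) by rewrite sumrB subr_ge0.
move/le_trans; apply; apply: ler_sum => j _.
have [->|pn0] := eqVneq (p j) 0.
  by rewrite !mul0r subr0 sub0r oppr_le0 ltW.
have pj : 0 < p j by rewrite lt_def pn0 p0.
rewrite -mulrBr -ler_pdivrMl// -ln_div ?posrE// mulrBr mulVf// -[p j / Q j]invrK.
rewrite invf_div lnV ?posrE ?divr_gt0// lerNr opprB mulrC.
rewrite ![(p j)^-1 * _]mulrC.
have := @le_ln1Dx R (Q j / p j - 1); rewrite [1 + _]addrC subrK; apply.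
by rewrite ltrBDl subrr divr_gt0.
Qed.

Lemma finite_partition_label k (A : 'I_k -> set I) : finite_partition A ->
  exists a : I -> 'I_k, [/\ finmeas a, forall j, A j = [set x | a x = j] &
    forall n s, join_atom f A s = [set x | [ffun i : 'I_n => a (iter i f x)] = s]].
Proof.
move=> [mA tA UA].
have /choice[a ha] x : exists j, A j x.
  by have : setT x by []; rewrite -UA => -[j _ ?]; exists j.
have AE j : A j = [set x | a x = j].
  apply/seteqP; split=> x /= => [Ajx|<-//].
  by apply/(tA _ _ _ _) => //; exists x; split.
exists a; split=> //.
  by apply: finmeas_fin => j; rewrite -AE.
move=> n s; apply/seteqP; split=> x /=.
  move=> h; apply/ffunP => i; rewrite ffunE.
  by have := h i; rewrite AE.
by move=> <- i; rewrite AE /= ffunE.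
Qed.

Variable nu : probability I R.

Lemma finmeas_names k (a : I -> 'I_k) n : finmeas a ->
  finmeas (fun x => [ffun i : 'I_n => a (iter i f x)]).
Proof.
move=> fa; apply: finmeas_fin => s.
rewrite (_ : [set x | _] = \bigcap_(i in [set: 'I_n]) [set x | a (iter i f x) = s i]).
  apply: fin_bigcap_measurable => // i _.
  have [_ /(_ [set s i])] := finmeas_precomp (measurable_iter_map alpha_gt0 i) fa.
  by [].
apply/seteqP; split=> x /=; first by move=> <- i _ /=; rewrite ffunE.
by move=> h; apply/ffunP => i; rewrite ffunE; exact: h.
Qed.

Lemma join_entropyE k (A : 'I_k -> set I) (a : I -> 'I_k) n :
  (forall s, join_atom f A s = [set x | [ffun i : 'I_n => a (iter i f x)] = s]) ->
  join_entropy f nu A n =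
  - \sum_s pr nu [set x | [ffun i : 'I_n => a (iter i f x)] = s] *
      ln (pr nu [set x | [ffun i : 'I_n => a (iter i f x)] = s]).
Proof.
by move=> h; congr (- _); apply: eq_bigr => s _; rewrite h.
Qed.

Hypothesis nu_inv : invariant_measure f nu.
Local Notation mean psi := (\int[nu]_x psi x).

Lemma mean_iter psi i : bmeas psi -> mean (fun x => psi (iter i f x)) = mean psi.
Proof.
move=> bp; elim: i => [//|i ih].
rewrite -ih -[RHS](mean_comp (measurable_map alpha_gt0) nu_inv).
  by apply: eq_Rintegral => x _; rewrite iterSr.
exact: (bmeas_comp (measurable_iter_map alpha_gt0 i) bp).
Qed.

Lemma bmeas_iter (psi : I -> R) i : bmeas psi -> bmeas (fun x => psi (iter i f x)).
Proof. exact: bmeas_comp (measurable_iter_map alpha_gt0 i). Qed.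

Lemma bmeas_birk (phi : I -> R) n : bmeas phi -> bmeas (birk phi n).
Proof. by move=> bp; apply: bmeas_sum => i; exact: bmeas_iter. Qed.

Lemma mean_birk (phi : I -> R) n : bmeas phi -> mean (birk phi n) = n%:R * mean phi.
Proof.
move=> bp; rewrite mean_sum => [|i]; last exact: bmeas_iter.
under eq_bigr do rewrite mean_iter//.
by rewrite sumr_const card_ord -[LHS]mulr_natl.
Qed.

Section UpperBound.
Variables (g p c B : R) (phi h : I -> R).
Hypotheses (g_gt0 : 0 < g) (phi_holder : is_holder g phi).
Hypotheses (c_gt0 : 0 < c) (h_bnd : forall x, c <= h x <= B).
Hypothesis h_super : forall x, transfer phi h x <= expR p * h x.

Lemma words_pressure N x :
  \sum_(w <- words N) expR (bsum phi w x) <= B / c * expR (p * N%:R).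
Proof.
have := words_transfer N x h_super => H.
rewrite mulrAC ler_pdivlMr// mulrC mulr_sumr mulrC.
apply: (@le_trans _ _ (expR (p * N%:R) * h x)).
  apply: le_trans H; apply: ler_sum => w _; rewrite mulrC ler_wpM2l ?expR_ge0//.
  by case/andP: (h_bnd (tword alpha w x)).
by rewrite ler_wpM2l ?expR_ge0//; case/andP: (h_bnd x).
Qed.

(* The reference weight of the atom [s] of the [n]-fold join sums, over all
   itineraries [w] of length [n + m], the Gibbs weight [exp (S phi)] of [w] times
   the weight of [s] given the labels that [w] predicts; the prediction [cc]
   is wrong only on a set of small measure. *)
Lemma join_entropy_le k (A : 'I_k -> set I) (D : nat -> R) (e : R) :
  finite_partition A ->
  (forall w x y, `|bsum phi w x - bsum phi w y| <= D (size w)) -> 0 < e ->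
  exists m, forall n, join_entropy f nu A n <=
    (n + m)%:R * (p - mean phi) + D (n + m)%N + ln (B / c) + n%:R * e.
Proof.
move=> partA hD e0; have [a [fa _ aE]] := finite_partition_label partA.
have bphi := holder_bmeas g_gt0 phi_holder.
have k0 : (0 < k)%N by case: k a {A partA fa aE} => [a|//]; have [] := a (I01_zero R).
(* A correct prediction gets weight [exp (- (e / 2))]; the remaining mass [eta], split over [k]
   labels, pays for a wrong one, at cost [L = ln (k / eta)]. *)
pose eta := 1 - expR (- (e / 2)).
have eta1 : expR (- (e / 2)) < 1 by rewrite expR_lt1 oppr_lt0 divr_gt0.
have eta0 : 0 < eta by rewrite subr_gt0.
have eta1' : eta < 1 by rewrite /eta ltrBlDr ltrDl expR_gt0.
have k0' : 0 < k%:R :> R by rewrite ltr0n.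
pose L := ln (k%:R / eta).
have L0 : 0 <= L.
  by rewrite ln_ge0// ler_pdivlMr// mul1r (le_trans (ltW eta1'))// ler1n.
have L1 : 0 < L + 1 by rewrite ltr_wpDl.
(* Small enough that wrong predictions, of cost [L] each, add at most [e / 2] on average. *)
have [m [cc hcc]] := approx_label alpha_gt0 nu fa (e := e / 2 / (L + 1))
   ltac:(by rewrite !divr_gt0).
exists m => n; pose N := (n + m)%N.
pose rho (j0 j : 'I_k) : R := if j0 == j then e / 2 else L.
have sum_rho j0 : \sum_j expR (- rho j0 j) <= 1.
  rewrite (bigD1 j0)//= /rho eqxx.
  under eq_bigr => j jj0 do rewrite eq_sym (negbTE jj0) expRN lnK ?posrE ?divr_gt0// invf_div.
  rewrite sumr_const -[X in _ + X]mulr_natl.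
  apply: (@le_trans _ _ (expR (- (e / 2)) + k%:R * (eta / k%:R))).
    rewrite lerD2l ler_wpM2r ?divr_ge0 ?(ltW eta0)// ler_nat.
    by rewrite (leq_trans (max_card _))// card_ord.
  by rewrite mulrCA divff ?gt_eqF// mulr1 /eta subrKC.
have cB : c <= B by have /andP[h1 h2] := h_bnd (I01_zero R); exact: le_trans h2.
have [K KE] : exists K, K = B / c by exists (B / c).
have K0 : 0 < K by rewrite KE divr_gt0// (lt_le_trans c_gt0).
pose pred w (i : 'I_n) := cc (take m (drop i w)).
pose T w (s : {ffun 'I_n -> 'I_k}) := bsum phi w (I01_zero R) - ln K - p * N%:R
   - \sum_i rho (pred w i) (s i).
pose Q s := \sum_(w <- words N) expR (T w s).
have Q0 s : 0 < Q s.
  rewrite /Q (perm_big _ (perm_to_rem (itin_words alpha N (I01_zero R)))) big_cons.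
  by rewrite ltr_pwDl ?expR_gt0// sumr_ge0// => *; exact: expR_ge0.
pose X x := [ffun i : 'I_n => a (iter i f x)].
have fX : finmeas X := finmeas_names n fa.
have Q1 : \sum_s Q s <= \sum_s pr nu [set x | X x = s].
  rewrite sum_pr// exchange_big /=.
  apply: (@le_trans _ _ (\sum_(w <- words N) expR (bsum phi w (I01_zero R)) / (K * expR (p * N%:R)))).
    apply: ler_sum => w _; rewrite /T.
    have TE (s : {ffun 'I_n -> 'I_k}) : expR (T w s) =
        expR (bsum phi w (I01_zero R)) / (K * expR (p * N%:R)) *
        \prod_i expR (- rho (pred w i) (s i)).
      by rewrite /T expRD -sumrN expR_sum !expRB lnK ?posrE// invfM mulrA.
    under eq_bigr => s _ do rewrite TE.
    rewrite -mulr_sumr ler_piMr//.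
      by rewrite divr_ge0 ?expR_ge0// mulr_ge0 ?expR_ge0// ltW.
    rewrite -(bigA_distr_bigA (fun i j => expR (- rho (pred w i) j))).
    rewrite -[leRHS](big1_eq (idx := 1) (op := *%R) (index_enum 'I_n) xpredT).
    apply: ler_prod => i _; rewrite sum_rho andbT sumr_ge0// => *; exact: expR_ge0.
  rewrite -mulr_suml ler_pdivrMr ?mul1r ?KE ?words_pressure// -KE.
  by rewrite mulr_gt0// expR_gt0.
have H1 : join_entropy f nu A n <= mean (fun x => - ln (Q (X x))).
  rewrite (join_entropyE (aE n)) (@mean_finmeas _ _ _ nu _ X (fun s => - ln (Q s)))//.
  apply: le_trans (gibbs_inequality _ Q0 Q1) _ => [s|]; first exact: pr_ge0.
  rewrite -sumrN le_eqVlt; apply/orP; left; apply/eqP; apply: eq_bigr => s _.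
  by rewrite mulNr mulrC.
pose rho' x := rho (cc (itin m x)) (a x).
have frho : finmeas (fun x => (cc (itin m x), a x)).
  exact: finmeas_pair (finmeas_comp cc (finmeas_itin alpha_gt0 m)) fa.
have brho : bmeas rho' := bmeas_finmeas (fun q => rho q.1 q.2) frho.
have rho_mean : mean rho' <= e.
  pose bad := [set x | cc (itin m x) != a x].
  have mbad : measurable bad.
    by have [_ /(_ [set q | q.1 != q.2])] := frho.
  have bbad := bmeas_indic R mbad.
  apply: (@le_trans _ _ (mean (fun x => e / 2 + L * (\1_bad x : R)))).
    apply: le_mean => //; first exact/bmeasD/bmeasZ/bbad/bmeas_cst.
    move=> x; rewrite /rho' /rho indicE.
    case: (eqVneq (cc (itin m x)) (a x)) => cax.
      by rewrite memNset ?mulr0 ?addr0// /bad /= cax eqxx.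
    by rewrite mem_set// mulr1 lerDr divr_ge0// ltW.
  rewrite meanD ?mean_cst ?meanZ ?mean_indic//; [|exact: bmeas_cst|exact: bmeasZ].
  have : L * pr nu bad <= L * (e / 2 / (L + 1)) by rewrite ler_wpM2l.
  have : L * (e / 2 / (L + 1)) <= e / 2.
    rewrite mulrCA ger_pMr ?divr_gt0// ler_pdivrMr// mul1r lerDl//.
  by rewrite /pr; lra.
pose u x := ln K + p * N%:R + D N - birk phi N x + birk rho' n x.
have bu : bmeas u.
  apply: bmeasD; last exact: bmeas_birk.
  by apply: bmeasB; [exact: bmeas_cst|exact: bmeas_birk].
have H2 : mean (fun x => - ln (Q (X x))) <= mean u.
  apply: le_mean => //; first exact: (bmeas_finmeas (fun s => - ln (Q s)) fX).
  move=> x; rewrite lerNl.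
  (* Only the term of the true itinerary is kept. *)
  have QT : expR (T (itin N x) (X x)) <= Q (X x).
    rewrite /Q (perm_big _ (perm_to_rem (itin_words alpha N x))) big_cons lerDl.
    by rewrite sumr_ge0// => *; exact: expR_ge0.
  have : T (itin N x) (X x) <= ln (Q (X x)).
    by rewrite -[leLHS]expRK ler_ln ?posrE ?expR_gt0.
  apply: le_trans; rewrite /T /u.
  have -> : \sum_i rho (pred (itin N x) i) (X x i) = birk rho' n x.
    apply: eq_bigr => i _; rewrite /X ffunE /rho' /pred drop_itin; last first.
      by rewrite (leq_trans (ltnW (ltn_ord i)))// leq_addr.
    by rewrite take_itin// /N addnC -addnBA ?leq_addr// ltnW.
  have := hD (itin N x) (iter N f x) (I01_zero R).
  rewrite bsum_itin// size_itin => /(le_trans (ler_norm _)).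
  by lra.
apply: (le_trans H1); apply: (le_trans H2).
have -> : mean u = ln K + p * N%:R + D N - N%:R * mean phi + n%:R * mean rho'.
  rewrite /u meanD ?meanB ?mean_cst ?mean_birk//.
  - exact: bmeas_cst.
  - exact: bmeas_birk.
  - by apply: bmeasB; [exact: bmeas_cst|exact: bmeas_birk].
  - exact: bmeas_birk.
have : n%:R * mean rho' <= n%:R * e by rewrite ler_wpM2l.
by rewrite -/N -KE; lra.
Qed.

Lemma join_entropy_ratio k (A : 'I_k -> set I) e : finite_partition A -> 0 < e ->
  \forall n \near \oo, join_entropy f nu A n / n%:R <= p - mean phi + e.
Proof.
move=> partA e0; set G := p - mean phi.
have [D [D0 hD hD']] := bsum_distortion alpha_gt0 g_gt0 phi_holder.
have e40 : 0 < e / 4 by rewrite divr_gt0.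
have [m hm] := join_entropy_le partA hD e40.
have [n0 hn0] := hD' _ e40.
near=> n.
have n1 : 0 < n%:R :> R by rewrite ltr0n; near: n; exists 1%N.
rewrite ler_pdivrMr//; apply: (le_trans (hm n)); rewrite -/G.
have : D (n + m)%N <= e / 4 * (n + m)%:R.
  by apply: hn0; rewrite (leq_trans _ (leq_addr _ _))//; near: n; exists n0.
have : m%:R * G + ln (B / c) + e / 4 * m%:R <= e / 4 * n%:R.
  set V := (X in X <= _); rewrite -ler_pdivrMl//.
  have : (Num.truncn ((e / 4)^-1 * `|V|)).+1%:R <= n%:R :> R.
    by rewrite ler_nat; near: n; exists (Num.truncn ((e / 4)^-1 * `|V|)).+1.
  apply: le_trans; rewrite (le_trans _ (ltW (truncnS_gt _)))//.
  by rewrite ler_pM2l ?invr_gt0// ler_norm.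
have : 0 < e * n%:R by rewrite mulr_gt0.
rewrite natrD; lra.
Unshelve. all: by end_near. Qed.

(** [limn] has the default value 0 on a divergent sequence; the maximum with 0 covers that case, so
    convergence of the quotients need not be known. *)
Lemma partition_entropy_le k (A : 'I_k -> set I) :
  finite_partition A -> partition_entropy f nu A <= Num.max 0 (p - mean phi).
Proof.
move=> partA.
have [cv|ncv] := pselect (cvgn (fun n => join_entropy f nu A n / n%:R)); last first.
  by rewrite /partition_entropy dvgP// le_max lexx.
apply/ler_addgt0Pr => e e0; rewrite -lerBlDr le_max; apply/orP; right.
by rewrite lerBlDr; apply: limr_le => //; exact: join_entropy_ratio.
Qed.

End UpperBound.

Lemma trivial_partition_entropy : partition_entropy f nu (fun _ : 'I_1 => setT) = 0.
Proof.
rewrite /partition_entropy (_ : (fun n => _) = fun=> 0) ?lim_cst//.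
apply/funext => n; rewrite /join_entropy big1 ?oppr0 ?mul0r// => s _.
rewrite (_ : join_atom _ _ _ = setT); last exact/seteqP.
by rewrite [X in fine X](@probability_setT _ _ _ nu) /= ln1 mulr0.
Qed.

Lemma entropy_ge0 : (0 <= entropy f nu)%E.
Proof.
apply: ereal_sup_ubound; exists 1%N, (fun=> setT); split.
  split=> [i||]; first exact: measurableT.
    by move=> i j _ _ _; rewrite !ord1.
  by apply/seteqP; split=> // x _; exists ord0.
by rewrite trivial_partition_entropy.
Qed.

Section VariationalUpperBound.
Variables (g p c B : R) (phi h : I -> R).
Hypotheses (g_gt0 : 0 < g) (phi_holder : is_holder g phi).
Hypotheses (c_gt0 : 0 < c) (h_bnd : forall x, c <= h x <= B).
Hypothesis h_super : forall x, transfer phi h x <= expR p * h x.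

(** A single itinerary contributes no more than the full sum of [words_pressure], so Birkhoff sums
    are at most [p * n] up to [o(n)], and so is [n * mean phi]. This removes the maximum in
    [partition_entropy_le]. *)
Lemma mean_le_pressure : mean phi <= p.
Proof.
have bphi := holder_bmeas g_gt0 phi_holder.
have [D [D0 hD hD']] := bsum_distortion alpha_gt0 g_gt0 phi_holder.
have le n : n%:R * mean phi <= ln (B / c) + p * n%:R + D n.
  rewrite -mean_birk//; apply: mean_le; first exact: bmeas_birk.
  move=> x; have cB : c <= B.
    by have /andP[h1 h2] := h_bnd (I01_zero R); exact: le_trans h2.
  have K0 : 0 < B / c by rewrite divr_gt0// (lt_le_trans c_gt0).
  have := words_pressure c_gt0 h_bnd h_super n (iter n f x).
  rewrite (perm_big _ (perm_to_rem (itin_words alpha n x))) big_cons bsum_itin// => H.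
  have : expR (birk phi n x) <= expR (ln (B / c) + p * n%:R).
    rewrite expRD lnK ?posrE//; apply: le_trans H; rewrite lerDl.
    by rewrite sumr_ge0// => *; exact: expR_ge0.
  by rewrite ler_expR => /le_trans; apply; rewrite lerDl.
rewrite leNgt; apply/negP => lt; pose e := (mean phi - p) / 4.
have e0 : 0 < e by rewrite divr_gt0// subr_gt0.
have [n0 hn0] := hD' _ e0.
pose n := maxn n0 (Num.truncn (e^-1 * `|ln (B / c)|)).+1.
have h1 : D n <= e * n%:R by apply: hn0; rewrite leq_maxl.
have h2 : ln (B / c) <= e * n%:R.
  rewrite -ler_pdivrMl//.
  apply: (@le_trans _ _ (Num.truncn (e^-1 * `|ln (B / c)|)).+1%:R); last first.
    by rewrite ler_nat leq_maxr.
  rewrite (le_trans _ (ltW (truncnS_gt _)))//.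
  by rewrite ler_pM2l ?invr_gt0// ler_norm.
have n1 : 0 < n%:R :> R by rewrite ltr0n leq_max orbT.
have := le n; have : mean phi = p + 4 * e by rewrite /e; lra.
move=> ->; have : 0 < e * n%:R by rewrite mulr_gt0.
by lra.
Qed.

(** The upper half of the variational principle, with a supersolution in place of an
    eigenfunction. *)
Lemma entropy_le : (entropy f nu <= (p - mean phi)%:E)%E.
Proof.
apply: ge_ereal_sup => _ [k [A [partA ->]]]; rewrite lee_fin.
have := partition_entropy_le g_gt0 phi_holder c_gt0 h_bnd h_super partA.
by rewrite max_r// subr_ge0 mean_le_pressure.
Qed.

End VariationalUpperBound.

(** For the zero potential the constant 1 is a supersolution with exponent [ln 2], which bounds the
    entropy. *)
Lemma entropy_fin : entropy f nu = (fine (entropy f nu))%:E.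
Proof.
rewrite fineK// ge0_fin_numE ?entropy_ge0//.
have hz : is_holder 1 (fun=> 0 : R).
  by split; exists 0 => *; rewrite ?subrr normr0// mul0r.
apply: le_lt_trans (@entropy_le 1 (ln 2) 1 1 (fun=> 0) (fun=> 1) _ hz _ _ _) _ => //.
- by move=> x; rewrite lexx.
- by move=> x; rewrite /transfer expR0 lnK ?posrE// !mulr1.
- exact: ltry.
Qed.

End EntropyBounds.

(** * Potentials favouring the neutral fixed point *)

Section HolderCalculus.
Variables (R : realType) (g : R).
Local Notation I := (I01 R).
Implicit Types (phi psi : I -> R) (x y : I).

Lemma is_holder_lipschitz (G : R -> R) L psi :
  (forall x y, `|G (psi x) - G (psi y)| <= L * `|psi x - psi y|) ->
  is_holder g psi -> is_holder g (G \o psi).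
Proof.
move=> GL [[M hM] [N hN]]; split.
  exists (`|G (psi (I01_zero R))| + `|L| * (M + M)) => x /=.
  rewrite -[G (psi x)](subrK (G (psi (I01_zero R)))) addrC.
  rewrite (le_trans (ler_normD _ _))// lerD2l (le_trans (GL _ _))//.
  apply: (@le_trans _ _ (`|L| * `|psi x - psi (I01_zero R)|)).
    by rewrite ler_wpM2r// ler_norm.
  by rewrite ler_wpM2l// (le_trans (ler_normB _ _))// lerD.
exists (`|L| * N) => x y /=; rewrite (le_trans (GL _ _))//.
apply: (@le_trans _ _ (`|L| * `|psi x - psi y|)).
  by rewrite ler_wpM2r// ler_norm.
by rewrite -mulrA ler_wpM2l.
Qed.

Lemma is_holder_cst (c : R) : is_holder g (fun=> c : R).
Proof.
split; first by exists `|c|.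
by exists 0 => x y; rewrite subrr normr0 mul0r.
Qed.

Lemma is_holderD phi psi : is_holder g phi -> is_holder g psi ->
  is_holder g (fun x => phi x + psi x).
Proof.
move=> [[M hM] [N hN]] [[M' hM'] [N' hN']]; split.
  by exists (M + M') => x; rewrite (le_trans (ler_normD _ _))// lerD.
exists (N + N') => x y; rewrite mulrDl opprD addrACA.
by rewrite (le_trans (ler_normD _ _))// lerD.
Qed.

Lemma is_holderM phi psi : is_holder g phi -> is_holder g psi ->
  is_holder g (fun x => phi x * psi x).
Proof.
move=> [[M hM] [N hN]] [[M' hM'] [N' hN']]; split.
  by exists (M * M') => x; rewrite normrM ler_pM.
exists (M * N' + N * M') => x y.
have -> : phi x * psi x - phi y * psi y =
    phi x * (psi x - psi y) + (phi x - phi y) * psi y by ring.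
rewrite (le_trans (ler_normD _ _))// [leRHS]mulrDl !normrM lerD//.
  by rewrite -mulrA ler_pM.
by rewrite mulrAC ler_pM.
Qed.

Lemma is_holderZ (c : R) psi : is_holder g psi -> is_holder g (fun x => c * psi x).
Proof. exact/is_holderM/is_holder_cst. Qed.

Lemma is_holderN psi : is_holder g psi -> is_holder g (fun x => - psi x).
Proof.
move=> /(is_holderZ (-1)); rewrite (_ : (fun x => -1 * psi x) = (fun x => - psi x))//.
by apply/funext => x; rewrite mulN1r.
Qed.

Lemma is_holderB phi psi : is_holder g phi -> is_holder g psi ->
  is_holder g (fun x => phi x - psi x).
Proof. by move=> hp hq; apply: is_holderD => //; exact: is_holderN. Qed.

Lemma expR_lip (M a b : R) : a <= M -> b <= M ->
  `|expR a - expR b| <= expR M * `|a - b|.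
Proof.
wlog ba : a b / b <= a => [hw aM bM|aM bM].
  by have [|/ltW] := leP b a => h; [|rewrite distrC (distrC a)]; exact: hw.
rewrite !ger0_norm ?subr_ge0 ?ler_expR//.
have -> : expR a - expR b = expR a * (1 - expR (b - a)).
  by rewrite mulrBr mulr1 -expRD [a + _]addrC subrK.
have h : 1 - expR (b - a) <= a - b by have := expR_ge1Dx (b - a); lra.
rewrite ler_pM ?expR_ge0 ?ler_expR// subr_ge0 expR_le1 subr_le0//.
Qed.

Lemma is_holder_expR psi : is_holder g psi -> is_holder g (fun x => expR (psi x)).
Proof.
move=> hp; have [[M hM] _] := hp.
apply: (is_holder_lipschitz (G := expR) (L := expR M)) => // x y.
by apply: expR_lip; rewrite (le_trans (ler_norm _)).
Qed.

Lemma inv_lip (c a b : R) : 0 < c -> c <= a -> c <= b ->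
  `|a^-1 - b^-1| <= c^-1 ^+ 2 * `|a - b|.
Proof.
move=> c0 ca cb; have a0 := lt_le_trans c0 ca; have b0 := lt_le_trans c0 cb.
have -> : a^-1 - b^-1 = a^-1 * b^-1 * (b - a).
  by field; rewrite !gt_eqF.
rewrite normrM distrC ler_wpM2r// ger0_norm ?mulr_ge0 ?invr_ge0 ?(ltW a0) ?(ltW b0)//.
by rewrite expr2 ler_pM ?invr_ge0 ?lef_pV2 ?posrE ?(ltW a0) ?(ltW b0).
Qed.

Lemma is_holderV (c : R) psi : 0 < c -> (forall x, c <= psi x) ->
  is_holder g psi -> is_holder g (fun x => (psi x)^-1).
Proof.
move=> c0 cp; apply: (is_holder_lipschitz (G := GRing.inv) (L := c^-1 ^+ 2)).
by move=> x y; exact: inv_lip.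
Qed.

Lemma is_holder_nonexpansive (T : I -> I) psi : 0 < g ->
  (forall x y, `|val (T x) - val (T y)| <= `|val x - val y|) ->
  is_holder g psi -> is_holder g (psi \o T).
Proof.
move=> g0 hT [[M hM] [N hN]]; split; first by exists M => x; exact: hM.
exists `|N| => x y; rewrite (le_trans (hN _ _))//.
apply: (@le_trans _ _ (`|N| * `|val (T x) - val (T y)| `^ g)).
  by rewrite ler_wpM2r ?powR_ge0// ler_norm.
by rewrite ler_wpM2l// powR_le_powR// ltW.
Qed.

Lemma lipschitz_holder (L : R) psi : 0 < g <= 1 -> 
  (forall x y, `|psi x - psi y| <= L * `|val x - val y|) -> is_holder g psi.
Proof.
move=> /andP[g0 g1] pL; split.
  exists (`|psi (I01_zero R)| + `|L|) => x.
  rewrite -[psi x](subrK (psi (I01_zero R))) addrC.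
  rewrite (le_trans (ler_normD _ _))// lerD2l (le_trans (pL _ _))//.
  apply: (@le_trans _ _ (`|L| * 1)); last by rewrite mulr1.
  rewrite (le_trans (ler_wpM2r _ (ler_norm L)))//.
  by rewrite ler_wpM2l// I01_dist1.
exists `|L| => x y; rewrite (le_trans (pL _ _))//.
apply: (@le_trans _ _ (`|L| * `|val x - val y|)).
  by rewrite ler_wpM2r// ler_norm.
rewrite ler_wpM2l//; have [->|n0] := eqVneq `|val x - val y| 0; first exact: powR_ge0.
by rewrite ger1_powR// lt_def n0 normr_ge0 I01_dist1.
Qed.

End HolderCalculus.

Section LowPotentials.
Variables (R : realType) (alpha : R).
Hypothesis alpha_gt0 : 0 < alpha.
Local Notation I := (I01 R).
Local Notation f := (@intermittent_map R alpha).
Local Notation branch := (branch alpha).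
Local Notation transfer := (@transfer R alpha).
Implicit Types (phi h : I -> R).

Lemma transfer_le phi psi h x : (forall y, phi y <= psi y) -> (forall y, 0 <= h y) ->
  transfer phi h x <= transfer psi h x.
Proof. by move=> pp h0; apply: lerD; rewrite ler_wpM2r ?ler_expR. Qed.

Lemma transfer_shift phi h (q : R) x :
  transfer (fun y => q + phi y) h x = expR q * transfer phi h x.
Proof.
rewrite /transfer !expRD; move: (expR q) (expR _) (expR _) (h _) (h _) => a b c u w.
by ring.
Qed.

Definition tamed_power (k : R) (x : I) : R := (Num.max (val x `^ alpha) k)^-1.

(** The least value of [x ^ alpha] on the image of the right branch, where the potential
    [- s * x ^ alpha] is uniformly low. *)
Definition right_floor : R := lift_inv alpha 1 `^ alpha.

Lemma right_floor_gt0 : 0 < right_floor.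
Proof. exact/powR_gt0/lift_inv1_gt0. Qed.

Lemma right_floor_le x : right_floor <= val (branch true x) `^ alpha.
Proof.
rewrite powR_le_powR ?(ltW alpha_gt0) ?(ltW (lift_inv1_gt0 alpha_gt0))//.
exact: branch_true_ge.
Qed.

Lemma tamed_power_le_inv k x : 0 < val x -> tamed_power k x <= (val x `^ alpha)^-1.
Proof.
move=> x0; rewrite lef_pV2 ?posrE ?lt_max ?powR_gt0// le_max lexx//.
Qed.

Lemma tamed_power_bnd k x : 0 < k <= 1 -> 1 <= tamed_power k x <= k^-1.
Proof.
move=> /andP[k0 k1]; have m0 : 0 < Num.max (val x `^ alpha) k by rewrite lt_max k0 orbT.
rewrite lef_pV2 ?posrE// le_max lexx orbT andbT -[leLHS]invr1 lef_pV2 ?posrE//.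
by rewrite ge_max k1 powR_le1 ?I01P// ltW.
Qed.

Lemma branch_false_power x : val x `^ alpha =
  val (branch false x) `^ alpha * (1 + val (branch false x) `^ alpha) `^ alpha.
Proof.
rewrite -powRM ?addr_ge0 ?powR_ge0//; last by case/andP: (I01P (branch false x)).
by congr (_ `^ alpha); have := lift_branch alpha_gt0 false x; rewrite add0r.
Qed.

(** Here [a] is [y ^ alpha] at the left preimage [y] of [x], and [x ^ alpha = a * (1 + a) ^ alpha].
    Since [(1 + a) ^ alpha <= exp (alpha * a)], after multiplication by [a] the left term leaves the
    slack [exp (- alpha * a) - exp (- s * a)], at least [exp (- alpha) * a / 2] once
    [s >= alpha + 1]; the second bound on [s] makes the right term fit into it. *)
Lemma neutral_gain (s b0 a : R) : 0 < b0 -> alpha + 1 <= s ->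
  2 * expR alpha / b0 ^+ 2 <= s -> 0 < a <= 1 ->
  expR (- (s * a)) * a^-1 + expR (- (s * b0)) * b0^-1 <= (a * (1 + a) `^ alpha)^-1.
Proof.
move=> b00 sa sb /andP[ap a1]; have a0 := ltW ap.
have s0 : 0 < s by apply: lt_le_trans sa; rewrite addr_gt0.
have aX : expR (- (alpha * a)) * a^-1 <= (a * (1 + a) `^ alpha)^-1.
  have p1 : 0 < (1 + a) `^ alpha by rewrite powR_gt0// ltr_pwDl.
  rewrite invfM mulrC ler_pM2l ?invr_gt0// expRN lef_pV2 ?posrE ?expR_gt0//.
  rewrite mulrC expRM powR_le_powR ?(ltW alpha_gt0) ?addr_ge0//.
  exact: expR_ge1Dx.
apply: le_trans aX; rewrite -lerBrDl -mulrBl ler_pdivlMr//.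
have hu : expR (- alpha) * (a / 2) <= expR (- (alpha * a)) - expR (- (s * a)).
  have -> : expR (- (alpha * a)) - expR (- (s * a)) =
      expR (- (alpha * a)) * (1 - expR (- ((s - alpha) * a))).
    rewrite mulrBr mulr1 -expRD; congr (_ - expR _); ring.
  rewrite ler_pM ?expR_ge0 ?divr_ge0//.
    by rewrite ler_expR lerN2 ler_piMr// ltW.
  have [t tE] : exists t, t = s - alpha by exists (s - alpha).
  rewrite -tE; have t1 : 1 <= t by rewrite tE; lra.
  have ta0 : 0 <= t * a by rewrite mulr_ge0// (le_trans ler01).
  have h1 : expR (- (t * a)) <= (1 + t * a)^-1.
    by rewrite expRN lef_pV2 ?posrE ?expR_gt0 ?expR_ge1Dx// ltr_pwDl.
  suff h2 : a / 2 <= 1 - (1 + t * a)^-1 by lra.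
  have -> : 1 - (1 + t * a)^-1 = t * a / (1 + t * a).
    by field; rewrite gt_eqF// ltr_pwDl.
  rewrite ler_pdivlMr ?ltr_pwDl//.
  have ta : 0 <= t * (a * (1 - a)).
    by rewrite !mulr_ge0 ?subr_ge0// (le_trans ler01).
  have ta1 : 0 <= a * (t - 1) by rewrite mulr_ge0// subr_ge0.
  rewrite -subr_ge0.
  have -> : t * a - a / 2 * (1 + t * a) = (t * (a * (1 - a)) + a * (t - 1)) / 2.
    by field.
  by rewrite divr_ge0// addr_ge0.
apply: le_trans hu.
have hs : expR (- (s * b0)) <= (s * b0)^-1.
  rewrite expRN lef_pV2 ?posrE ?expR_gt0 ?mulr_gt0//.
  by have := expR_ge1Dx (s * b0); lra.
have h : expR (- (s * b0)) / b0 <= expR (- alpha) / 2.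
  apply: (@le_trans _ _ ((s * b0)^-1 / b0)).
    by rewrite ler_wpM2r// invr_ge0 ltW.
  rewrite -invfM expRN -invfM lef_pV2 ?posrE ?mulr_gt0 ?expR_gt0//.
  have -> : expR alpha * 2 = 2 * expR alpha / b0 ^+ 2 * b0 * b0.
    by field; rewrite gt_eqF.
  by rewrite !ler_wpM2r ?(ltW b00).
have := ler_wpM2r a0 h; congr (_ <= _); ring.
Qed.

(* [h = x ^ (- alpha)] makes [h (E x) - h x] bounded away from [0] near the
   neutral fixed point; truncating it costs a factor [1 + k / right_floor]. *)
Lemma tamed_power_super : exists2 s : R, 0 < s & forall k x, 0 < k <= 1 ->
  transfer (fun y => - (s * val y `^ alpha)) (tamed_power k) x <=
  (1 + k / right_floor) * tamed_power k x.
Proof.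
have := right_floor_le; have := right_floor_gt0.
move: (right_floor) => b0 b00 bR.
have [s [sa sb]] : exists s : R, alpha + 1 <= s /\ 2 * expR alpha / b0 ^+ 2 <= s.
  exists (alpha + 1 + 2 * expR alpha / b0 ^+ 2); split.
    by rewrite lerDl divr_ge0 ?exprn_ge0 ?(ltW b00)// mulr_ge0// expR_ge0.
  by rewrite lerDr addr_ge0// ltW.
have s0 : 0 < s by apply: lt_le_trans sa; rewrite addr_gt0.
exists s => // k x k01; have /andP[k0 k1] := k01.
have /andP[hx1 hxk] := tamed_power_bnd x k01.
have /andP[hR1 _] := tamed_power_bnd (branch true x) k01.
have /andP[hL1 hLk] := tamed_power_bnd (branch false x) k01.
have := tamed_power_le_inv k (branch_true_gt0 alpha_gt0 x).
have := @tamed_power_le_inv k (branch false x).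
have := bR x; have := branch_false_power x.
have := powR_ge0 (val (branch false x)) alpha.
have : val (branch false x) `^ alpha <= 1 by rewrite powR_le1 ?I01P ?(ltW alpha_gt0).
have a_gt0 : 0 < val (branch false x) `^ alpha -> 0 < val (branch false x).
  by apply: gt0_powR => //; case/andP: (I01P (branch false x)).
move: a_gt0; rewrite /transfer.
move: (tamed_power k (branch false x)) (tamed_power k (branch true x)) hL1 hLk hR1 => hL hR.
move: (val (branch false x)) (val (branch true x) `^ alpha) => y b.
move: (y `^ alpha) => a hL1 hLk hR1 a_gt0 a1 a0 XE b0b hLa hRb.
have bp : 0 < b by exact: lt_le_trans b00 b0b.
have hRb0 : hR <= b0^-1.
  by apply: (le_trans hRb); rewrite lef_pV2 ?posrE.
have eR : expR (- (s * b)) <= expR (- (s * b0)).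
  by rewrite ler_expR lerN2 ler_wpM2l// ltW.
have eR1 : expR (- (s * b0)) <= 1 by rewrite expR_le1 oppr_le0 mulr_ge0// ltW.
have hR0 : 0 <= hR by exact: le_trans hR1.
have hL0 : 0 <= hL by exact: le_trans hL1.
(* If [h] is truncated at [x], it has its maximal value [k^-1] there and only the right branch costs
   extra; otherwise [neutral_gain] applies. *)
have [Xk|kX] := leP (val x `^ alpha) k.
  have -> : tamed_power k x = k^-1 by rewrite /tamed_power max_r.
  have -> : (1 + k / b0) * k^-1 = k^-1 + b0^-1.
    by field; rewrite !gt_eqF.
  apply: lerD.
    apply: le_trans hLk; rewrite ler_piMl//.
    by rewrite expR_le1 oppr_le0 mulr_ge0// ltW.
  by apply: le_trans hRb0; rewrite ler_piMl// (le_trans eR).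
have X0 : 0 < val x `^ alpha by exact: lt_trans kX.
have -> : tamed_power k x = (val x `^ alpha)^-1.
  by rewrite /tamed_power max_l// ltW.
have ap : 0 < a.
  by rewrite lt_def a0 andbT; apply/eqP => aE; move: X0; rewrite XE aE mul0r ltxx.
rewrite XE in X0 *.
apply: (@le_trans _ _ (a * (1 + a) `^ alpha)^-1); last first.
  rewrite ler_peMl ?invr_ge0 ?(ltW X0)// lerDl divr_ge0//; exact: ltW.
apply: (@le_trans _ _ (expR (- (s * a)) * a^-1 + expR (- (s * b0)) * b0^-1)).
  apply: lerD; first by rewrite ler_wpM2l ?expR_ge0// hLa// a_gt0.
  by rewrite ler_pM ?expR_ge0.
by apply: neutral_gain => //; rewrite ap.
Qed.

Lemma low_supersolution : exists2 s : R, 0 < s & forall phi (q : R),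
  (forall x, phi x <= q - s * val x `^ alpha) -> forall e, 0 < e ->
  exists h B, (forall x, 1 <= h x <= B) /\
    forall x, transfer phi h x <= expR (q + e) * h x.
Proof.
have [s s0 hs] := tamed_power_super; exists s => // phi q hphi e e0.
(* Then [1 + k / right_floor <= 1 + e <= exp e]. *)
pose k := Num.min 1 (e * right_floor).
have k01 : 0 < k <= 1.
  by rewrite lt_min ltr01 mulr_gt0 ?right_floor_gt0//= ge_min lexx.
exists (tamed_power k), k^-1; split=> x; first exact: tamed_power_bnd.
have h0 y : 0 <= tamed_power k y.
  by have /andP[h _] := tamed_power_bnd y k01; exact: le_trans h.
apply: (le_trans (transfer_le x hphi h0)).
rewrite transfer_shift expRD -mulrA ler_wpM2l ?expR_ge0//.
apply: (le_trans (hs k x k01)); rewrite ler_wpM2r//.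
apply: (le_trans (expR_ge1Dx _)); rewrite ler_expR.
by rewrite ler_pdivrMr ?right_floor_gt0// ge_min lexx orbT.
Qed.

(** No invariant measure does better than the Dirac mass at 0, which has zero entropy. By
    [entropy_fin], [fine] loses nothing here. *)
Definition subcritical phi : Prop := forall nu : probability I R,
  invariant_measure f nu ->
  fine (entropy f nu) + \int[nu]_x phi x <= phi (I01_zero R).

Lemma low_subcritical : exists2 s : R, 0 < s & forall g phi, 0 < g ->
  is_holder g phi ->
  (forall x, phi x <= phi (I01_zero R) - s * val x `^ alpha) -> subcritical phi.
Proof.
have [s s0 hs] := low_supersolution; exists s => // g phi g0 hphi low nu inv.
apply/ler_addgt0Pr => e e0.
have [h [B [hB hsup]]] := hs phi _ low e e0.
have := entropy_le alpha_gt0 inv g0 hphi ltr01 hB hsup.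
by rewrite (entropy_fin alpha_gt0 inv) lee_fin lerBrDr.
Qed.

End LowPotentials.

(** * Supersolutions and the resolvent of the transfer operator *)

Section Supersolutions.
Variables (R : realType) (alpha : R).
Hypothesis alpha_gt0 : 0 < alpha.
Local Notation I := (I01 R).
Local Notation f := (@intermittent_map R alpha).
Local Notation branch := (branch alpha).
Local Notation transfer := (@transfer R alpha).
Implicit Types (phi h : I -> R) (x y : I) (p : R).

(** No regularity of [h] is asked, only bounds from both sides: enough for [entropy_le], and stable
    under the geometric means of [supersolvable_interpolate]. *)
Definition supersolvable phi p := exists h B,
  (forall x, 1 <= h x <= B) /\ (forall x, transfer phi h x <= expR p * h x).

Lemma supersolvable_le phi p p' : p <= p' -> supersolvable phi p -> supersolvable phi p'.
Proof.
move=> pp' [h [B [hB hs]]]; exists h, B; split=> // x.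
rewrite (le_trans (hs x))// ler_wpM2r ?ler_expR//.
by have /andP[h1 _] := hB x; rewrite (le_trans ler01).
Qed.

Lemma supersolvable_ge g phi : 0 < g -> is_holder g phi ->
  ~ subcritical alpha phi ->
  exists2 p0, phi (I01_zero R) < p0 & forall p, supersolvable phi p -> p0 <= p.
Proof.
move=> g0 hphi /existsNP[nu] /not_implyP[inv] /negP; rewrite -ltNge => lt.
exists (fine (entropy f nu) + \int[nu]_x phi x) => // p [h [B [hB hs]]].
have := entropy_le alpha_gt0 inv g0 hphi ltr01 hB hs.
by rewrite (entropy_fin alpha_gt0 inv) lee_fin lerBrDr.
Qed.

Lemma supersolvable_nonempty phi M : (forall x, `|phi x| <= M) ->
  supersolvable phi (M + ln 2).
Proof.
move=> hM; exists (fun=> 1), 1; split=> x; first by rewrite lexx.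
rewrite /transfer !mulr1 expRD lnK ?posrE// mulr_natr mulr2n.
by apply: lerD; rewrite ler_expR (le_trans (ler_norm _)).
Qed.

Lemma young_expR (t a b : R) : 0 <= t <= 1 ->
  expR ((1 - t) * a + t * b) <= (1 - t) * expR a + t * expR b.
Proof.
move=> /andP[t0 t1]; set m := (1 - t) * a + t * b.
have tan c : expR m * (1 + (c - m)) <= expR c.
  rewrite (_ : expR c = expR m * expR (c - m)); last first.
    by rewrite -expRD [m + _]addrC subrK.
  by rewrite ler_wpM2l ?expR_ge0// expR_ge1Dx.
have t1' : 0 <= 1 - t by rewrite subr_ge0.
have := lerD (ler_wpM2l t1' (tan a)) (ler_wpM2l t0 (tan b)).
by apply: le_trans; rewrite /m le_eqVlt; apply/orP; left; apply/eqP; ring.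
Qed.

Lemma expR_sum_le1 (a b P : R) : expR a + expR b <= expR P ->
  expR (a - P) + expR (b - P) <= 1.
Proof. by move=> h; rewrite !expRB -mulrDl ler_pdivrMr ?expR_gt0// mul1r. Qed.

(* Hoelder's inequality makes [p] convex along the segment of potentials. *)
Lemma supersolvable_interpolate phi (v : I -> R) c p1 p2 t : 0 <= t <= 1 ->
  supersolvable phi p1 -> supersolvable (fun x => phi x - c * v x) p2 ->
  supersolvable (fun x => phi x - t * c * v x) ((1 - t) * p1 + t * p2).
Proof.
move=> t01 [h1 [B1 [hB1 hs1]]] [h2 [B2 [hB2 hs2]]]; have /andP[t0 t1] := t01.
have t1' : 0 <= 1 - t by rewrite subr_ge0.
have expE (h : I -> R) B : (forall x, 1 <= h x <= B) ->
    exists u : I -> R, (forall x, h x = expR (u x)) /\ (forall x, 0 <= u x).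
  move=> hB; exists (fun x => ln (h x)); split=> x; have /andP[h1' _] := hB x.
    by rewrite lnK// posrE (lt_le_trans ltr01).
  by rewrite ln_ge0.
have [u1 [u1E u10]] := expE _ _ hB1; have [u2 [u2E u20]] := expE _ _ hB2.
exists (fun x => expR ((1 - t) * u1 x + t * u2 x)), (B1 + B2); split=> x.
  apply/andP; split.
    by rewrite -[leLHS]expR0 ler_expR addr_ge0// mulr_ge0.
  apply: (le_trans (young_expR _ _ t01)); rewrite -u1E -u2E.
  have /andP[a1 a2] := hB1 x; have /andP[b1 b2] := hB2 x.
  apply: lerD; [apply: le_trans a2|apply: le_trans b2]; rewrite ler_piMl//.
  - by rewrite (le_trans ler01).
  - by rewrite gerBl.
  - by rewrite (le_trans ler01).
pose P := p1 + u1 x; pose Q := p2 + u2 x.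
have H1 : expR (phi (branch false x) + u1 (branch false x) - P) +
    expR (phi (branch true x) + u1 (branch true x) - P) <= 1.
  by apply: expR_sum_le1; rewrite !expRD -!u1E; exact: hs1.
have H2 : expR (phi (branch false x) - c * v (branch false x) + u2 (branch false x) - Q) +
    expR (phi (branch true x) - c * v (branch true x) + u2 (branch true x) - Q) <= 1.
  by apply: expR_sum_le1; rewrite ![expR (_ + u2 _)]expRD -!u2E; exact: hs2.
rewrite /transfer -!expRD.
rewrite -[leRHS]mul1r -ler_pdivrMr ?expR_gt0// mulrDl -!expRB.
have key b : expR (phi (branch b x) - t * c * v (branch b x) +
    ((1 - t) * u1 (branch b x) + t * u2 (branch b x)) -
    ((1 - t) * p1 + t * p2 + ((1 - t) * u1 x + t * u2 x))) <=
    (1 - t) * expR (phi (branch b x) + u1 (branch b x) - P) +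
    t * expR (phi (branch b x) - c * v (branch b x) + u2 (branch b x) - Q).
  apply: le_trans (young_expR _ _ t01).
  by rewrite ler_expR /P /Q le_eqVlt; apply/orP; left; apply/eqP; ring.
apply: (le_trans (lerD (key false) (key true))).
have := lerD (ler_wpM2l t1' H1) (ler_wpM2l t0 H2).
by rewrite !mulr1 subrK !mulrDr addrACA.
Qed.

(** From [branch_gap] and [exp (a / 2) <= 1 + a] on [0, 1]. In exponential form, the contraction of
    a branch acts on Hoelder quotients like subtracting [g / 2 * x ^ alpha] from the potential. *)
Lemma branch_contract g b x y : 0 < g -> val x <= val y ->
  `|val (branch b x) - val (branch b y)| `^ g <=
  expR (- (g / 2 * val (branch b x) `^ alpha)) * `|val x - val y| `^ g.
Proof.
move=> g0 xy; have := branch_gap alpha_gt0 b xy.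
have := branch_le alpha_gt0 b xy.
have : 0 <= val (branch b x) `^ alpha <= 1.
  by rewrite powR_ge0 powR_le1 ?I01P// ltW.
move: (val (branch b x)) (val (branch b y)) (val x) (val y) xy => u v s t st.
move: (u `^ alpha) => a /andP[a0 a1] uv gap.
rewrite distrC ger0_norm ?subr_ge0// distrC ger0_norm ?subr_ge0//.
have ea : expR (a / 2) <= 1 + a.
  have h : 1 - a / 2 <= expR (- (a / 2)) by have := expR_ge1Dx (- (a / 2)).
  have d0 : 0 < 1 - a / 2 by lra.
  rewrite -[leLHS]invrK -expRN -[leRHS]invrK lef_pV2 ?posrE ?expR_gt0 ?invr_gt0 ?ltr_pwDl//.
  apply: le_trans h; rewrite -[leLHS]mul1r ler_pdivrMr ?ltr_pwDl//.
  have : 0 <= a * (1 - a) by rewrite mulr_ge0 ?subr_ge0.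
  by lra.
have vu : v - u <= expR (- (a / 2)) * (t - s).
  rewrite mulrC expRN ler_pdivlMr ?expR_gt0//.
  by apply: le_trans gap; rewrite ler_wpM2l ?subr_ge0.
apply: (le_trans (powR_le_powR (ltW g0) _ vu)); first by rewrite subr_ge0.
rewrite powRM ?expR_ge0 ?subr_ge0// -expRM.
by rewrite (_ : - (a / 2) * g = - (g / 2 * a))//; field.
Qed.

(* For [c] large, only the neutral fixed point counts along
   [phi - c x ^ alpha]. *)
Lemma low_shift g phi e : 0 < g -> is_holder g phi -> 0 < e ->
  exists2 c, 0 < c &
    supersolvable (fun x => phi x - c * val x `^ alpha) (phi (I01_zero R) + e).
Proof.
move=> g0 [_ [N0 hN0]] e0; have [s s0 hs] := low_supersolution alpha_gt0.
pose N := `|N0| + 1; have N1 : 0 < N by rewrite ltr_wpDl.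
(* Below [r] the increment [N * x ^ g] of [phi] is at most [e / 2]; above [r] it is at most [N],
   hence at most [N / r ^ alpha * x ^ alpha]. *)
pose r := (e / 2 / N) `^ g^-1.
have r0 : 0 < r by rewrite powR_gt0// !divr_gt0.
have ra0 : 0 < r `^ alpha by rewrite powR_gt0.
exists (s + N / r `^ alpha); first by rewrite addr_gt0// divr_gt0.
have -> : phi (I01_zero R) + e = (phi (I01_zero R) + e / 2) + e / 2 by field.
apply: (hs _ (phi (I01_zero R) + e / 2)); last by rewrite divr_gt0.
move=> x.
have phix : phi x <= phi (I01_zero R) + N * val x `^ g.
  rewrite -lerBlDl (le_trans (ler_norm _))// (le_trans (hN0 _ _))//.
  have -> : `|val x - val (I01_zero R)| = val x.
    by rewrite subr0 ger0_norm//; case/andP: (I01P x).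
  rewrite ler_wpM2r ?powR_ge0// /N (le_trans (ler_norm _))// lerDl//.
suff : N * val x `^ g <= e / 2 + N / r `^ alpha * val x `^ alpha.
  by move: phix; lra.
have /andP[x0 x1] := I01P x.
have [xr|rx] := leP (val x) r.
  apply: (@le_trans _ _ (e / 2)); last first.
    by rewrite lerDl mulr_ge0 ?powR_ge0// divr_ge0// ltW.
  rewrite mulrC -ler_pdivlMr//.
  apply: (le_trans (powR_le_powR (ltW g0) x0 xr)).
  by rewrite /r -powRrM mulVf ?gt_eqF// powRr1// !divr_ge0// ltW.
apply: (@le_trans _ _ N).
  by rewrite ler_piMr ?(ltW N1)// powR_le1 ?x0// ltW.
rewrite -[leLHS]add0r lerD ?divr_ge0 ?(ltW e0)//.
rewrite -mulrA ler_peMr ?(ltW N1)// mulrC ler_pdivlMr// mul1r.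
by rewrite powR_le_powR ?(ltW alpha_gt0)// ltW.
Qed.

(** * The resolvent above the critical exponent *)

Section Resolvent.
Variables (g : R) (phi : I -> R).
Hypotheses (g_gt0 : 0 < g) (phi_holder : is_holder g phi).
Hypothesis phi_super : ~ subcritical alpha phi.

(** Plays the part of the logarithm of the spectral radius of the transfer operator. *)
Definition critical_exponent := inf [set p | supersolvable phi p].
Local Notation l := critical_exponent.

Lemma critical_exponent_inf : has_inf [set p | supersolvable phi p].
Proof.
have [p0 _ h0] := supersolvable_ge g_gt0 phi_holder phi_super.
have [[M hM] _] := phi_holder.
by split; [exists (M + ln 2); exact: supersolvable_nonempty|exists p0].
Qed.

Lemma critical_exponent_le p : supersolvable phi p -> l <= p.
Proof. by move=> sp; apply: ge_inf => //; case: critical_exponent_inf. Qed.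

Lemma critical_exponent_lt p : l < p -> supersolvable phi p.
Proof.
move=> lp; have [q /= sq qp] := inf_lt critical_exponent_inf.1 lp.
by apply: supersolvable_le sq; exact: ltW.
Qed.

Lemma critical_exponent_gap : phi (I01_zero R) < l.
Proof.
have [p0 lt h0] := supersolvable_ge g_gt0 phi_holder phi_super.
apply: (lt_le_trans lt); apply: lb_le_inf => //.
by case: critical_exponent_inf.
Qed.

(** Interpolates between [phi], with exponent just above [l], and [phi - c * x ^ alpha], with
    exponent [p2], which is below [l] by [critical_exponent_gap]. This is where supercriticality
    enters the regularity of the resolvent. *)
Lemma contracting_supersolution : exists k p3, [/\ 0 <= k <= g / 2, p3 < l &
  supersolvable (fun x => phi x - k * val x `^ alpha) p3].
Proof.
pose e := (l - phi (I01_zero R)) / 2.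
have e0 : 0 < e by rewrite divr_gt0// subr_gt0 critical_exponent_gap.
have [c c0 hc] := low_shift g_gt0 phi_holder e0.
set p2 := phi (I01_zero R) + e in hc.
have p2l : p2 < l by have := critical_exponent_gap; rewrite /p2 /e; lra.
pose t := Num.min 1 (g / 2 / c).
have t0 : 0 < t by rewrite lt_min ltr01 !divr_gt0.
have t1 : t <= 1 by rewrite ge_min lexx.
(* The excess over [l] is half of the gain [t * (l - p2)] of the interpolation. *)
pose p1 := l + t * (l - p2) / 2.
have td : 0 < t * (l - p2) by rewrite mulr_gt0// subr_gt0.
have p1l : l < p1 by rewrite /p1 ltrDl divr_gt0.
exists (t * c), ((1 - t) * p1 + t * p2); split.
- rewrite mulr_ge0 ?(ltW t0) ?(ltW c0)//= -ler_pdivlMr//.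
  by rewrite ge_min lexx orbT.
- have -> : (1 - t) * p1 + t * p2 = l - t * (l - p2) / 2 - t * (t * (l - p2)) / 2.
    by rewrite /p1; field.
  have : 0 < t * (t * (l - p2)) by rewrite mulr_gt0.
  by lra.
apply: supersolvable_interpolate => //; first by rewrite (ltW t0).
exact: critical_exponent_lt.
Qed.

(** Partial sums of the Neumann series of [exp (- p) * transfer phi] at the constant 1. *)
Fixpoint partial_resolvent p n x : R :=
  if n is m.+1 then 1 + expR (- p) * transfer phi (partial_resolvent p m) x else 1.

Lemma transfer_ge0 h x : (forall y, 0 <= h y) -> 0 <= transfer phi h x.
Proof. by move=> h0; rewrite addr_ge0// mulr_ge0 ?expR_ge0. Qed.

Lemma transfer_mono h h' x : (forall y, h y <= h' y) ->
  transfer phi h x <= transfer phi h' x.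
Proof. by move=> hh; apply: lerD; rewrite ler_wpM2l ?expR_ge0. Qed.

Lemma partial_resolvent_ge1 p n x : 1 <= partial_resolvent p n x.
Proof.
elim: n x => [//|n ih] x /=; rewrite lerDl mulr_ge0 ?expR_ge0// transfer_ge0// => y.
exact: le_trans (ih y).
Qed.

Lemma partial_resolventS p n x : partial_resolvent p n x <= partial_resolvent p n.+1 x.
Proof.
elim: n x => [|n ih] x; first exact: (partial_resolvent_ge1 p 1).
by rewrite /= lerD2l ler_wpM2l ?expR_ge0//; exact: transfer_mono.
Qed.

(** With a supersolution [h] of exponent [q < p], the series is dominated by a geometric one of
    ratio [exp (q - p)], of which [k] is the sum. *)
Lemma partial_resolvent_bounded p : l < p ->
  exists B, forall n x, partial_resolvent p n x <= B.
Proof.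
move=> lp; have [q /= [h [B [hB hs]]] qp] := inf_lt critical_exponent_inf.1 lp.
pose k := (1 - expR (q - p))^-1.
have d0 : 0 < 1 - expR (q - p) by rewrite subr_gt0 expR_lt1 subr_lt0.
have k0 : 0 < k by rewrite invr_gt0.
have k1 : 1 <= k by rewrite -[leLHS]invr1 lef_pV2 ?posrE// gerBl expR_ge0.
exists (k * B).
suff H n x : partial_resolvent p n x <= k * h x.
  by move=> n x; rewrite (le_trans (H n x))// ler_wpM2l ?(ltW k0)//; case/andP: (hB x).
elim: n x => [|n ih] x.
  by have /andP[h1 _] := hB x; rewrite /= -[leLHS]mulr1 ler_pM.
have -> : k * h x = (1 - expR (q - p)) * k * h x + expR (q - p) * k * h x by ring.
rewrite /k mulfV ?gt_eqF// mul1r -/k /=; apply: lerD; first by case/andP: (hB x).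
rewrite expRD.
have -> : expR q * expR (- p) * k * h x = expR (- p) * (k * (expR q * h x)) by ring.
rewrite ler_wpM2l ?expR_ge0//.
apply: (le_trans (transfer_mono _ ih)).
have -> : transfer phi (fun y => k * h y) x = k * transfer phi h x.
  by rewrite /transfer mulrDr; congr (_ + _); exact: mulrCA.
by rewrite ler_wpM2l// ltW.
Qed.

(** The Hoelder quotient is weighted by the supersolution [H] for [phi - k * x ^ alpha]: the
    contraction of branches turns [phi] into that potential, of exponent [p3 < l]. The variation of
    [exp phi] costs [2 * K * S] per step, which fixes [C] by [C * (exp l - exp p3) = 2 * K],
    independently of [p]. *)
Lemma partial_resolvent_holder k p3 : 0 <= k <= g / 2 -> p3 < l ->
  supersolvable (fun x => phi x - k * val x `^ alpha) p3 ->
  exists2 C, 0 < C & forall p S, l < p ->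
    (forall n x, partial_resolvent p n x <= S) -> forall n x y,
    `|partial_resolvent p n x - partial_resolvent p n y| <=
      C * S * `|val x - val y| `^ g.
Proof.
move=> /andP[k0 kg] p3l [H [B [HB Hs]]].
have [[M hM] [N hN]] := is_holder_expR phi_holder.
pose K := `|N| + 1; have K0 : 0 < K by rewrite ltr_wpDl.
have hK x y : `|expR (phi x) - expR (phi y)| <= K * `|val x - val y| `^ g.
  rewrite (le_trans (hN x y))// ler_wpM2r ?powR_ge0//.
  by rewrite (le_trans (ler_norm _))// lerDl.
have dl : 0 < expR l - expR p3 by rewrite subr_gt0 ltr_expR.
have [C [C0 CE]] : exists C, 0 < C /\ C * (expR l - expR p3) = 2 * K.
  exists (2 * K / (expR l - expR p3)).
  by rewrite divfK ?gt_eqF// divr_gt0// mulr_gt0.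
have B1 : 0 < B.
  by have /andP[a b] := HB (I01_zero R); rewrite (lt_le_trans ltr01)// (le_trans a).
exists (C * B); first by rewrite mulr_gt0.
move=> p S lp hS.
have S0 : 0 <= S.
  by rewrite (le_trans _ (hS 0%N (I01_zero R))).
have H0 x : 0 <= H x by have /andP[a _] := HB x; exact: le_trans a.
(* The weight is taken at the left endpoint, where [branch_contract] evaluates its factor. *)
suff main n x y : val x <= val y ->
    `|partial_resolvent p n x - partial_resolvent p n y| <=
    C * S * H x * `|val x - val y| `^ g.
  move=> n x y; wlog xy : x y / val x <= val y => [hw|].
    have [|/ltW] := leP (val x) (val y) => h; first exact: hw.
    by rewrite distrC (distrC (val x)); exact: hw.
  apply: (le_trans (main n x y xy)); rewrite ler_wpM2r ?powR_ge0//.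
  rewrite [leRHS]mulrAC ler_wpM2l ?mulr_ge0 ?(ltW C0)//.
  by case/andP: (HB x).
elim: n x y => [|n ih] x y xy.
  by rewrite subrr normr0 !mulr_ge0 ?powR_ge0 ?(ltW C0).
set r := partial_resolvent p n in ih *; set d := `|val x - val y| `^ g.
have d0 : 0 <= d by exact: powR_ge0.
have term b : `|expR (phi (branch b x)) * r (branch b x) -
    expR (phi (branch b y)) * r (branch b y)| <=
    (C * S) * d * (expR (phi (branch b x) - k * val (branch b x) `^ alpha) * H (branch b x))
    + K * S * d.
  have -> : expR (phi (branch b x)) * r (branch b x) -
      expR (phi (branch b y)) * r (branch b y) =
      expR (phi (branch b x)) * (r (branch b x) - r (branch b y)) +
      (expR (phi (branch b x)) - expR (phi (branch b y))) * r (branch b y) by ring.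
  rewrite (le_trans (ler_normD _ _))// !normrM; apply: lerD.
    rewrite ger0_norm ?expR_ge0// expRD.
    apply: (le_trans (ler_wpM2l (expR_ge0 _) (ih _ _ (branch_le alpha_gt0 b xy)))).
    have hc := branch_contract b g_gt0 xy.
    have : `|val (branch b x) - val (branch b y)| `^ g <=
        expR (- (k * val (branch b x) `^ alpha)) * d.
      apply: (le_trans hc); rewrite ler_wpM2r// ler_expR lerN2.
      by rewrite ler_wpM2r// powR_ge0.
    move=> hc'.
    have CS0 : 0 <= expR (phi (branch b x)) * (C * S * H (branch b x)).
      by rewrite !mulr_ge0 ?expR_ge0 ?(ltW C0).
    rewrite mulrA; apply: (le_trans (ler_wpM2l CS0 hc')).
    by rewrite le_eqVlt; apply/orP; left; apply/eqP; ring.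
  have r0 : 0 <= r (branch b y) by rewrite (le_trans ler01)// partial_resolvent_ge1.
  rewrite mulrAC; apply: ler_pM => //; last by rewrite ger0_norm//; exact: hS.
  apply: (le_trans (hK _ _)); rewrite ler_wpM2l ?(ltW K0)//.
  by rewrite powR_le_powR ?(ltW g_gt0) ?branch_lip.
have -> : partial_resolvent p n.+1 x - partial_resolvent p n.+1 y =
  expR (- p) * ((expR (phi (branch false x)) * r (branch false x) -
    expR (phi (branch false y)) * r (branch false y)) +
    (expR (phi (branch true x)) * r (branch true x) -
    expR (phi (branch true y)) * r (branch true y))).
  rewrite /= /transfer -/r opprD addrACA subrr add0r -mulrBr; congr (_ * _).
  by rewrite opprD addrACA.
rewrite normrM ger0_norm ?expR_ge0// expRN mulrC ler_pdivrMr ?expR_gt0//.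
apply: (le_trans (ler_normD _ _)).
apply: (le_trans (lerD (term false) (term true))).
have CSd : 0 <= C * S * d by rewrite !mulr_ge0// ltW.
have := ler_wpM2l CSd (Hs x); rewrite /transfer => h1.
have h2 : 2 * (K * S * d) <= C * S * H x * d * (expR p - expR p3).
  have -> : C * S * H x * d * (expR p - expR p3) =
     (S * d) * (C * (expR p - expR p3) * H x) by ring.
  have -> : 2 * (K * S * d) = (S * d) * (2 * K) by ring.
  rewrite ler_wpM2l ?mulr_ge0//.
  apply: (@le_trans _ _ (C * (expR p - expR p3))).
    by rewrite -CE ler_wpM2l ?(ltW C0)// lerD2r ler_expR ltW.
  rewrite ler_peMr//; last by case/andP: (HB x).
  by rewrite mulr_ge0 ?(ltW C0)// subr_ge0 ler_expR ltW// (lt_trans p3l).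
have -> : C * S * H x * d * expR p =
   C * S * d * (expR p3 * H x) + C * S * H x * d * (expR p - expR p3) by ring.
apply: le_trans (lerD h1 h2).
by rewrite addrACA -mulrDr mulr_natl mulr2n.
Qed.

(** [C] is the same for all [p > l], so the functions [h / S] stay equi-Hoelder as [p] decreases to
    [l]. The last clause provides a point where [h] is nearly maximal. *)
Lemma resolvent : exists2 C, 0 < C & forall p, l < p -> exists h S,
  [/\ forall x, 1 <= h x <= S, forall x, h x = 1 + expR (- p) * transfer phi h x,
    forall x y, `|h x - h y| <= C * S * `|val x - val y| `^ g &
    exists x, 3 / 4 * S <= h x].
Proof.
have [k [p3 [kg p3l sp3]]] := contracting_supersolution.
have [C C0 hC] := partial_resolvent_holder kg p3l sp3.
exists C => // p lp; have [B hB] := partial_resolvent_bounded lp.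
pose r n x := partial_resolvent p n x.
have cv x : cvgn (fun n => r n x).
  apply: nondecreasing_is_cvgn.
    by apply/nondecreasing_seqP => n; exact: partial_resolventS.
  by exists B => _ [n _ <-]; exact: hB.
pose h x := limn (fun n => r n x).
have rh n x : r n x <= h x.
  apply: nondecreasing_cvgn_le => //.
  by apply/nondecreasing_seqP => m; exact: partial_resolventS.
have h1 x : 1 <= h x by exact: le_trans (rh 0%N x).
have hhB x : h x <= B by apply: limr_le => //; near=> n; exact: hB.
pose S := sup [set h x | x in setT].
have hasS : has_sup [set h x | x in setT].
  by split; [exists (h (I01_zero R)), (I01_zero R)|exists B => _ [x _ <-]].
have hS x : h x <= S by apply: ub_le_sup; [case: hasS|exists x].
have S1 : 0 < S by rewrite (lt_le_trans ltr01)// (le_trans (h1 (I01_zero R))).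
exists h, S; split=> [x|x|x y|].
- by rewrite h1 hS.
- have c1 : (fun n => r n.+1 x) @ \oo --> h x.
    have := cv x; rewrite -(cvg_shiftS (fun n => r n x)).
    by move=> c; have := cv x => /cvg_ex[/= a ha]; rewrite /h (cvg_lim _ ha)//; move: ha; rewrite -cvg_shiftS.
  have c2 : (fun n => r n.+1 x) @ \oo --> 1 + expR (- p) * transfer phi h x.
    apply: cvgD; first exact: cvg_cst.
    apply: cvgM; first exact: cvg_cst.
    by apply: cvgD; (apply: cvgM; [exact: cvg_cst|exact: cv]).
  exact: (cvg_unique _ c1 c2).
- have c : (fun n => `|r n x - r n y|) @ \oo --> `|h x - h y|.
    by apply: cvg_norm; apply: cvgB; exact: cv.
  apply: (cvgr_to_le c); near=> n; apply: hC => // m z.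
  exact: le_trans (rh m z) (hS z).
have [|_ [x _ <-] hx] := @sup_adherent _ _ (S / 4) _ hasS; first by rewrite divr_gt0.
by exists x; move: hx; rewrite -/S; lra.
Unshelve. all: by end_near. Qed.

End Resolvent.

End Supersolutions.

(** * Perturbation to an exact eigenfunction *)

Section EigenfunctionPerturbation.
Variables (R : realType) (alpha : R).
Hypothesis alpha_gt0 : 0 < alpha.
Local Notation I := (I01 R).
Local Notation f := (@intermittent_map R alpha).
Local Notation branch := (branch alpha).
Local Notation tword := (tword alpha).
Local Notation transfer := (@transfer R alpha).
Local Notation F := (lift_fun alpha).
Variables (g : R) (phi : I -> R).
Hypotheses (g01 : 0 < g <= 1) (g_le : g <= alpha) (phi_holder : is_holder g phi).
Hypothesis phi_super : ~ subcritical alpha phi.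
Local Notation l := (critical_exponent alpha phi).

Let g_gt0 : 0 < g. Proof. by case/andP: g01. Qed.

Lemma tword_lower (q : R) (h : I -> R) w x : 0 <= q ->
  (forall b y, q * h (branch b y) <= h y) -> q ^+ size w * h (tword w x) <= h x.
Proof.
move=> q0 hq; elim: w => [|b w ih] /=; first by rewrite expr0 mul1r.
by apply: le_trans ih; rewrite exprSr -mulrA ler_wpM2l ?exprn_ge0.
Qed.

(** A Harnack inequality. For any [x], some inverse branch of order [m] leads so near the almost
    maximal point [x0] that [h] is at least [3/4 S - 1/4 S] there, and [h x] is at least [q ^ m]
    times that value. As [p <= l + 1], neither [m] nor [q] depends on [p]. *)
Lemma resolvent_ratio : exists C c : R, [/\ 0 < C, 0 < c &
  forall p, l < p -> p <= l + 1 -> exists h S,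
  [/\ forall x, 1 <= h x <= S, forall x, c * S <= h x,
    forall x, h x = 1 + expR (- p) * transfer phi h x &
    forall x y, `|h x - h y| <= C * S * `|val x - val y| `^ g]].
Proof.
have [C C0 hC] := resolvent alpha_gt0 g_gt0 phi_holder phi_super.
have [[M hM] _] := phi_holder.
pose r := (1 / 4 / C) `^ g^-1.
have r0 : 0 < r by apply: powR_gt0; rewrite !divr_gt0.
have [m hm] := cyl_diam_cvg0 alpha_gt0 r0.
have dm : C * cyl_diam alpha m `^ g <= 1 / 4.
  rewrite mulrC -ler_pdivlMr//.
  have /andP[d0 _] := cyl_diam01 alpha_gt0 m.
  apply: (le_trans (powR_le_powR (ltW g_gt0) d0 (ltW (hm m (leqnn m))))).
  by rewrite /r -powRrM mulVf ?gt_eqF// powRr1// !divr_ge0// ltW.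
have [q [q0 qE]] : exists q, 0 < q /\ q = expR (- (l + 1) - M).
  by exists (expR (- (l + 1) - M)); split=> //; exact: expR_gt0.
have qm : 0 < q ^+ m by exact: exprn_gt0.
exists C, (q ^+ m / 2); split=> //; first exact: divr_gt0.
move=> p lp pl; have [h [S [hS hE hH [x0 hx0]]]] := hC p lp.
exists h, S; split=> // x.
have h0 y : 0 <= h y by have /andP[a _] := hS y; exact: le_trans a.
have S0 : 0 <= S by have /andP[a b] := hS x; exact: le_trans (h0 x) b.
have hq b y : q * h (branch b y) <= h y.
  rewrite [leRHS]hE.
  have tb : expR (phi (branch b y)) * h (branch b y) <= transfer phi h y.
    have t0 b' : 0 <= expR (phi (branch b' y)) * h (branch b' y).
      by rewrite mulr_ge0 ?expR_ge0.
    by rewrite /transfer; case: b; rewrite ?lerDl ?lerDr.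
  apply: (@le_trans _ _ (expR (- p) * (expR (phi (branch b y)) * h (branch b y)))).
    rewrite mulrA -expRD ler_wpM2r// qE ler_expR.
    have := hM (branch b y); rewrite ler_norml => /andP[+ _].
    by move: pl; lra.
  apply: (le_trans (ler_wpM2l (expR_ge0 _) tb)).
  by rewrite lerDr.
pose w := itin alpha m x0.
have := tword_lower w x (ltW q0) hq; rewrite size_itin; apply: le_trans.
rewrite -mulrA ler_wpM2l ?(ltW qm)//.
have := hH x0 (tword w x); move=> /(le_trans (ler_norm _)).
have : `|val x0 - val (tword w x)| `^ g <= cyl_diam alpha m `^ g.
  apply: powR_le_powR => //; first exact: ltW.
  rewrite -[X in val X - _](tword_itin alpha_gt0 m x0).
  by apply: (le_trans (tword_dist alpha_gt0 _ _ _)); rewrite size_itin.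
move=> hd; have := ler_wpM2l (mulr_ge0 (ltW C0) S0) hd.
have := ler_wpM2r S0 dm; rewrite mulrAC => h1 h2 h3.
have := le_trans h3 (le_trans h2 h1); move: hx0; lra.
Qed.

(** As [h <= S], [transfer phi h = exp p * (h - 1) <= exp p * (1 - 1 / S) * h]; so [h] itself is a
    supersolution of exponent [p - 1 / S], which cannot lie below [l]. *)
Lemma resolvent_large p h S : l < p -> (forall x, 1 <= h x <= S) ->
  (forall x, h x = 1 + expR (- p) * transfer phi h x) -> S^-1 <= p - l.
Proof.
move=> lp hS hE; have h1 x : 1 <= h x by case/andP: (hS x).
have S1 : 1 <= S by have /andP[a b] := hS (I01_zero R); exact: le_trans b.
have S0 : 0 < S by exact: lt_le_trans S1.
have h0 x : 0 <= h x by exact: le_trans (h1 x).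
suff : supersolvable alpha phi (p - S^-1).
  by move=> /(critical_exponent_le alpha_gt0 g_gt0 phi_holder phi_super); lra.
exists h, S; split=> // x.
have tE : transfer phi h x = expR p * (h x - 1).
  by rewrite [in RHS]hE addrC addKr mulrA -expRD subrr expR0 mul1r.
rewrite tE expRD -mulrA ler_wpM2l ?expR_ge0//.
apply: (@le_trans _ _ ((1 - S^-1) * h x)).
  rewrite mulrBl mul1r lerD2l lerN2 mulrC ler_pdivrMr// mul1r.
  by case/andP: (hS x).
by rewrite ler_wpM2r// (le_trans _ (expR_ge1Dx _)).
Qed.

Lemma is_holder_power : is_holder g (fun x : I => val x `^ alpha).
Proof.
have [M M0 hM] := powR_holder g01 g_le; split.
  exists 1 => x; rewrite ger0_norm ?powR_ge0// powR_le1 ?I01P//; exact: ltW.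
by exists M => x y; apply: hM; exact: I01P.
Qed.

Lemma is_holder_val : is_holder g (fun x : I => val x : R).
Proof. by apply: (@lipschitz_holder _ _ 1) => // x y; rewrite mul1r. Qed.

(** [f] jumps where the lift crosses 1; folding the lift there keeps Hoelder continuity. *)
Lemma is_holder_fold : is_holder g (fun x : I => `|F (val x) - 1|).
Proof.
apply: (@is_holder_lipschitz _ _ (fun t => `|t - 1|) 1).
  move=> x y; rewrite mul1r.
  have -> : F (val x) - F (val y) = (F (val x) - 1) - (F (val y) - 1) by ring.
  exact: ler_dist_dist.
rewrite /lift_fun; apply: is_holderM; first exact: is_holder_val.
by apply: is_holderD; [exact: is_holder_cst|exact: is_holder_power].
Qed.

Lemma ln1D_lip (a b : R) : 0 <= a -> 0 <= b -> `|ln (1 + a) - ln (1 + b)| <= `|a - b|.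
Proof.
wlog ba : a b / b <= a => [hw a0 b0|a0 b0].
  by have [|/ltW] := leP b a => h; [|rewrite distrC (distrC a)]; exact: hw.
have a1 : 0 < 1 + a by rewrite ltr_pwDl.
have b1 : 0 < 1 + b by rewrite ltr_pwDl.
rewrite !ger0_norm ?subr_ge0 ?ler_ln ?posrE ?lerD2l//.
rewrite -ln_div ?posrE//.
have -> : (1 + a) / (1 + b) = 1 + (a - b) / (1 + b) by field; rewrite gt_eqF.
apply: (le_trans (le_ln1Dx _)).
  by rewrite (lt_le_trans (ltrN10 R))// divr_ge0 ?subr_ge0// ltW.
by rewrite ler_pdivrMr// ler_peMr ?subr_ge0// lerDl.
Qed.

(* As [|F - 1|] takes the values [1 - x] and [x] at the two preimages of [x],
   adding [ln (1 + expR p * |F - 1| * expR (- phi) / h)] to [phi] adds exactly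
   the missing [expR p] to [transfer phi h = expR p * (h - 1)]. *)
Lemma eigenfunction_perturbation e : 0 < e -> exists (u h : I -> R) p,
  [/\ forall x, `|u x| <= e, forall x y, `|u x - u y| <= e * `|val x - val y| `^ g,
    is_holder g h, forall x, 1 <= h x &
    forall x, transfer (fun y => phi y + u y) h x = expR p * h x].
Proof.
move=> e0; have [C [c [C0 c0 hR]]] := resolvent_ratio.
pose k x := `|F (val x) - 1| * expR (- phi x).
have [[M0 hM0] [N0 hN0]] : is_holder g k.
  by apply: is_holderM; [exact: is_holder_fold|exact/is_holder_expR/is_holderN].
have k0 x : 0 <= k x by rewrite mulr_ge0 ?expR_ge0.
have [M [M1 hM]] : exists M, 0 < M /\ forall x, k x <= M.
  exists (`|M0| + 1); split; first by rewrite ltr_wpDl.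
  move=> x; rewrite (le_trans (ler_norm _))// (le_trans (hM0 x))//.
  by rewrite (le_trans (ler_norm _))// lerDl.
have [N [N1 hN]] : exists N, 0 < N /\
    forall x y, `|k x - k y| <= N * `|val x - val y| `^ g.
  exists (`|N0| + 1); split; first by rewrite ltr_wpDl.
  move=> x y; rewrite (le_trans (hN0 x y))// ler_wpM2r ?powR_ge0//.
  by rewrite (le_trans (ler_norm _))// lerDl.
have [Z [Z0 ZE]] : exists Z, 0 < Z /\ Z = expR (l + 1).
  by exists (expR (l + 1)); split=> //; exact: expR_gt0.
(* [K1 / S] and [K2 / S] will bound the supremum and the Hoelder constant of the correction [q]; [d]
   makes both at most [e], since [S >= 1 / d]. *)
pose K1 := Z * (M / c); pose K2 := Z * (N / c + M * (c^-1 ^+ 2 * C)).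
have K10 : 0 < K1 by rewrite mulr_gt0// divr_gt0.
have K20 : 0 < K2.
  rewrite mulr_gt0// addr_gt0 ?divr_gt0// mulr_gt0// mulr_gt0//.
  by rewrite exprn_gt0// invr_gt0.
pose d := Num.min 1 (Num.min (e / K1) (e / K2)).
have d0 : 0 < d by rewrite !lt_min ltr01 !divr_gt0.
have lp : l < l + d by rewrite ltrDl.
have pl : l + d <= l + 1 by rewrite lerD2l ge_min lexx.
have [h [S [hS hc hE hH]]] := hR (l + d) lp pl.
have Sd : S^-1 <= d.
  by have := resolvent_large lp hS hE; rewrite addrC addKr.
have S1 : 1 <= S by have /andP[a b] := hS (I01_zero R); exact: le_trans b.
have S0 : 0 < S by exact: lt_le_trans S1.
have cS0 : 0 < c * S by rewrite mulr_gt0.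
have h1 x : 1 <= h x by case/andP: (hS x).
have h0 x : 0 < h x by exact: lt_le_trans (h1 x).
set p := l + d in lp pl hE.
have ep0 : 0 < expR p by exact: expR_gt0.
have epZ : expR p <= Z by rewrite ZE ler_expR.
pose q x := expR p * (k x / h x).
have q0 x : 0 <= q x.
  by rewrite mulr_ge0 ?(ltW ep0)// divr_ge0// ltW.
have hhol : is_holder g h.
  split; first by exists S => x; rewrite ger0_norm ?(ltW (h0 x))//; case/andP: (hS x).
  by exists (C * S).
have K1e : K1 * S^-1 <= e.
  rewrite mulrC -ler_pdivlMr// (le_trans Sd)// /d ge_min; apply/orP; right.
  by rewrite ge_min lexx.
have K2e : K2 * S^-1 <= e.
  rewrite mulrC -ler_pdivlMr// (le_trans Sd)// /d ge_min; apply/orP; right.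
  by rewrite ge_min lexx orbT.
have qe x : q x <= e.
  apply: le_trans K1e; rewrite /q /K1 -mulrA.
  apply: ler_pM; [exact: ltW|by rewrite divr_ge0// ltW|exact: epZ|].
  rewrite -mulrA -invfM; apply: ler_pM => //; first by rewrite invr_ge0 ltW.
  by rewrite lef_pV2 ?posrE.
have qh x y : `|q x - q y| <= e * `|val x - val y| `^ g.
  have D0 : 0 <= `|val x - val y| `^ g by exact: powR_ge0.
  apply: (@le_trans _ _ (K2 * S^-1 * `|val x - val y| `^ g)); last by rewrite ler_wpM2r.
  have -> : q x - q y = expR p * ((k x - k y) * (h x)^-1 + k y * ((h x)^-1 - (h y)^-1)).
    by rewrite /q; ring.
  rewrite normrM (ger0_norm (ltW ep0)).
  have -> : K2 * S^-1 * `|val x - val y| `^ g =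
     Z * ((N * `|val x - val y| `^ g) * (c * S)^-1 +
          M * ((c * S)^-1 ^+ 2 * (C * S * `|val x - val y| `^ g))).
    by rewrite /K2; field; rewrite !gt_eqF.
  apply: ler_pM; [exact: ltW|exact: normr_ge0|exact: epZ|].
  apply: (le_trans (ler_normD _ _)).
  rewrite (normrM (k x - k y)) (normrM (k y)); apply: lerD.
    apply: ler_pM => //; rewrite normfV (ger0_norm (ltW (h0 x))).
    by rewrite lef_pV2 ?posrE.
  apply: ler_pM => //; first by rewrite ger0_norm.
  apply: (le_trans (inv_lip cS0 (hc x) (hc y))).
  by rewrite ler_wpM2l// exprn_ge0// invr_ge0 ltW.
pose u x := ln (1 + q x).
exists u, h, p; split=> // [x|x y|x].
- have : 0 <= u x by rewrite ln_ge0// lerDl.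
  move=> /ger0_norm ->; apply: le_trans (qe x).
  by apply: le_ln1Dx; rewrite (lt_le_trans (ltrN10 R)).
- apply: le_trans (qh x y); exact: ln1D_lip.
have term b : expR (phi (branch b x) + u (branch b x)) * h (branch b x) =
    expR (phi (branch b x)) * h (branch b x) + expR p * `|b%:R + val x - 1|.
  rewrite expRD /u lnK; last by rewrite posrE ltr_pwDl.
  rewrite mulrDr mulr1 mulrDl; congr (_ + _).
  rewrite /q /k (lift_branch alpha_gt0) expRN.
  by field; rewrite !gt_eqF ?expR_gt0.
have /andP[x0 x1] := I01P x.
have unit1 : `|false%:R + val x - 1| + `|true%:R + val x - 1| = 1.
  have -> : true%:R + val x - 1 = val x by rewrite addrAC subrr add0r.
  by rewrite add0r distrC ger0_norm ?subr_ge0// ger0_norm// subrK.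
transitivity (transfer phi h x +
    expR p * (`|false%:R + val x - 1| + `|true%:R + val x - 1|)).
  rewrite mulrDr [RHS]addrACA; congr (_ + _); [exact: (term false)|exact: (term true)].
rewrite unit1 mulr1 [in RHS]hE mulrDr mulr1 mulrA -expRD subrr expR0 mul1r.
by rewrite addrC.
Qed.

End EigenfunctionPerturbation.

(** * Contraction of Markov operators *)

Section MarkovOperator.
Variables (R : realType) (alpha : R).
Hypothesis alpha_gt0 : 0 < alpha.
Local Notation I := (I01 R).
Local Notation branch := (branch alpha).
Variables (P : bool -> I -> R).

Definition averaging (psi : I -> R) (x : I) : R :=
  P false x * psi (branch false x) + P true x * psi (branch true x).

Lemma averagingD psi chi n x : iter n averaging (fun y => psi y + chi y) x =
  iter n averaging psi x + iter n averaging chi x.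
Proof.
elim: n x => [//|n ih] x; rewrite !iterS /averaging -/averaging !ih.
by ring.
Qed.

Lemma averagingZ c psi n x : iter n averaging (fun y => c * psi y) x =
  c * iter n averaging psi x.
Proof. by elim: n x => [//|n ih] x; rewrite !iterS /averaging !ih; ring. Qed.

Variables (g d N : R).
Hypotheses (g01 : 0 < g <= 1) (d_gt0 : 0 < d).
Hypothesis P_sum : forall x, P false x + P true x = 1.
Hypothesis P_ge : forall b x, d <= P b x.
Hypothesis P_holder : forall x y,
  `|P true x - P true y| <= N * `|val x - val y| `^ g.

Let g_gt0 : 0 < g. Proof. by case/andP: g01. Qed.

Let P_ge0 b x : 0 <= P b x.
Proof. exact: le_trans (ltW d_gt0) (P_ge b x). Qed.

Let P_le1 b x : P b x <= 1.
Proof.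
have := P_sum x; have := P_ge0 true x; have := P_ge0 false x.
by case: b => *; lra.
Qed.

Lemma averaging_cst (c : R) n x : iter n averaging (fun=> c) x = c.
Proof.
elim: n x => [//|n ih] x; rewrite iterS /averaging !ih -mulrDl P_sum.
by rewrite mul1r.
Qed.

Lemma averaging_le psi chi n x : (forall y, psi y <= chi y) ->
  iter n averaging psi x <= iter n averaging chi x.
Proof.
move=> h; elim: n x => [|n ih] x; first exact: h.
by rewrite !iterS lerD// ler_wpM2l.
Qed.

Lemma averaging_dist psi c e n x : (forall y, `|psi y - c| <= e) ->
  `|iter n averaging psi x - c| <= e.
Proof.
move=> h; rewrite ler_norml; apply/andP; split.
  rewrite -[c](averaging_cst _ n x) lerBrDl -[- e](averaging_cst _ n x) -averagingD.
  by apply: averaging_le => y; have := h y; rewrite ler_norml => /andP[? ?]; lra.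
rewrite lerBlDl -[c](averaging_cst _ n x) -[e](averaging_cst _ n x) -averagingD.
by apply: averaging_le => y; have := h y; rewrite ler_norml => /andP[? ?]; lra.
Qed.

Let q : R := expR (- (g / 2 * right_floor alpha)).

Let q_gt0 : 0 < q. Proof. exact: expR_gt0. Qed.

Let q_lt1 : q < 1.
Proof.
rewrite -expR0 ltr_expR oppr_lt0 mulr_gt0 ?divr_gt0//.
exact: right_floor_gt0.
Qed.

Let branch_true_contract x y :
  `|val (branch true x) - val (branch true y)| `^ g <=
  q * `|val x - val y| `^ g.
Proof.
wlog xy : x y / val x <= val y => [hw|].
  by have [/hw//|/ltW/hw] := leP (val x) (val y); rewrite distrC (distrC (val y)).
apply: (le_trans (branch_contract alpha_gt0 true g_gt0 xy)).
rewrite ler_wpM2r ?powR_ge0// ler_expR lerN2 ler_wpM2l//.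
  by rewrite ltW// divr_gt0.
exact: right_floor_le.
Qed.

Let branch_pow_le b x y :
  `|val (branch b x) - val (branch b y)| `^ g <= `|val x - val y| `^ g.
Proof. by apply: powR_le_powR (ltW g_gt0) _ _ => //; exact: branch_lip. Qed.

Let branch_true_iter n x y :
  `|val (iter n (branch true) x) - val (iter n (branch true) y)| `^ g <= q ^+ n.
Proof.
elim: n => [|n ih].
  by rewrite expr0 powR_le1 ?(ltW g_gt0)// normr_ge0 I01_dist1.
rewrite !iterS; apply: (le_trans (branch_true_contract _ _)).
by rewrite exprS ler_wpM2l// ltW.
Qed.

(** Chosen for [M_ge]: the variation of the weights then costs at most half of the gain
    [d * (1 - q)] of the right branch. *)
Let M : R := Num.max 1 (2 * N / (d * (1 - q))).

Let M_ge1 : 1 <= M. Proof. by rewrite le_max lexx. Qed.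

Let M_ge : N <= M * (d * (1 - q) / 2).
Proof.
have h : 0 < d * (1 - q) by rewrite mulr_gt0// subr_gt0.
have : 2 * N / (d * (1 - q)) <= M by rewrite le_max lexx orbT.
rewrite ler_pdivrMr// => ?; lra.
Qed.

(* Oscillation with respect to the bounded metric [min(1, M |x - y|^g)], for
   which [M] is so large that [averaging] contracts short distances. *)
Let osc (K : R) (psi : I -> R) := forall x y,
  psi x - psi y <= K /\ psi x - psi y <= M * K * `|val x - val y| `^ g.

(** Independent coupling of the random steps from [x] and from [y]. *)
Let averaging_pair psi x y : averaging psi x - averaging psi y =
  \sum_(b : bool) \sum_(c : bool) P b x * P c y * (psi (branch b x) - psi (branch c y)).
Proof.
rewrite !big_bool /= /averaging.
have -> : P false x = 1 - P true x by rewrite -(P_sum x) addrK.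
have -> : P false y = 1 - P true y by rewrite -(P_sum y) addrK.
by ring.
Qed.

(** Both points take the same branch: the left one does not expand, the right one, of weight at
    least [d], contracts by [q], and half of this gain pays for the difference of the weights. *)
Let osc_short K psi x y : 0 <= K -> osc K psi ->
  averaging psi x - averaging psi y <=
  (1 - d * (1 - q) / 2) * (M * K * `|val x - val y| `^ g).
Proof.
move=> K0 h.
have [s [sE s0]] : exists s, s = `|val x - val y| `^ g /\ 0 <= s.
  by exists (`|val x - val y| `^ g); split=> //; exact: powR_ge0.
rewrite -sE.
have E : averaging psi x - averaging psi y =
    P false x * (psi (branch false x) - psi (branch false y)) +
    P true x * (psi (branch true x) - psi (branch true y)) +
    (P true x - P true y) * (psi (branch true y) - psi (branch false y)).
  have Py : P false y = 1 - P true y by rewrite -(P_sum y) addrK.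
  have Px : P false x = 1 - P true x by rewrite -(P_sum x) addrK.
  by rewrite /averaging Px Py; ring.
have MK0 : 0 <= M * K by rewrite mulr_ge0// (le_trans _ M_ge1).
have h1 : P false x * (psi (branch false x) - psi (branch false y)) <=
    P false x * (M * K * s).
  rewrite ler_wpM2l//; apply: (le_trans (h _ _).2).
  by rewrite ler_wpM2l// sE.
have h2 : P true x * (psi (branch true x) - psi (branch true y)) <=
    P true x * (M * K * (q * s)).
  rewrite ler_wpM2l//; apply: (le_trans (h _ _).2).
  by rewrite ler_wpM2l// sE.
have h3 : (P true x - P true y) * (psi (branch true y) - psi (branch false y))
    <= N * s * K.
  apply: (le_trans (ler_norm _)); rewrite normrM ler_pM// ?sE//.
  by rewrite ler_norml (h _ _).1 andbT lerNl opprB (h _ _).1.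
have h4 : N * s * K <= M * (d * (1 - q) / 2) * (s * K).
  by rewrite -mulrA ler_wpM2r// mulr_ge0.
have h5 : d * (1 - q) * (M * K * s) <= P true x * (1 - q) * (M * K * s).
  rewrite ler_wpM2r//; first exact: mulr_ge0.
  by rewrite ler_wpM2r// subr_ge0 ltW.
have Px : P false x = 1 - P true x by rewrite -(P_sum x) addrK.
rewrite E; move: h1 h2 h3 h4 h5; rewrite Px.
move: (P true x) (psi _ - _) (psi _ - psi _) => p u v.
by nra.
Qed.

Let osc_averaging K psi : 0 <= K -> osc K psi -> osc K (averaging psi).
Proof.
move=> K0 h x y; split.
  rewrite averaging_pair.
  apply: (@le_trans _ _ (\sum_(b : bool) \sum_(c : bool) P b x * P c y * K)).
    by apply: ler_sum => b _; apply: ler_sum => c _;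
      rewrite ler_wpM2l ?mulr_ge0// (h _ _).1.
  rewrite !big_bool /=.
  have Py : P false y = 1 - P true y by rewrite -(P_sum y) addrK.
  have Px : P false x = 1 - P true x by rewrite -(P_sum x) addrK.
  by rewrite Px Py le_eqVlt; apply/orP; left; apply/eqP; ring.
apply: (le_trans (osc_short x y K0 h)); rewrite -[leRHS]mul1r ler_wpM2r//.
  by rewrite !mulr_ge0 ?powR_ge0// (le_trans _ M_ge1).
by rewrite lerBlDr lerDl divr_ge0// mulr_ge0 ?(ltW d_gt0)// subr_ge0 ltW.
Qed.

Let osc_iter K psi n : 0 <= K -> osc K psi -> osc K (iter n averaging psi).
Proof. by move=> K0 h; elim: n => [//|n ih]; rewrite iterS; exact: osc_averaging. Qed.

(** Under the independent coupling both points follow the right branch [n] times with probability at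
    least [d ^ n * d ^ n]; otherwise the trivial bound [K] applies. *)
Let osc_long K psi n x y : 0 <= K -> osc K psi ->
  iter n averaging psi x - iter n averaging psi y <=
  K - d ^+ n * d ^+ n * (K - (psi (iter n (branch true) x) -
                              psi (iter n (branch true) y))).
Proof.
move=> K0 h; elim: n x y => [|n ih] x y.
  by rewrite expr0 !mul1r subKr.
rewrite -[iter n.+1 averaging psi]/(averaging (iter n averaging psi)) averaging_pair !big_bool /= -!iterS !iterSr.
have := ih (branch true x) (branch true y).
have [a1 _] := osc_iter n K0 h (branch true x) (branch false y).
have [a2 _] := osc_iter n K0 h (branch false x) (branch true y).
have [a3 _] := osc_iter n K0 h (branch false x) (branch false y).
rewrite -!iterSr.
move: (iter n averaging psi) a1 a2 a3 => u a1 a2 a3 a4.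
have k1 : 0 <= K - (psi (iter n.+1 (branch true) x) - psi (iter n.+1 (branch true) y)).
  by rewrite subr_ge0 (h _ _).1.
move: a4 k1; rewrite !iterSr.
move: (K - (_ - _)) => k a4 k1.
have p1 := P_sum x; have p2 := P_sum y.
have e1 : P true x * P false y * (u (branch true x) - u (branch false y)) <=
    P true x * P false y * K by rewrite ler_wpM2l// mulr_ge0.
have e2 : P false x * P true y * (u (branch false x) - u (branch true y)) <=
    P false x * P true y * K by rewrite ler_wpM2l// mulr_ge0.
have e3 : P false x * P false y * (u (branch false x) - u (branch false y)) <=
    P false x * P false y * K by rewrite ler_wpM2l// mulr_ge0.
have e4 : P true x * P true y * (u (branch true x) - u (branch true y)) <=
    P true x * P true y * (K - d ^+ n * d ^+ n * k) by rewrite ler_wpM2l// mulr_ge0.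
have e5 : d * d * (d ^+ n * d ^+ n * k) <= P true x * P true y * (d ^+ n * d ^+ n * k).
  by rewrite ler_wpM2r// ?ler_pM ?(ltW d_gt0)// !mulr_ge0 ?exprn_ge0 ?(ltW d_gt0).
have e6 : K = P true x * P true y * K + P true x * P false y * K +
    P false x * P true y * K + P false x * P false y * K.
  have -> : P false x = 1 - P true x by rewrite -p1 addrK.
  have -> : P false y = 1 - P true y by rewrite -p2 addrK.
  by ring.
rewrite exprS.
have -> : d * d ^+ n * (d * d ^+ n) * k = d * d * (d ^+ n * d ^+ n * k) by ring.
move: e4; rewrite [X in _ <= X -> _](mulrBr _ K) => e4.
move: e1 e2 e3 e4 e5 e6.
move: (d * d * _) (P true x * P true y * (d ^+ n * _ * k)) => z1 z2.
move: (P true x * P false y * (_ - _)) (P false x * P true y * (_ - _)).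
move: (P false x * P false y * (_ - _)) (P true x * P true y * (_ - _)).
move=> w1 w2 w3 w4; lra.
Qed.

(** After [j] right steps any two points are within 1/2 in the bounded metric, which by [osc_long]
    gives the factor [r2] on the uniform bound; [osc_short] gives [r1] on the Hoelder bound. *)
Lemma osc_contraction : exists j r, [/\ (0 < j)%N, 0 < r < 1 &
  forall K psi, 0 <= K -> osc K psi -> osc (r * K) (iter j averaging psi)].
Proof.
have [j j0 hj] : exists2 j, (0 < j)%N & M * q ^+ j <= 1 / 2.
  have M0 : 0 < M := lt_le_trans ltr01 M_ge1.
  have e0 : 0 < 1 / 2 / M by rewrite !divr_gt0.
  have : (fun n => q ^+ n) @ \oo --> (0 : R).
    by apply: cvg_expr; rewrite ger0_norm ?ltW.
  move/cvgrPdist_lt => /(_ _ e0)[n _ hn]; exists n.+1 => //.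
  have := hn n.+1 (leqnSn n).
  rewrite /= sub0r normrN ger0_norm ?exprn_ge0 ?(ltW q_gt0)//.
  by rewrite ltr_pdivlMr// mulrC => /ltW.
have dj : 0 < d ^+ j * d ^+ j <= 1.
  rewrite mulr_gt0 ?exprn_gt0//= -exprD exprn_ile1 ?(ltW d_gt0)//.
  exact: le_trans (P_ge true (I01_zero R)) (P_le1 _ _).
have dq : 0 < d * (1 - q) < 1.
  rewrite mulr_gt0 ?subr_gt0//= -[ltRHS]mul1r.
  apply: (@le_lt_trans _ _ (1 * (1 - q))); last by have := q_gt0; lra.
  rewrite ler_wpM2r ?subr_ge0 ?(ltW q_lt1)//.
  exact: le_trans (P_ge true (I01_zero R)) (P_le1 _ _).
have [r1 [r1E r1b]] : exists r, r = 1 - d * (1 - q) / 2 /\ 0 < r < 1.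
  by exists (1 - d * (1 - q) / 2); split=> //; case/andP: dq => *; apply/andP; split; lra.
have [r2 [r2E r2b]] : exists r, r = 1 - d ^+ j * d ^+ j / 2 /\ 0 < r < 1.
  by exists (1 - d ^+ j * d ^+ j / 2); split=> //; case/andP: dj => *; apply/andP; split; lra.
exists j, (Num.max r1 r2); split=> //.
  by case/andP: r1b => ? ?; case/andP: r2b => ? ?; rewrite lt_max gt_max; apply/andP; split; [apply/orP; left|apply/andP].
move=> K psi K0 h.
have H1 x y : iter j averaging psi x - iter j averaging psi y <= r2 * K.
  apply: (le_trans (osc_long j x y K0 h)).
  have : psi (iter j (branch true) x) - psi (iter j (branch true) y) <= K / 2.
    apply: (le_trans (h _ _).2).
    apply: (@le_trans _ _ (M * K * q ^+ j)).
      by rewrite ler_wpM2l// mulr_ge0// (le_trans _ M_ge1).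
    by rewrite mulrAC [leRHS]mulrC ler_wpM2r//; lra.
  move: (psi _ - _) => t ht.
  have : d ^+ j * d ^+ j * (K / 2) <= d ^+ j * d ^+ j * (K - t).
    by rewrite ler_wpM2l//; [case/andP: dj => /ltW|lra].
  rewrite r2E mulrBl; move: (d ^+ j * d ^+ j) => z hz; lra.
have H2 x y : iter j averaging psi x - iter j averaging psi y <=
    r1 * (M * K * `|val x - val y| `^ g).
  case: j j0 {hj dj r2E H1} => // j _; rewrite !iterS r1E.
  exact/osc_short/osc_iter.
move=> x y; split.
  by apply: (le_trans (H1 x y)); rewrite ler_wpM2r// le_max lexx orbT.
apply: (le_trans (H2 x y)).
have -> : M * (Num.max r1 r2 * K) * `|val x - val y| `^ g =
  Num.max r1 r2 * (M * K * `|val x - val y| `^ g) by ring.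
rewrite ler_wpM2r ?le_max ?lexx// !mulr_ge0 ?powR_ge0//.
exact: le_trans M_ge1.
Qed.

Lemma averaging_osc : exists C rho : R, [/\ 0 < C, 0 < rho < 1 &
  forall psi K, 0 <= K ->
   (forall x y, `|psi x - psi y| <= K * `|val x - val y| `^ g) ->
  forall n x y, `|iter n averaging psi x - iter n averaging psi y| <= C * K * rho ^+ n].
Proof.
have [j [r [j0 /andP[r0 r1] hr]]] := osc_contraction.
(* [rho] is the [j]-th root of [r]; the constant [r^-1] below accounts for the last incomplete block
   of steps. *)
have [rho [rho0 rho1 rhoj]] : exists rho, [/\ 0 < rho, rho < 1 & rho ^+ j = r].
  exists (r `^ j%:R^-1); split.
  - exact: powR_gt0.
  - have : r `^ j%:R^-1 < 1 `^ j%:R^-1.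
      by rewrite gt0_ltr_powR ?nnegrE ?(ltW r0)// invr_gt0 ltr0n.
    by rewrite powR1.
  - by rewrite -powR_mulrn ?powR_ge0// -powRrM mulVf ?powRr1 ?(ltW r0)// pnatr_eq0 -lt0n.
exists r^-1, rho; split; rewrite ?invr_gt0 ?rho0//.
move=> psi K K0 hK n.
have o0 : osc K psi.
  move=> x y; have hxy := le_trans (ler_norm _) (hK x y); split.
    apply: (le_trans hxy); rewrite -[leRHS]mulr1 ler_wpM2l//.
    by rewrite powR_le1 ?(ltW g_gt0)// normr_ge0 I01_dist1.
  apply: (le_trans hxy); rewrite ler_wpM2r ?powR_ge0//.
  by rewrite -[leLHS]mul1r ler_wpM2r.
have om m : osc (r ^+ m * K) (iter (m * j) averaging psi).
  elim: m => [|m ih]; first by rewrite expr0 mul1r.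
  rewrite mulSn iterD exprS -mulrA; apply: hr => //.
  by rewrite mulr_ge0// exprn_ge0// ltW.
have on : osc (r ^+ (n %/ j) * K) (iter n averaging psi).
  rewrite [in iter n](divn_eq n j) addnC iterD; apply: osc_iter => //.
  by rewrite mulr_ge0// exprn_ge0// ltW.
have B : r ^+ (n %/ j) * K <= r^-1 * K * rho ^+ n.
  rewrite [leRHS]mulrAC ler_wpM2r// -[leLHS]mul1r -[X in X * _](@mulVf _ r) ?gt_eqF//.
  rewrite -mulrA ler_wpM2l ?invr_ge0 ?(ltW r0)// -exprS -rhoj -exprM.
  rewrite ler_wiXn2l ?(ltW rho0) ?(ltW rho1)//.
  by rewrite mulnC ltnW// ltn_ceil.
move=> x y; apply: le_trans B; rewrite ler_norml (on _ _).1 andbT.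
by rewrite lerNl opprB (on _ _).1.
Qed.

(** All later iterates at the base point are averages of values of the [n]-th one, so they stay
    within its oscillation. *)
Lemma averaging_limit : exists (L : (I -> R) -> R) (C rho : R), [/\ 0 < C, 0 < rho < 1 &
  forall psi K, 0 <= K ->
   (forall x y, `|psi x - psi y| <= K * `|val x - val y| `^ g) ->
  forall n x, `|iter n averaging psi x - L psi| <= C * K * rho ^+ n].
Proof.
have [C [rho [C0 /andP[rho0 rho1] H]]] := averaging_osc.
exists (fun psi => limn (fun n => iter n averaging psi (I01_zero R))), C, rho.
split; rewrite ?rho0// => psi K K0 hK.
have near_le n m x : (n <= m)%N ->
    `|iter n averaging psi x - iter m averaging psi (I01_zero R)| <= C * K * rho ^+ n.
  move=> nm; rewrite distrC -(subnK nm) iterD; apply: averaging_dist => y.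
  exact: H.
have geo : (fun n => C * K * rho ^+ n) @ \oo --> (0 : R).
  rewrite -[X in _ --> X](mulr0 (C * K)); apply: cvgM; first exact: cvg_cst.
  by apply: cvg_expr; rewrite ger0_norm ?ltW.
have cv : cvgn (fun n => iter n averaging psi (I01_zero R)).
  apply: cauchy_cvg; apply: cauchy_exP => e e0.
  have /cvgrPdist_lt/(_ _ e0)[n _ hn] := geo.
  exists (iter n averaging psi (I01_zero R)); exists n => // m /= nm.
  rewrite /ball /=; apply: (le_lt_trans (near_le _ _ _ nm)).
  have := hn n (leqnn n); rewrite /= sub0r normrN ger0_norm//.
  by rewrite !mulr_ge0// ?exprn_ge0 ?(ltW C0) ?(ltW rho0).
move=> n x.
have cvd : (fun m => `|iter n averaging psi x - iter m averaging psi (I01_zero R)|) @ \oo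
    --> `|iter n averaging psi x - limn (fun m => iter m averaging psi (I01_zero R))|.
  by apply: cvg_norm; apply: cvgB => //; exact: cvg_cst.
apply: (cvgr_to_le cvd); exists n => // m /= nm; exact: near_le.
Qed.

End MarkovOperator.

(** * Riesz representation on Hoelder functions *)

Section DistributionFunction.
Variables (R : realType) (F : R -> R).
Local Notation I := (I01 R).
Hypotheses (F_nd : nondecreasing F) (F_rc : right_continuous F).
Hypotheses (F_lt0 : forall t, t < 0 -> F t = 0) (F_ge1 : forall t, 1 <= t -> F t = 1).

HB.instance Definition _ := isCumulative.Build R _ R F F_nd F_rc.

Let F_Ny : F @ -oo --> (0 : R).
Proof.
apply: (@cvg_trans _ ((fun=> 0 : R) @ -oo)); last exact: cvg_cst.
apply: near_eq_cvg; apply: filterS (nbhs_ninfty_lt (num_real (0 : R))) => t t0.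
by rewrite F_lt0.
Qed.

Let F_y : F @ +oo --> (1 : R).
Proof.
apply: (@cvg_trans _ ((fun=> 1 : R) @ +oo)); last exact: cvg_cst.
apply: near_eq_cvg; apply: filterS (nbhs_pinfty_ge (num_real (1 : R))) => t t1.
by rewrite F_ge1.
Qed.

HB.instance Definition _ := isCumulativeBounded.Build R 0 1 F F_Ny F_y.

Let proj : measurableTypeR R -> I := fun t => toI (clamp t).

Let val_proj t : val (proj t) = clamp t.
Proof. by rewrite val_toI// clamp01. Qed.

Let measurable_proj : measurable_fun [set: measurableTypeR R] proj.
Proof.
apply: measurable_to_I01.
have : measurable_fun [set: measurableTypeR R] (@clamp R).
  apply: continuous_measurable_fun; apply: (@holder_continuous _ _ 1 1) => // x y.
  by rewrite powRr1// mul1r clamp_lip.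
by apply: eq_measurable_fun => t _; rewrite val_proj.
Qed.

HB.instance Definition _ := @isMeasurableFun.Build _ _ _ _ proj measurable_proj.

(** Clamping pushes the Lebesgue-Stieltjes measure of [F] to the interval and keeps its distribution
    function there. *)
Lemma distribution_probability : exists nu : probability I R,
  forall t, 0 <= t -> pr nu [set x : I | val x <= t] = F t.
Proof.
exists (distribution (lebesgue_stieltjes_measure F) proj) => t t0.
rewrite /pr /distribution /pushforward /=.
have [t1|t1] := ltP t 1.
  transitivity (fine (lebesgue_stieltjes_measure F `]-oo, t]%classic)).
    congr (fine (lebesgue_stieltjes_measure F _)); apply/seteqP; split=> s /=;
      rewrite val_proj /clamp in_itv /= ge_max ge_min t0/= leNgt t1 //.
  by rewrite (_ : lebesgue_stieltjes_measure F `]-oo, t]%classic = (F t)%:E)//;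
    exact: cdf_lebesgue_stieltjes_id.
rewrite F_ge1// (_ : proj @^-1` _ = setT).
  by rewrite [X in fine X](@probability_setT _ _ _ _).
apply/seteqP; split=> s //= _; rewrite val_proj.
by have /andP[_ h] := clamp01 s; exact: le_trans h t1.
Qed.

End DistributionFunction.

Lemma holder_modulus (R : realType) (g : R) (psi : I01 R -> R) e : 0 < g ->
  is_holder g psi -> 0 < e -> exists2 d, 0 < d &
  forall x y, `|val x - val y| <= d -> `|psi x - psi y| <= e.
Proof.
move=> g0 [_ [N hN]] e0; have N1 : 0 < `|N| + 1 by rewrite ltr_wpDl.
have eN : 0 < e / (`|N| + 1) by rewrite divr_gt0.
exists ((e / (`|N| + 1)) `^ g^-1) => [|x y xy]; first exact: powR_gt0.
apply: (le_trans (hN _ _)).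
apply: (@le_trans _ _ ((`|N| + 1) * ((e / (`|N| + 1)) `^ g^-1) `^ g)).
  apply: (@le_trans _ _ (`|N| * `|val x - val y| `^ g)).
    by rewrite ler_wpM2r ?powR_ge0// ler_norm.
  by apply: ler_pM; rewrite ?powR_ge0 ?lerDl// powR_le_powR ?(ltW g0).
by rewrite -powRrM mulVf ?gt_eqF// powRr1 ?(ltW eN)// mulrC divfK ?gt_eqF.
Qed.

Section Ramps.
Variable R : realType.
Local Notation I := (I01 R).

(** A Lipschitz stand-in for the indicator of [x <= i / n]: it is 1 up to [(i - 1) / n] and 0 from
    [i / n] on. *)
Definition ramp (n i : nat) (x : I) : R := clamp (i%:R - n%:R * val x).

Definition grid (n i : nat) : I := toI (i%:R / n%:R).

Lemma val_grid n i : (0 < n)%N -> (i <= n)%N -> val (grid n i) = i%:R / n%:R.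
Proof.
move=> n0 ni; rewrite val_toI// divr_ge0//=.
by rewrite ler_pdivrMr ?ltr0n// mul1r ler_nat.
Qed.

Lemma ramp_ge0 n i x : 0 <= ramp n i x.
Proof. by have /andP[] := clamp01 (i%:R - n%:R * val x). Qed.

Lemma ramp_le1 n i x : ramp n i x <= 1.
Proof. by have /andP[] := clamp01 (i%:R - n%:R * val x). Qed.

Lemma ramp_eq1 n i (x : I) : (0 < n)%N -> val x <= i%:R / n%:R -> ramp n i.+1 x = 1.
Proof.
move=> n0; rewrite ler_pdivlMr ?ltr0n// mulrC => h; rewrite /ramp /clamp -natr1.
rewrite min_l ?max_r//.
by move: (n%:R * _) h => z h; lra.
Qed.

Lemma ramp_eq0 n i (x : I) : (0 < n)%N -> i%:R / n%:R <= val x -> ramp n i x = 0.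
Proof.
move=> n0; rewrite ler_pdivrMr ?ltr0n// mulrC => h; rewrite /ramp /clamp.
by rewrite max_l// ge_min subr_le0 h orbT.
Qed.

Lemma ramp_holder g n i : 0 < g <= 1 -> is_holder g (ramp n i).
Proof.
move=> g01; apply: (@lipschitz_holder _ _ n%:R) => // x y.
apply: (le_trans (clamp_lip _ _)).
have -> : i%:R - n%:R * val x - (i%:R - n%:R * val y) = - (n%:R * (val x - val y)).
  by ring.
by rewrite normrN normrM ger0_norm.
Qed.

Lemma sum_by_parts (a r : nat -> R) n : \sum_(i < n.+1) a i * (r i.+1 - r i) =
  a n * r n.+1 - a 0%N * r 0%N - \sum_(i < n) (a i.+1 - a i) * r i.+1.
Proof.
elim: n => [|n ih]; first by rewrite big_ord_recr !big_ord0/=; ring.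
by rewrite big_ord_recr ih /= [in RHS]big_ord_recr/=; ring.
Qed.

(** Summation by parts turns the combination into the sum of [psi (i / n)] against the increments of
    the ramps; these are nonnegative, add up to 1, and vanish at [x] unless [i / n] is within
    [1 / n] of it. *)
Lemma ramp_approx n (psi : I -> R) w x : (0 < n)%N -> 0 <= w ->
  (forall x y, `|val x - val y| <= n%:R^-1 -> `|psi x - psi y| <= w) ->
  `|psi x - (psi (grid n n) +
     \sum_(i < n) - (psi (grid n i.+1) - psi (grid n i)) * ramp n i.+1 x)| <= w.
Proof.
move=> n0 w0 hw; have nR : (0 : R) < n%:R by rewrite ltr0n.
have r0 : ramp n 0 x = 0.
  by apply: ramp_eq0 => //; rewrite mul0r; have /andP[] := I01P x.
have r1 : ramp n n.+1 x = 1.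
  by apply: ramp_eq1 => //; rewrite divff ?gt_eqF//; have /andP[] := I01P x.
have r_le i : ramp n i x <= ramp n i.+1 x.
  have [h|/ltW h] := leP (val x) (i%:R / n%:R).
    by rewrite ramp_eq1// ramp_le1.
  by rewrite ramp_eq0// ramp_ge0.
have -> : psi x - (psi (grid n n) +
     \sum_(i < n) - (psi (grid n i.+1) - psi (grid n i)) * ramp n i.+1 x) =
   \sum_(i < n.+1) (psi x - psi (grid n i)) * (ramp n i.+1 x - ramp n i x).
  have := sum_by_parts (fun i => psi (grid n i)) (ramp n ^~ x) n.
  rewrite r1 r0 => Abel; under [in RHS]eq_bigr do rewrite mulrBl.
  rewrite sumrB Abel -mulr_sumr.
  rewrite -(big_mkord xpredT (fun i => ramp n i.+1 x - ramp n i x)) telescope_sumr//.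
  under eq_bigr do rewrite mulNr.
  by rewrite sumrN r1 r0; ring.
apply: (le_trans (ler_norm_sum _ _ _)).
apply: (@le_trans _ _ (\sum_(i < n.+1) w * (ramp n i.+1 x - ramp n i x))).
  apply: ler_sum => i _; rewrite normrM [X in _ * X <= _]ger0_norm ?subr_ge0//.
  have [h|h] := leP (i%:R + 1) (n%:R * val x).
    by rewrite !ramp_eq0 ?subrr ?mulr0// ler_pdivrMr// mulrC -?natr1//; lra.
  have [h'|h'] := leP (n%:R * val x) (i%:R - 1).
    case: (nat_of_ord i) h' => [|j] h'.
      have : 0 <= n%:R * val x by rewrite mulr_ge0//; have /andP[] := I01P x.
      by move=> ?; lra.
    rewrite !ramp_eq1 ?subrr ?mulr0// ler_pdivlMr// mulrC; move: h'; rewrite -!natr1; lra.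
  apply: ler_wpM2r; first by rewrite subr_ge0; exact: r_le.
  apply: hw; rewrite val_grid//; last by rewrite -ltnS; exact: ltn_ord.
  rewrite -(ler_pM2l nR) -{1}[n%:R]ger0_norm ?(ltW nR)// -normrM mulrBr mulrCA !divff ?gt_eqF// mulr1.
  by rewrite ler_norml; apply/andP; split; lra.
rewrite -mulr_sumr -(big_mkord xpredT (fun i => ramp n i.+1 x - ramp n i x)).
by rewrite telescope_sumr// r1 r0 subr0 mulr1.
Qed.

End Ramps.

Section PositiveFunctional.
Variables (R : realType) (g : R).
Local Notation I := (I01 R).
Local Notation grid := (grid R).
Hypothesis g01 : 0 < g <= 1.
Variable L : (I -> R) -> R.
Hypothesis L_D : forall psi chi, is_holder g psi -> is_holder g chi ->
  L (fun x => psi x + chi x) = L psi + L chi.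
Hypothesis L_Z : forall c psi, is_holder g psi -> L (fun x => c * psi x) = c * L psi.
Hypothesis L_le : forall psi chi, is_holder g psi -> is_holder g chi ->
  (forall x, psi x <= chi x) -> L psi <= L chi.
Hypothesis L_1 : L (fun=> 1) = 1.

Let g_gt0 : 0 < g. Proof. by case/andP: g01. Qed.

Lemma functional_cst c : L (fun=> c) = c.
Proof.
rewrite (_ : (fun=> c) = (fun x => c * 1)); last by apply/funext => x; rewrite mulr1.
by rewrite L_Z ?L_1 ?mulr1//; exact: is_holder_cst.
Qed.

Let L_cst := functional_cst.

Let L_sum n (c : nat -> R) (psi : nat -> I -> R) : (forall i, is_holder g (psi i)) ->
  is_holder g (fun x => \sum_(i < n) c i * psi i x) /\
  L (fun x => \sum_(i < n) c i * psi i x) = \sum_(i < n) c i * L (psi i).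
Proof.
move=> h; elim: n => [|n [ih1 ih2]].
  rewrite big_ord0 (_ : (fun x => _) = (fun=> 0)).
    by split; [exact: is_holder_cst|exact: L_cst].
  by apply/funext => x; rewrite big_ord0.
rewrite big_ord_recr/= -ih2 -L_Z// -L_D//; last exact: is_holderZ.
rewrite (_ : (fun x => _) = (fun x => \sum_(i < n) c i * psi i x + c n * psi n x)).
  by split=> //; apply: is_holderD => //; exact: is_holderZ.
by apply/funext => x; rewrite big_ord_recr.
Qed.

Let L_close psi chi e : is_holder g psi -> is_holder g chi ->
  (forall x, `|psi x - chi x| <= e) -> `|L psi - L chi| <= e.
Proof.
move=> hp hc h; have he := is_holder_cst g e; rewrite ler_norml; apply/andP; split.
  rewrite lerBrDr addrC -(L_cst (- e)) -L_D//; last exact: is_holder_cst.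
  apply: L_le => // [|x]; first by apply: is_holderD => //; exact: is_holder_cst.
  by have := h x; rewrite ler_norml => /andP[? _]; lra.
rewrite lerBlDr -(L_cst e) -L_D//.
apply: L_le => // [|x]; first exact: is_holderD.
by have := h x; rewrite ler_norml => /andP[_ ?]; lra.
Qed.

(* Approximate [psi] by its values at [i / n] against the partition of unity
   [ramp n i.+1 - ramp n i], and sum by parts. *)
Lemma ramp_stieltjes (F : R -> R) n psi w : (0 < n)%N -> 0 <= w ->
  nondecreasing F -> (forall t, 0 <= F t <= 1) ->
  (forall i, F (i%:R / n%:R) <= L (ramp n i.+1) <= F (i.+1%:R / n%:R)) ->
  is_holder g psi ->
  (forall x y, `|val x - val y| <= n%:R^-1 -> `|psi x - psi y| <= w) ->
  `|L psi - (psi (grid n n) -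
     \sum_(i < n) (psi (grid n i.+1) - psi (grid n i)) * F (i%:R / n%:R))| <= w + w.
Proof.
move=> n0 w0 F_nd F01 F_ramp hpsi hw.
pose T x := psi (grid n n) +
  \sum_(i < n) - (psi (grid n i.+1) - psi (grid n i)) * ramp n i.+1 x.
have [hT LT] := L_sum n (fun i => - (psi (grid n i.+1) - psi (grid n i)))
  (fun i => ramp_holder n i.+1 g01).
have -> : L psi - (psi (grid n n) -
     \sum_(i < n) (psi (grid n i.+1) - psi (grid n i)) * F (i%:R / n%:R)) =
   (L psi - L T) + (\sum_(i < n) (psi (grid n i.+1) - psi (grid n i)) *
     (F (i%:R / n%:R) - L (ramp n i.+1))).
  rewrite /T L_D//; last exact: is_holder_cst.
  rewrite L_cst LT; set A := \sum_(i < n) _ * F _.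
  have -> : \sum_(i < n) - (psi (grid n i.+1) - psi (grid n i)) * L (ramp n i.+1) =
      - \sum_(i < n) (psi (grid n i.+1) - psi (grid n i)) * L (ramp n i.+1).
    by rewrite -sumrN; apply: eq_bigr => i _; rewrite mulNr.
  have -> : \sum_(i < n) (psi (grid n i.+1) - psi (grid n i)) *
      (F (i%:R / n%:R) - L (ramp n i.+1)) = A -
      \sum_(i < n) (psi (grid n i.+1) - psi (grid n i)) * L (ramp n i.+1).
    by rewrite -sumrB; apply: eq_bigr => i _; rewrite mulrBr.
  by move: A (\sum_(i < n) _) => A B; ring.
apply: (le_trans (ler_normD _ _)); apply: lerD.
  apply: L_close => // [|x]; first by apply: is_holderD => //; exact: is_holder_cst.
  rewrite /T; exact: ramp_approx.
apply: (le_trans (ler_norm_sum _ _ _)).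
apply: (@le_trans _ _ (\sum_(i < n) w * (F (i.+1%:R / n%:R) - F (i%:R / n%:R)))).
  apply: ler_sum => i _; rewrite normrM; apply: ler_pM => //.
    have hi : (i < n)%N := ltn_ord i.
    apply: hw; rewrite (val_grid R n0 hi) (val_grid R n0 (ltnW hi)) -mulrBl -natrB//.
    by rewrite subSnn mul1r ger0_norm ?invr_ge0.
  have /andP[a b] := F_ramp i.
  by rewrite distrC ger0_norm ?subr_ge0// lerB.
rewrite -mulr_sumr -(big_mkord xpredT (fun i => F (i.+1%:R / n%:R) - F (i%:R / n%:R))).
rewrite telescope_sumr// -[leRHS]mulr1 ler_wpM2l//.
have /andP[a _] := F01 (0%:R / n%:R); have /andP[_ b] := F01 (n%:R / n%:R).
by lra.
Qed.

End PositiveFunctional.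

Section Riesz.
Variables (R : realType) (g : R).
Local Notation I := (I01 R).
Hypothesis g01 : 0 < g <= 1.
Variable L : (I -> R) -> R.
Hypothesis L_D : forall psi chi, is_holder g psi -> is_holder g chi ->
  L (fun x => psi x + chi x) = L psi + L chi.
Hypothesis L_Z : forall c psi, is_holder g psi -> L (fun x => c * psi x) = c * L psi.
Hypothesis L_le : forall psi chi, is_holder g psi -> is_holder g chi ->
  (forall x, psi x <= chi x) -> L psi <= L chi.
Hypothesis L_1 : L (fun=> 1) = 1.

Let g_gt0 : 0 < g. Proof. by case/andP: g01. Qed.

Let L_cst c : L (fun=> c) = c.
Proof. exact: (functional_cst L_Z L_1). Qed.

Let major (t : R) (psi : I -> R) := [/\ is_holder g psi, forall x, 0 <= psi x &
  forall x, val x <= t -> 1 <= psi x].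

(** The distribution function of the measure to be found, approached from above so as to be
    right-continuous. *)
Let F (t : R) : R := inf [set L psi | psi in major t].

Let major1 t : major t (fun=> 1).
Proof. by split=> //; exact: is_holder_cst. Qed.

Let F_has t : has_inf [set L psi | psi in major t].
Proof.
split; first by exists (L (fun=> 1)), (fun=> 1).
exists 0 => _ [psi [h p _] <-]; rewrite -(L_cst 0).
by apply: L_le => //; exact: is_holder_cst.
Qed.

Let F_le t psi : major t psi -> F t <= L psi.
Proof. by move=> h; apply: ge_inf; [case: (F_has t)|exists psi]. Qed.

Let F_ge t c : (forall psi, major t psi -> c <= L psi) -> c <= F t.
Proof.
by move=> h; apply: lb_le_inf; [case: (F_has t)|move=> _ [psi hp <-]; exact: h].
Qed.

Let F_nd : nondecreasing F.
Proof.
move=> s t st; apply: F_ge => psi [h p k]; apply: F_le; split=> // x xs.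
exact/k/(le_trans xs).
Qed.

Let F_lt0 t : t < 0 -> F t = 0.
Proof.
move=> t0; apply/eqP; rewrite eq_le; apply/andP; split.
  rewrite -[leRHS](L_cst 0); apply: F_le; split=> // [|x xt].
    exact: is_holder_cst.
  by have /andP[h _] := I01P x; move: (le_lt_trans (le_trans h xt) t0); rewrite ltxx.
apply: F_ge => psi [h p _]; rewrite -[leLHS](L_cst 0).
by apply: L_le => //; exact: is_holder_cst.
Qed.

Let F_ge1 t : 1 <= t -> F t = 1.
Proof.
move=> t1; apply/eqP; rewrite eq_le; apply/andP; split.
  by rewrite -[leRHS](L_cst 1); exact: F_le.
apply: F_ge => psi [h _ p]; rewrite -[leLHS](L_cst 1).
apply: L_le => //; first exact: is_holder_cst.
by move=> x; apply: p; have /andP[_ h1] := I01P x; exact: le_trans h1 t1.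
Qed.

(** A nearly optimal majorant at [t], raised by [e / 2], is still a majorant slightly beyond [t], by
    uniform continuity. *)
Let F_rc : right_continuous F.
Proof.
move=> t; apply/cvgrPdist_le => e e0.
suff [d d0 hd] : exists2 d, 0 < d & forall s, t < s -> s < t + d -> F s <= F t + e.
  near=> s; rewrite distrC ger0_norm ?subr_ge0; last first.
    by apply/F_nd/ltW; near: s; exact: nbhs_right_gt.
  rewrite lerBlDl; apply: hd; first by near: s; exact: nbhs_right_gt.
  by near: s; apply: nbhs_right_lt; rewrite ltrDl.
have [t0|t0] := ltP t 0.
  exists (- t); rewrite ?oppr_gt0// => s _; rewrite subrr => s0.
  by rewrite !F_lt0// add0r ltW.
have [t1|t1] := leP 1 t.
  exists 1 => // s ts _; rewrite !F_ge1 ?lerDl ?(ltW e0)//.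
  exact: le_trans t1 (ltW ts).
have [_ [psi [hpsi' p k] <-] hpsi] :=
  inf_adherent (divr_gt0 e0 (ltr0Sn _ 1)) (F_has t).
have [d d0 hd] := holder_modulus g_gt0 hpsi' (divr_gt0 e0 (ltr0Sn _ 1)).
exists (Num.min (1 - t) d); first by rewrite lt_min subr_gt0 t1.
move=> s ts; rewrite -ltrBlDl lt_min => /andP[s1 sd].
have {}s1 : s < 1 by lra.
apply: (@le_trans _ _ (L (fun x => psi x + e / 2))); last first.
  have hF : L psi <= F t + e / 2 := ltW hpsi.
  rewrite L_D ?L_cst//; last exact: is_holder_cst.
  by move: hF; move: (F t) (L psi) => a b ?; lra.
apply: F_le; split=> [|x|x xs].
  by apply: is_holderD => //; exact: is_holder_cst.
  by rewrite addr_ge0// ltW// divr_gt0.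
have [xt|tx] := leP (val x) t.
  by rewrite (le_trans (k x xt))// lerDl ltW// divr_gt0.
have tE : val (toI t : I) = t by rewrite val_toI// t0 ltW.
have := k (toI t); rewrite tE lexx => /(_ isT) k1.
have : `|psi x - psi (toI t)| <= e / 2.
  apply: hd; rewrite tE ger0_norm ?subr_ge0 ?(ltW tx)// (le_trans _ (ltW sd))//.
  by rewrite lerB.
rewrite ler_norml => /andP[? ?]; lra.
Unshelve. all: end_near. Qed.
Let F01 t : 0 <= F t <= 1.
Proof.
apply/andP; split; last by rewrite -(L_cst 1) F_le.
by rewrite -(@F_lt0 (Num.min t (-1))) ?F_nd// ?ge_min ?lexx// gt_min oppr_lt0 ltr01 orbT.
Qed.

Let F_ramp n i : (0 < n)%N -> F (i%:R / n%:R) <= L (ramp n i.+1) <= F (i.+1%:R / n%:R).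
Proof.
move=> n0; apply/andP; split.
  apply: F_le; split=> [|x|x xi]; first exact: ramp_holder.
    exact: ramp_ge0.
  by rewrite ramp_eq1// ?ltnS.
apply: F_ge => psi [h p k]; apply: L_le => // [|x]; first exact: ramp_holder.
have [xi|xi] := leP (val x) (i.+1%:R / n%:R); last by rewrite ramp_eq0// ltW.
by apply: le_trans (k _ xi); exact: ramp_le1.
Qed.

(** [L] and the integral are within [e / 2] of the same Stieltjes sum, by [ramp_stieltjes] applied
    to each. *)
Lemma riesz : exists nu : probability I R, forall psi, is_holder g psi ->
  \int[nu]_x psi x = L psi.
Proof.
have [nu hnu] := distribution_probability F_nd F_rc F_lt0 F_ge1.
exists nu => psi hpsi; apply/eqP; rewrite -subr_eq0 -normr_le0.
apply/ler_addgt0Pl => e e0; rewrite addr0.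
have e4 : 0 < e / 4 by rewrite divr_gt0.
have [d d0 hd] := holder_modulus g_gt0 hpsi e4.
have [n n0 hw] : exists2 n, (0 < n)%N & forall x y : I,
    `|val x - val y| <= n%:R^-1 -> `|psi x - psi y| <= e / 4.
  exists (Num.truncn d^-1).+1 => // x y h; apply: hd; apply: (le_trans h).
  by rewrite invf_ple ?posrE ?ltr0n// ltW// truncnS_gt.
have bm chi : is_holder g chi -> bmeas chi by exact: holder_bmeas.
have A := ramp_stieltjes g01 L_D L_Z L_le L_1 n0 (ltW e4) F_nd F01
  (fun i => F_ramp i n0) hpsi hw.
have B : `|\int[nu]_x psi x - (psi (grid R n n) -
     \sum_(i < n) (psi (grid R n i.+1) - psi (grid R n i)) * F (i%:R / n%:R))|
    <= e / 4 + e / 4.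
  apply: (@ramp_stieltjes _ g g01 (fun psi => \int[nu]_x psi x)) => //.
  - by move=> *; apply: meanD; exact: bm.
  - by move=> *; apply: meanZ; exact: bm.
  - by move=> *; apply: le_mean => //; exact: bm.
  - exact: mean_cst.
  - exact: ltW.
  move=> i; have mr := bm _ (ramp_holder n i.+1 g01).
  have mI t : @measurable _ I [set x : I | val x <= t].
    rewrite (_ : [set x | _] = (fun x : I => val x) @^-1` `]-oo, t]%classic).
      by rewrite -[X in measurable X]setTI; apply: measurable_val.
    by apply/seteqP; split=> x; rewrite /= in_itv.
  have fE t : 0 <= t -> F t = \int[nu]_x (\1_[set x : I | val x <= t] x).
    by move=> t0; rewrite mean_indic// -hnu.
  apply/andP; split; rewrite fE ?divr_ge0//; apply: le_mean => //.
  - exact: bmeas_indic.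
  - move=> x; rewrite indicE; have [/set_mem xi|_] := boolP (x \in _).
      by rewrite ramp_eq1.
    exact: ramp_ge0.
  - exact: bmeas_indic.
  - move=> x; rewrite indicE; have [_|xi] := boolP (x \in _); first exact: ramp_le1.
    rewrite ramp_eq0// ltW// ltNge; apply: contra xi => xi.
    exact/mem_set.
move: A B; move: (L psi) (\int[nu]_x psi x) (psi _ - _) => a b c.
rewrite !ler_norml => /andP[? ?] /andP[? ?]; apply/andP; split; lra.
Qed.

End Riesz.

(** * Stationary measures *)

Section OpenIndicators.
Variable R : realType.
Local Notation I := (I01 R).

(** With [gap] the distance to the complement truncated at 1, [1 - (1 - gap) ^ n] converges to the
    indicator. The element 1 of [S x] truncates, and avoids an empty infimum when [U] is the whole
    line. *)
Lemma open_indic_cvg (U : set R) : open U -> exists chi : nat -> I -> R,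
  [/\ forall g n, 0 < g <= 1 -> is_holder g (chi n), forall n x, `|chi n x| <= 1 &
   forall x, chi n x @[n --> \oo] --> (\1_((fun x : I => val x) @^-1` U) x : R)].
Proof.
move=> oU.
pose S (x : R) := [set s : R | s = 1 \/ exists2 y, ~ U y & s = `|x - y|].
have S_inf x : has_inf (S x).
  by split; [exists 1; left|exists 0 => _ [->|[y _ ->]]].
pose gap x := inf (S x).
have gap_le x s : S x s -> gap x <= s by move=> h; apply: ge_inf => //; case: (S_inf x).
have gap_ge x c : (forall s, S x s -> c <= s) -> c <= gap x.
  by move=> h; apply: lb_le_inf => //; case: (S_inf x).
have gap0 x : 0 <= gap x by apply: gap_ge => _ [->|[y _ ->]].
have gap1 x : gap x <= 1 by apply: gap_le; left.
have gap_lip x y : gap x - gap y <= `|x - y|.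
  rewrite lerBlDl -lerBlDr; apply: gap_ge => _ [->|[z Uz ->]].
    by rewrite lerBlDr (le_trans (gap1 x))// lerDl.
  rewrite lerBlDr (le_trans (gap_le x `|x - z| _))//; first by right; exists z.
  by rewrite -[x - z](subrKA y) addrC ler_normD.
have gapN x : ~ U x -> gap x = 0.
  move=> Ux; apply/eqP; rewrite eq_le gap0 andbT; apply: gap_le; right.
  by exists x => //; rewrite subrr normr0.
have gapU x : U x -> 0 < gap x.
  move=> Ux; have /nbhs_ballP[e e0 he] := open_nbhs_nbhs (conj oU Ux).
  apply: (@lt_le_trans _ _ (Num.min 1 e)); first by rewrite lt_min ltr01.
  apply: gap_ge => _ [->|[y Uy ->]]; first by rewrite ge_min lexx.
  rewrite ge_min; apply/orP; right; rewrite leNgt; apply/negP => xy; apply: Uy.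
  exact: he.
exists (fun n x => 1 - (1 - gap (val x)) ^+ n).
have b x : 0 <= 1 - gap x <= 1 by rewrite subr_ge0 gap1 gerBl gap0.
split=> [g n g01|n x|x].
- apply: (@lipschitz_holder _ _ n%:R) => // x y.
  have -> : 1 - (1 - gap (val x)) ^+ n - (1 - (1 - gap (val y)) ^+ n) =
    (1 - gap (val y)) ^+ n - (1 - gap (val x)) ^+ n by ring.
  apply: (le_trans (expr_lip _ (b _) (b _))); rewrite ler_wpM2l//.
  have -> : 1 - gap (val y) - (1 - gap (val x)) = gap (val x) - gap (val y) by ring.
  by rewrite ler_norml gap_lip andbT lerNl opprB distrC gap_lip.
- have /andP[b0 b1] := b (val x).
  by rewrite ger0_norm ?subr_ge0 ?exprn_ile1// gerBl exprn_ge0.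
- rewrite indicE; have [/set_mem /= xU|xU] := boolP (x \in _).
    rewrite -[X in _ --> X]subr0; apply: cvgB; first exact: cvg_cst.
    apply: cvg_expr; have /andP[b0 b1] := b (val x).
    by rewrite ger0_norm// gtrBl gapU.
  rewrite gapN; last by move=> h; move/negP: xU; apply; exact/mem_set.
  under eq_fun do rewrite subr0 expr1n subrr.
  exact: cvg_cst.
Qed.

End OpenIndicators.

Section StationaryMeasure.
Variables (R : realType) (alpha : R).
Hypothesis alpha_gt0 : 0 < alpha.
Local Notation I := (I01 R).
Local Notation branch := (branch alpha).
Variables (P : bool -> I -> R).
Local Notation averaging := (@averaging R alpha P).
Variables (g d N : R).
Hypotheses (g01 : 0 < g <= 1) (d_gt0 : 0 < d).
Hypothesis P_sum : forall x, P false x + P true x = 1.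
Hypothesis P_ge : forall b x, d <= P b x.
Hypothesis P_holder : forall x y,
  `|P true x - P true y| <= N * `|val x - val y| `^ g.

Let g_gt0 : 0 < g. Proof. by case/andP: g01. Qed.

Let P_ge0 b x : 0 <= P b x.
Proof. exact: le_trans (ltW d_gt0) (P_ge b x). Qed.

Let P_le1 b x : P b x <= 1.
Proof.
have := P_sum x; have := P_ge0 true x; have := P_ge0 false x.
by case: b => *; lra.
Qed.

Let holder_P b : is_holder g (P b).
Proof.
split; first by exists 1 => x; rewrite ger0_norm.
exists N => x y; case: b => //.
have -> : P false x - P false y = - (P true x - P true y).
  by have := P_sum x; have := P_sum y; lra.
by rewrite normrN.
Qed.

Let holder_averaging psi : is_holder g psi -> is_holder g (averaging psi).
Proof.
by move=> h; apply: is_holderD; apply: is_holderM => //;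
  apply: (is_holder_nonexpansive g_gt0 _ h) => x y; exact: branch_lip.
Qed.

Let bmeas_averaging psi : bmeas psi -> bmeas (averaging psi).
Proof.
by move=> h; apply: bmeasD; apply: bmeasM; (try exact: (holder_bmeas g_gt0));
  apply: (bmeas_comp _ h); exact: measurable_branch.
Qed.

Lemma averaging_cvg (psi_ : nat -> I -> R) psi :
  (forall x, psi_ n x @[n --> \oo] --> psi x) ->
  forall x, averaging (psi_ n) x @[n --> \oo] --> averaging psi x.
Proof.
by move=> h x; apply: cvgD; apply: cvgM; (try exact: cvg_cst); exact: h.
Qed.

Let averaging_norm psi M x : (forall y, `|psi y| <= M) -> `|averaging psi x| <= M.
Proof.
move=> h; rewrite (le_trans (ler_normD _ _))// !normrM !(ger0_norm (P_ge0 _ _)).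
rewrite -[leRHS]mul1r -(P_sum x) mulrDl lerD// ler_wpM2l//.
Qed.

Section Extension.
Variable nu : probability I R.
Hypothesis holder_stationary : forall psi, is_holder g psi ->
  \int[nu]_x averaging psi x = \int[nu]_x psi x.

Let D psi : R := \int[nu]_x averaging psi x - \int[nu]_x psi x.

Let D_lin a psi chi : bmeas psi -> bmeas chi ->
  D (fun x => a * psi x + chi x) = a * D psi + D chi.
Proof.
move=> hp hc; rewrite /D.
have -> : averaging (fun x => a * psi x + chi x) =
    (fun x => a * averaging psi x + averaging chi x).
  by apply/funext => x; rewrite /averaging; ring.
have m1 := bmeas_averaging hp; have m2 := bmeas_averaging hc.
rewrite (meanD nu (bmeasZ a m1) m2) (meanD nu (bmeasZ a hp) hc).
rewrite (meanZ nu a m1) (meanZ nu a hp).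
move: (\int[nu]_x averaging psi x) (\int[nu]_x averaging chi x) => u v.
by move: (\int[nu]_x psi x) (\int[nu]_x chi x) => u' v'; ring.
Qed.

Let D_cvg (psi_ : nat -> I -> R) psi M :
  (forall n, bmeas (psi_ n)) -> (forall n x, `|psi_ n x| <= M) ->
  (forall x, psi_ n x @[n --> \oo] --> psi x) ->
  (forall n, D (psi_ n) = 0) -> bmeas psi /\ D psi = 0.
Proof.
move=> hm hM hc h0; have [b1 c1] := mean_cvg nu (fun n => (hm n).1) hM hc.
split=> //.
have [_ c2] := mean_cvg nu (fun n => (bmeas_averaging (hm n)).1)
  (fun n x => averaging_norm x (hM n)) (averaging_cvg hc).
apply/eqP; rewrite subr_eq0; apply/eqP.
apply: (cvg_unique _ c2) => //.
rewrite (_ : (fun n => \int[nu]_x averaging (psi_ n) x) = (fun n => \int[nu]_x psi_ n x))//.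
by apply/funext => n; apply/eqP; rewrite -subr_eq0; apply/eqP/h0.
Qed.

(** [D] vanishes on open sets by approximation with Hoelder functions, and the sets where it
    vanishes form a lambda-system. *)
Let D_indic A : measurable A -> D (\1_A) = 0.
Proof.
pose H := [set A : set I | measurable A /\ D (\1_A) = 0].
suff h : <<s @open (set_type (`[0, 1]%classic : set R)) >> `<=` H by move=> /h[].
apply: lambda_system_subset => //.
- by move=> B C; exact: openI.
- split=> //.
  + split=> //; rewrite /D (_ : (\1_setT : I -> R) = fun=> 1); last first.
      by apply/funext => x; rewrite indicT.
    rewrite (_ : averaging (fun=> 1) = fun=> 1) ?subrr//.
    by apply/funext => x; rewrite /averaging !mulr1 P_sum.
  + move=> C B BC [mC DC] [mB DB]; split; first exact: measurableD.
    rewrite (_ : (\1_(C `\` B) : I -> R) = (fun x => (-1) * \1_B x + \1_C x)).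
      by rewrite D_lin ?DC ?DB ?mulr0 ?addr0//; exact: bmeas_indic.
    apply/funext => x; rewrite !indicE in_setD.
    have [xB|xB] := boolP (x \in B); rewrite ?andbF ?andbT ?mulr0 ?add0r//.
    by rewrite (mem_set (BC _ (set_mem xB))) mulr1 addNr.
  + move=> F ndF hF; split; first by apply: bigcup_measurable => n _; case: (hF n).
    apply: (@D_cvg (fun n => \1_(F n)) _ 1 _ _ _ _).2 => [n|n x|x|n].
    * by apply: bmeas_indic; case: (hF n).
    * by rewrite indicE; case: (_ \in _); rewrite ?normr1 ?normr0.
    * rewrite !indicE; have [/set_mem[k _ xk]|h] := boolP (x \in _).
        apply: cvg_near_cst; exists k => // n /= kn; rewrite indicE mem_set//.
        by move/subsetPset: (ndF _ _ kn); exact.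
      apply: cvg_near_cst; apply: nearW => n; rewrite indicE memNset// => xn.
      by move/negP: h; apply; apply/mem_set; exists n.
    * by case: (hF n).
- move=> _ [U oU <-]; split; first exact: I01_open_preimage.
  have [chi [hh h1 hc]] := open_indic_cvg oU.
  apply: (@D_cvg chi _ 1 _ h1 hc _).2 => n.
    exact/(holder_bmeas g_gt0)/hh.
  by rewrite /D holder_stationary ?subrr//; exact: hh.
Qed.

(* Peeling off binary digits: [2 D psi = D chi] for
   [chi = 2 psi - \1_[1/2 <= psi]], which again takes values in [0, 1]. *)
Let D_unit n psi : bmeas psi -> (forall x, 0 <= psi x <= 1) ->
  `|D psi| <= 2 / 2 ^+ n.
Proof.
elim: n psi => [|n ih] psi hp h01.
  rewrite expr0 divr1 (le_trans (ler_normB _ _))// (_ : 2 = 1 + 1)// lerD//.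
    apply: norm_mean_le; first exact: bmeas_averaging.
    by move=> x; apply: averaging_norm => y; rewrite ger0_norm; case/andP: (h01 y).
  by apply: norm_mean_le => // y; rewrite ger0_norm; case/andP: (h01 y).
pose A := psi @^-1` `[1 / 2, +oo[%classic.
have mA : measurable A.
  by rewrite -[A]setTI; apply: hp.1 => //; exact: measurable_itv.
have hc : bmeas (fun x => 2 * psi x + (-1) * \1_A x).
  by apply: bmeasD; apply: bmeasZ => //; exact: bmeas_indic.
have c01 x : 0 <= 2 * psi x + (-1) * \1_A x <= 1.
  have /andP[? ?] := h01 x; rewrite indicE.
  have [/set_mem|/negP xA] := boolP (x \in A).
    by rewrite /A /= in_itv /= andbT mulr1 => ?; apply/andP; split; lra.
  have : psi x < 1 / 2.
    rewrite ltNge; apply/negP => h; apply: xA; apply/mem_set.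
    by rewrite /A /= in_itv /= andbT.
  by rewrite mulr0 addr0 => ?; apply/andP; split; lra.
have := ih _ hc c01; rewrite D_lin//; last by apply: bmeasZ; exact: bmeas_indic.
have -> : D (fun x => (-1) * \1_A x) = 0.
  have := D_lin (-1) (bmeas_indic R mA) (bmeas_cst _ 0).
  rewrite D_indic// mulr0 add0r.
  have -> : D (fun=> 0) = 0.
    by rewrite /D (_ : averaging _ = fun=> 0) ?subrr//; apply/funext => x; rewrite /averaging !mulr0 addr0.
  by move=> h0; rewrite -[RHS]h0; congr D; apply/funext => x; rewrite addr0.
rewrite addr0 normrM ger0_norm// exprS invfM => h.
rewrite mulrA divff// mul1r; move: h; move: (_ ^-1) => z; lra.
Qed.

Lemma stationary_bmeas psi : bmeas psi ->
  \int[nu]_x averaging psi x = \int[nu]_x psi x.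
Proof.
move=> hp; apply/eqP; rewrite -subr_eq0 -/(D psi).
have [M hM] := hp.2; pose K := `|M| + 1.
have K0 : 0 < K by rewrite ltr_wpDl.
have K20 : 2 * K != 0 by rewrite mulf_neq0 ?gt_eqF.
pose chi x := (2 * K)^-1 * psi x + 1 / 2.
have hc : bmeas chi by apply: bmeasD; [exact: bmeasZ|exact: bmeas_cst].
have c01 x : 0 <= chi x <= 1.
  have : `|(2 * K)^-1 * psi x| <= 1 / 2.
    rewrite normrM ger0_norm ?invr_ge0 ?mulr_ge0 ?(ltW K0)//.
    rewrite mulrC ler_pdivrMr ?mulr_gt0// mulrA mul1r mulVf// mul1r.
    by rewrite (le_trans (hM x))// (le_trans (ler_norm _))// lerDl.
  by rewrite ler_norml => /andP[? ?]; rewrite /chi; apply/andP; split; lra.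
have D0 : D chi = 0.
  apply/eqP; rewrite -normr_le0; apply/ler_addgt0Pl => e e0; rewrite addr0.
  have : (fun n => (1 / 2) ^+ n) @ \oo --> (0 : R).
    by apply: cvg_expr; rewrite ger0_norm//; lra.
  move=> /cvgrPdist_lt/(_ _ (divr_gt0 e0 (ltr0Sn _ 1)))[n _ hn].
  have := hn n (leqnn n); rewrite /= sub0r normrN ger0_norm ?exprn_ge0// => hn'.
  apply: (le_trans (D_unit n hc c01)); rewrite -exprVn -[2^-1]mul1r.
  by move: (_ ^+ n) hn' => z ?; lra.
have := D_lin (2 * K) hc (bmeas_cst _ (- K)).
rewrite D0 mulr0 add0r.
have -> : D (fun=> - K) = 0.
  rewrite /D (_ : averaging _ = fun=> - K) ?subrr//; apply/funext => x.
  by rewrite /averaging -mulrDl P_sum mul1r.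
move=> h0; rewrite -[X in _ == X]h0; apply/eqP; congr D; apply/funext => x.
rewrite /chi.
by rewrite mulrDr mulrA mulfV// mul1r; lra.
Qed.

End Extension.

(** On Hoelder functions the iterates converge to a constant; this limit is a positive normalized
    linear functional, which [riesz] represents. Shifting the limit by one step gives stationarity
    on Hoelder functions, and [stationary_bmeas] extends it. *)
Theorem stationary_measure : exists (nu : probability I R) (C rho : R),
  [/\ 0 < C, 0 < rho < 1,
   forall psi, bmeas psi -> \int[nu]_x averaging psi x = \int[nu]_x psi x &
   forall psi K, 0 <= K ->
   (forall x y, `|psi x - psi y| <= K * `|val x - val y| `^ g) ->
   forall n x, `|iter n averaging psi x - \int[nu]_x psi x| <= C * K * rho ^+ n].
Proof.
have [L [C [rho [C0 rho01 hL]]]] :=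
  averaging_limit alpha_gt0 g01 d_gt0 P_sum P_ge P_holder.
have cvL psi x : is_holder g psi -> iter n averaging psi x @[n --> \oo] --> L psi.
  move=> [_ [K hK]]; apply/cvgrPdist_le => e e0.
  have h x' y : `|psi x' - psi y| <= `|K| * `|val x' - val y| `^ g.
    by apply: (le_trans (hK _ _)); rewrite ler_wpM2r ?powR_ge0// ler_norm.
  have : (fun n => C * `|K| * rho ^+ n) @ \oo --> (0 : R).
    rewrite -[X in _ --> X](mulr0 (C * `|K|)); apply: cvgM; first exact: cvg_cst.
    by case/andP: rho01 => ? ?; apply: cvg_expr; rewrite ger0_norm ?ltW.
  move=> /cvgrPdist_lt/(_ _ e0)[m _ hm]; exists m => // n /= mn.
  rewrite distrC (le_trans (hL _ _ (normr_ge0 K) h n x))//.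
  by have := hm n mn; rewrite /= sub0r normrN => /ltW; exact: le_trans (ler_norm _).
pose x0 : I := I01_zero R.
have cst1 : is_holder g (fun _ : I => 1 : R) by exact: is_holder_cst.
have [nu hnu] : exists nu : probability I R, forall psi, is_holder g psi ->
    \int[nu]_x psi x = L psi.
  apply: riesz => // [psi chi hp hc|c psi hp|psi chi hp hc h|].
  - apply: (cvg_unique _ (cvL _ x0 (is_holderD hp hc))) => //.
    rewrite /= (_ : (fun n => _) = (fun n => iter n averaging psi x0 +
      iter n averaging chi x0)); first by apply: cvgD; exact: cvL.
    by apply/funext => n; rewrite averagingD.
  - apply: (cvg_unique _ (cvL _ x0 (is_holderZ c hp))) => //.
    rewrite /= (_ : (fun n => _) = (fun n => c * iter n averaging psi x0)).
      by apply: cvgM; [exact: cvg_cst|exact: cvL].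
    by apply/funext => n; rewrite averagingZ.
  - apply: (ler_cvg_to (cvL _ x0 hp) (cvL _ x0 hc)); apply: nearW => n.
    exact: (averaging_le _ d_gt0 P_ge).
  - apply: (cvg_unique _ (cvL _ x0 cst1)) => //.
    rewrite /= (_ : (fun n => _) = (fun=> 1)); first exact: cvg_cst.
    by apply/funext => n; rewrite averaging_cst.
exists nu, C, rho; split=> //.
  apply: stationary_bmeas => psi hp; rewrite !hnu//; last exact: holder_averaging.
  apply: (cvg_unique _ (cvL _ x0 (holder_averaging hp))) => //.
  rewrite /= (_ : (fun n => _) = (fun n => iter n.+1 averaging psi x0)).
    by rewrite (cvg_shiftS (fun n => iter n averaging psi x0)); exact: cvL.
  by apply/funext => n; rewrite iterSr.
move=> psi K K0 hK n x; rewrite hnu; first exact: hL.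
split; last by exists K.
exists (`|psi x0| + K) => y; rewrite -[psi y](subrK (psi x0)) addrC.
rewrite (le_trans (ler_normD _ _))// lerD2l (le_trans (hK _ _))//.
by rewrite -[leRHS]mulr1 ler_wpM2l// powR_le1 ?(ltW g_gt0)// normr_ge0 I01_dist1.
Qed.

End StationaryMeasure.

(** * Gibbs states *)

Section StationaryInvariant.
Variables (R : realType) (alpha : R).
Hypothesis alpha_gt0 : 0 < alpha.
Local Notation I := (I01 R).
Local Notation f := (@intermittent_map R alpha).
Local Notation branch := (branch alpha).
Variables (P : bool -> I -> R) (d : R).
Local Notation averaging := (@averaging R alpha P).
Hypotheses (d_gt0 : 0 < d) (bmeas_P : forall b, bmeas (P b)).
Hypothesis P_sum : forall x, P false x + P true x = 1.
Hypothesis P_ge : forall b x, d <= P b x.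
Variable nu : probability I R.
Local Notation mean psi := (\int[nu]_x psi x).
Hypothesis stationary : forall psi, bmeas psi -> mean (averaging psi) = mean psi.

Let bmeas_averaging psi : bmeas psi -> bmeas (averaging psi).
Proof.
by move=> h; apply: bmeasD; apply: bmeasM => //;
  apply: (bmeas_comp _ h); exact: measurable_branch.
Qed.

Let Z : set I := [set x | val x = 0].

Let mZ : measurable Z.
Proof.
rewrite (_ : Z = (fun x : I => val x) @^-1` [set 0]).
  by rewrite -[X in measurable X]setTI; apply: measurable_val.
by apply/seteqP; split.
Qed.

(** The right branch never takes the value 0, so one averaging step multiplies the mass of 0 by at
    most [1 - d]. This disposes of the point where [map_branch] fails. *)
Lemma mean_indic0 : mean (\1_Z) = 0.
Proof.
have bZ := bmeas_indic R mZ.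
have h : mean (averaging (\1_Z)) <= mean (fun x => (1 - d) * \1_Z x).
  apply: le_mean; [exact: bmeas_averaging|exact: bmeasZ|] => x.
  have bt : branch true x \notin Z.
    apply/negP => /set_mem h.
    by have := branch_true_gt0 alpha_gt0 x; rewrite h ltxx.
  rewrite /averaging !indicE (negbTE bt) mulr0 addr0.
  have [/set_mem xZ|xZ] := boolP (x \in Z).
    rewrite mulr1; apply: (@le_trans _ _ (P false x)).
      rewrite -[leRHS]mulr1 ler_wpM2l ?(le_trans (ltW d_gt0))//.
      by case: (_ \in _).
    by have := P_sum x; have := P_ge true x; lra.
  rewrite memNset ?mulr0// => h; move/negP: xZ; apply; apply/mem_set.
  rewrite /Z /=; have := lift_branch alpha_gt0 false x; rewrite h lift_fun0 add0r.
  by move=> <-.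
rewrite stationary// meanZ// in h.
apply/eqP; rewrite eq_le; apply/andP; split.
  have : d * mean (\1_Z) <= 0 by lra.
  by rewrite pmulr_rle0.
by apply: mean_ge => // x; rewrite indicE.
Qed.

Lemma mean_eq_pos psi chi : bmeas psi -> bmeas chi ->
  (forall x : I, 0 < val x -> psi x = chi x) -> mean psi = mean chi.
Proof.
move=> hp hc h; have hb := bmeasB hp hc; have [_ [M hM]] := hb.
have bZ := bmeas_indic R mZ.
have le (x : I) : `|psi x - chi x| <= M * \1_Z x.
  rewrite indicE; have [_|xZ] := boolP (x \in Z); first by rewrite mulr1.
  rewrite mulr0 h ?subrr ?normr0// lt_neqAle eq_sym; have /andP[-> _] := I01P x.
  by rewrite andbT; apply: contra xZ => /eqP xZ; apply/mem_set.
apply/eqP; rewrite -subr_eq0 -meanB// -normr_le0.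
have zE : mean (fun x => M * \1_Z x) = 0 by rewrite meanZ// mean_indic0 mulr0.
have zE' : mean (fun x => - M * \1_Z x) = 0 by rewrite meanZ// mean_indic0 mulr0.
have u1 : mean (fun x => psi x - chi x) <= mean (fun x => M * \1_Z x).
  apply: le_mean => //; first exact: bmeasZ.
  by move=> x; have := le x; rewrite ler_norml => /andP[].
have u2 : mean (fun x => - M * \1_Z x) <= mean (fun x => psi x - chi x).
  apply: le_mean => //; first exact: bmeasZ.
  by move=> x; have := le x; rewrite ler_norml mulNr => /andP[].
rewrite zE in u1; rewrite zE' in u2.
by rewrite normr_le0 eq_le u1 u2.
Qed.

(** Averaging [psi (f x) * chi x] pulls [psi x] out, because [f] inverts both branches off the null
    point 0: [averaging] is adjoint to composition with [f]. *)
Lemma mean_shift psi chi : bmeas psi -> bmeas chi ->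
  mean (fun x => psi (f x) * chi x) = mean (fun x => psi x * averaging chi x).
Proof.
move=> hp hc; have hpf := bmeas_comp (measurable_map alpha_gt0) hp.
rewrite -stationary; last exact: bmeasM.
apply: mean_eq_pos; first exact/bmeas_averaging/bmeasM.
  exact/bmeasM/bmeas_averaging.
by move=> x x0; rewrite /averaging !map_branch//; ring.
Qed.

Lemma stationary_invariant : invariant_measure f nu.
Proof.
move=> A mA.
have mfA : @measurable _ I (f @^-1` A).
  by rewrite -[X in measurable X]setTI; apply: measurable_map.
rewrite (prob_fine nu mfA) (prob_fine nu mA) -!mean_indic//; congr (_%:E).
have := mean_shift (bmeas_indic R mA) (bmeas_cst _ 1).
rewrite (_ : averaging (fun=> 1) = fun=> 1); last first.
  by apply/funext => x; rewrite /averaging !mulr1 P_sum.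
have e1 : (fun x => (\1_A (f x) : R) * 1) = \1_(f @^-1` A).
  by apply/funext => x; rewrite mulr1.
have e2 : (fun x => (\1_A x : R) * 1) = \1_A by apply/funext => x; rewrite mulr1.
by rewrite e1 e2.
Qed.

Lemma mean_shift_iter n psi chi : bmeas psi -> bmeas chi ->
  mean (fun x => psi (iter n f x) * chi x) =
  mean (fun x => psi x * iter n averaging chi x).
Proof.
move=> hp; elim: n chi => [//|n ih] chi hc.
have E : (fun x => psi (iter n.+1 f x) * chi x) =
    (fun x => (fun y => psi (iter n f y)) (f x) * chi x).
  by apply/funext => x; rewrite iterSr.
rewrite E (mean_shift (bmeas_iter alpha_gt0 n hp) hc).
rewrite ih; last exact: bmeas_averaging.
by congr (fine (integral _ _ _)); apply/funext => x; rewrite iterSr.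
Qed.

End StationaryInvariant.

(** * Equilibrium states from an eigenfunction *)

Section GibbsState.
Variables (R : realType) (alpha : R).
Hypothesis alpha_gt0 : 0 < alpha.
Local Notation I := (I01 R).
Local Notation f := (@intermittent_map R alpha).
Local Notation branch := (branch alpha).
Local Notation tword := (tword alpha).
Local Notation bsum := (@bsum R alpha).
Local Notation itin := (itin alpha).
Local Notation birk := (@birk R alpha).
Local Notation transfer := (@transfer R alpha).
Variables (g p : R) (phi h : I -> R).
Hypotheses (g01 : 0 < g <= 1) (phi_holder : is_holder g phi).
Hypotheses (h_holder : is_holder g h) (h_ge1 : forall x, 1 <= h x).
Hypothesis h_eigen : forall x, transfer phi h x = expR p * h x.

Let g_gt0 : 0 < g. Proof. by case/andP: g01. Qed.

Let h_gt0 x : 0 < h x. Proof. exact: lt_le_trans (h_ge1 x). Qed.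

Let P b x : R := expR (phi (branch b x) - p) * h (branch b x) / h x.

Let P_sum x : P false x + P true x = 1.
Proof.
have -> : P false x + P true x = transfer phi h x * expR (- p) / h x.
  rewrite /P /transfer !expRD; move: (expR (- p)) (h x)^-1 => u v.
  move: (expR (phi _)) (expR (phi _)) (h _) (h _) => a1 a2 a3 a4.
  by ring.
rewrite h_eigen [expR p * _ * _]mulrAC -expRD subrr expR0 mul1r divff//.
by rewrite gt_eqF.
Qed.

Let holder_P b : is_holder g (P b).
Proof.
have hT (psi : I -> R) : is_holder g psi -> is_holder g (psi \o branch b).
  by move=> k; apply: (is_holder_nonexpansive g_gt0 _ k) => x y; exact: branch_lip.
apply: is_holderM; last exact: (is_holderV ltr01).
apply: is_holderM; last exact: (hT h).
apply: is_holder_expR; apply: is_holderB; last exact: is_holder_cst.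
exact: (hT phi).
Qed.

Let P_lower : exists2 d, 0 < d & forall b x, d <= P b x.
Proof.
have [[M hM] _] := phi_holder; have [[B hB] _] := h_holder.
have hB' x : h x <= B by exact: le_trans (ler_norm _) (hB x).
have B0 : 0 < B by exact: lt_le_trans (h_gt0 (I01_zero R)) (hB' _).
exists (expR (- M - p) / B); first by rewrite divr_gt0// expR_gt0.
move=> b x; apply: ler_pM; rewrite ?expR_ge0 ?invr_ge0 ?(ltW B0)//.
  rewrite -[leLHS]mulr1; apply: ler_pM; rewrite ?expR_ge0//.
  by rewrite ler_expR lerB//; have := hM (branch b x); rewrite ler_norml => /andP[].
by rewrite lef_pV2 ?posrE.
Qed.

Section Equilibrium.
Variables (d : R) (nu : probability I R).
Hypotheses (d_gt0 : 0 < d) (P_ge : forall b x, d <= P b x).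
Local Notation mean psi := (\int[nu]_x psi x).
Hypothesis stationary : forall psi, bmeas psi ->
  mean (averaging alpha P psi) = mean psi.

Let bmeas_P b : bmeas (P b) := holder_bmeas g_gt0 (holder_P b).

Let nu_inv : invariant_measure f nu :=
  stationary_invariant alpha_gt0 d_gt0 bmeas_P P_sum P_ge stationary.

Let bphi : bmeas phi := holder_bmeas g_gt0 phi_holder.

(** The upper half of the Gibbs property of cylinders. The test function [chi] is there for the
    induction: peeling off the first letter replaces it by [P b x * chi (branch b x)]. *)
Lemma cylinder_mean_le w chi c : bmeas chi ->
  (forall x, expR (bsum phi w x - p * (size w)%:R) * h (tword w x) / h x *
     chi (tword w x) <= c) ->
  mean (fun x => (itin (size w) x == w)%:R * chi x) <= c.
Proof.
have bI w' : bmeas (fun x => (itin (size w') x == w')%:R : R).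
  exact: (bmeas_finmeas (fun v => (v == w')%:R) (finmeas_itin alpha_gt0 (size w'))).
elim: w chi => [|b w ih] chi hc hle.
  apply: mean_le => [|x]; first exact: bmeasM.
  by have := hle x; rewrite /= mulr0 subr0 expR0 !mul1r divff ?gt_eqF// mul1r.
pose chi' x := P b x * chi (branch b x).
have hc' : bmeas chi'.
  by apply: bmeasM => //; apply: (bmeas_comp _ hc); exact: measurable_branch.
have bR : bmeas (fun x => (right_half alpha x == b)%:R * chi x).
  apply: bmeasM => //.
  exact: (bmeas_finmeas (fun v => (v == b)%:R) (finmeas_right_half alpha)).
have -> : mean (fun x => (itin (size (b :: w)) x == b :: w)%:R * chi x) =
    mean (fun x => (itin (size w) x == w)%:R * chi' x).
  rewrite (_ : (fun x => _) = (fun x => (fun y => (itin (size w) y == w)%:R) (f x) *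
     ((right_half alpha x == b)%:R * chi x))); last first.
    apply/funext => x /=; rewrite eqseq_cons mulrA -natrM mulnb andbC //.
  rewrite (mean_shift alpha_gt0 d_gt0 bmeas_P P_sum P_ge stationary (bI w) bR).
  apply: (mean_eq_pos alpha_gt0 d_gt0 bmeas_P P_sum P_ge stationary).
  - apply: bmeasM => //; apply: bmeasD; apply: bmeasM => //;
      apply: (bmeas_comp _ bR); exact: measurable_branch.
  - exact: bmeasM.
  - move=> x x0; rewrite /averaging !right_half_branch// /chi'.
    by case: b {hle chi' hc' bR}; rewrite !mul1r mul0r mulr0 ?addr0 ?add0r.
apply: ih => // x; apply: le_trans (hle x).
rewrite /chi' /P /= -natr1 le_eqVlt; apply/orP; left; apply/eqP.
have -> : phi (branch b (tword w x)) + bsum phi w x - p * ((size w)%:R + 1) =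
  (bsum phi w x - p * (size w)%:R) + (phi (branch b (tword w x)) - p) by ring.
rewrite [in RHS]expRD; move: (expR (bsum phi w x - _)) => u.
move: (expR (phi (branch b (tword w x)) - p)) (h_gt0 x) (h_gt0 (tword w x)) => v.
move: (h x) (h (tword w x)) (h (branch _ _)) (chi _) => h1 h2 h3 k h10 h20.
by field; rewrite !gt_eqF.
Qed.

Let bit (j : 'I_2) : bool := val j == 1%N.
Let side x : 'I_2 := inord (right_half alpha x).

Let bit_side x : bit (side x) = right_half alpha x.
Proof. by rewrite /bit /side /= inordK; case: right_half. Qed.

Let side_partition : finite_partition (fun j => [set x | side x = j]).
Proof.
have m j : @measurable _ I [set x | side x = j].
  have [_ /(_ [set j])] := finmeas_comp (fun b : bool => inord b : 'I_2)
    (finmeas_right_half alpha).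
  exact.
split=> //.
  by move=> i j _ _ [x [/= <- <-]].
by apply/seteqP; split=> // x _; exists (side x).
Qed.

(** Each atom of the join is a cylinder, of mass at most [exp (- c s)], so its information is at
    least [c s]; and [c (X x)] is [p * n] minus the Birkhoff sum at [x], up to [o(n)]. *)
Lemma side_entropy_ge : exists D : nat -> R,
  (forall e, 0 < e -> exists n0, forall n, (n0 <= n)%N -> D n <= e * n%:R) /\
  forall n, n%:R * (p - mean phi) - D n <=
    join_entropy f nu (fun j => [set x | side x = j]) n.
Proof.
have [D [D0 hD hD']] := bsum_distortion alpha_gt0 g_gt0 phi_holder.
have [[B hB] _] := h_holder.
have hB' x : h x <= B by exact: le_trans (ler_norm _) (hB x).
have B0 : 0 < B by exact: lt_le_trans (h_gt0 (I01_zero R)) (hB' _).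
exists (fun n => D n + D n + ln B); split.
  move=> e e0; have e3 : 0 < e / 3 by rewrite divr_gt0.
  have [n0 hn0] := hD' _ e3.
  exists (maxn n0 (Num.truncn ((e / 3)^-1 * `|ln B|)).+1) => n.
  rewrite geq_max => /andP[nn0 nB]; have := hn0 _ nn0.
  have : ln B <= e / 3 * n%:R.
    rewrite -ler_pdivrMl//; apply: (@le_trans _ _ ((e / 3)^-1 * `|ln B|)).
      by rewrite ler_pM2l ?invr_gt0// ler_norm.
    by rewrite (le_trans (ltW (truncnS_gt _)))// ler_nat.
  by move: (D n) (ln B) n%:R => u v z; lra.
move=> n; pose X x := [ffun i : 'I_n => side (iter i f x)].
pose ws (s : {ffun 'I_n -> 'I_2}) := [seq bit (s i) | i <- enum 'I_n].
have size_ws s : size (ws s) = n by rewrite size_map size_enum_ord.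
have itinE x : itin n x = ws (X x).
  rewrite /ws (eq_map (g := fun i : 'I_n => right_half alpha (iter i f x))); last first.
    by move=> i; rewrite ffunE bit_side.
  rewrite -[RHS]/(map ((fun i => right_half alpha (iter i f x)) \o val) (enum 'I_n)).
  rewrite map_comp val_enum_ord.
  elim: n x {X ws size_ws} => [//|n ih] x /=; rewrite ih (iotaDl 1 0 n) -map_comp.
  by congr (_ :: _); apply: eq_map => i /=; rewrite -iterSr.
have fX : finmeas X.
  apply: finmeas_names => //; exact: finmeas_comp (fun b : bool => inord b : 'I_2)
    (finmeas_right_half alpha).
pose c s := p * n%:R - bsum phi (ws s) (I01_zero R) - D n - ln B.
have mu_le s : pr nu [set x | X x = s] <= expR (- c s).
  have mX : measurable [set x | X x = s] by have [_ /(_ [set s])] := fX.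
  rewrite /pr -mean_indic//.
  apply: (@le_trans _ _ (mean (fun x => (itin (size (ws s)) x == ws s)%:R * 1))).
    apply: le_mean; first exact: bmeas_indic.
      apply: bmeasM (bmeas_cst _ _).
      exact: (bmeas_finmeas (fun v => (v == ws s)%:R) (finmeas_itin alpha_gt0 (size (ws s)))).
    move=> x; rewrite mulr1 indicE size_ws itinE.
    have [/set_mem /= ->|_] := boolP (x \in _); first by rewrite eqxx.
    exact: ler0n.
  apply: cylinder_mean_le; first exact: bmeas_cst.
  move=> x; rewrite mulr1 size_ws.
  apply: (@le_trans _ _ (expR (bsum phi (ws s) x - p * n%:R) * B)).
    rewrite -mulrA ler_wpM2l ?expR_ge0// ler_pdivrMr// (le_trans (hB' _))//.
    by rewrite -[leLHS]mulr1 ler_wpM2l// ltW.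
  rewrite -[X in _ * X](@lnK R B) ?posrE// -expRD ler_expR /c.
  have := hD (ws s) x (I01_zero R); rewrite size_ws => /(le_trans (ler_norm _)).
  by move: (bsum _ _ _) (bsum _ _ _) => u v; lra.
rewrite (@join_entropyE _ _ _ _ _ side); last first.
  move=> s; apply/seteqP; split=> x /=.
    by move=> k; apply/ffunP => i; rewrite ffunE k.
  by move=> <- i; rewrite ffunE.
rewrite -sumrN.
apply: (@le_trans _ _ (mean (fun x => c (X x)))); last first.
  rewrite (@mean_finmeas _ _ _ nu _ X c)//; apply: ler_sum => s _.
  rewrite -/(pr nu [set x | X x = s]).
  have [->|pn0] := eqVneq (pr nu [set x | X x = s]) 0.
    by rewrite mul0r mulr0 oppr0.
  have p0 : 0 < pr nu [set x | X x = s] by rewrite lt_def pn0 pr_ge0.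
  rewrite -mulrN mulrC ler_wpM2l ?(ltW p0)// lerNr -[leRHS](expRK).
  by rewrite ler_ln ?posrE ?expR_gt0//; exact: mu_le.
have -> : n%:R * (p - mean phi) - (D n + D n + ln B) =
    mean (fun x => (p * n%:R - (D n + D n + ln B)) - birk phi n x).
  rewrite meanB ?mean_cst ?(mean_birk alpha_gt0 nu_inv)//; last exact: bmeas_birk.
    by ring.
  exact: bmeas_cst.
apply: le_mean; last 1 first.
- move=> x; rewrite /c -(bsum_itin alpha_gt0) itinE.
  have := hD (ws (X x)) (I01_zero R) (iter n f x).
  rewrite size_ws => /(le_trans (ler_norm _)).
  by move: (bsum _ _ _) (bsum _ _ _) => u v; lra.
- by apply: bmeasB; [exact: bmeas_cst|exact: bmeas_birk].
- exact: (bmeas_finmeas c fX).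
Qed.

Let h_bnd : exists B, forall x, 1 <= h x <= B.
Proof.
have [[B hB] _] := h_holder; exists B => x.
by rewrite h_ge1 (le_trans (ler_norm _) (hB x)).
Qed.

Let h_super x : transfer phi h x <= expR p * h x.
Proof. by rewrite h_eigen. Qed.

(** The partition into halves attains the bound of [entropy_le]. The two estimates also show that
    its quotients converge, so [limn] is a true limit. *)
Lemma equilibrium_entropy : entropy f nu = (p - mean phi)%:E.
Proof.
have [B hB] := h_bnd; apply/eqP; rewrite eq_le; apply/andP; split.
  exact: (entropy_le alpha_gt0 nu_inv g_gt0 phi_holder ltr01 hB h_super).
apply: ereal_sup_ubound; exists 2%N, (fun j => [set x | side x = j]).
split=> //; congr (_%:E); apply/esym.
apply: (@cvg_lim R) => //; apply/cvgrPdist_le => e e0.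
have [D [hD hge]] := side_entropy_ge; have [n0 hn0] := hD _ e0.
near=> n.
have n1 : 0 < n%:R :> R by rewrite ltr0n; near: n; exists 1%N.
rewrite ler_distl; apply/andP; split.
  rewrite lerBlDr; near: n.
  exact: (join_entropy_ratio alpha_gt0 nu_inv g_gt0 phi_holder ltr01 hB h_super).
rewrite -lerBlDr ler_pdivlMr//; apply: le_trans (hge n).
have : D n <= e * n%:R by apply: hn0; near: n; exists n0.
by move: (D n) => u; lra.
Unshelve. all: by end_near. Qed.

(** Up to the coboundary of [ln h], whose mean is 0, [phi - p] is the logarithm of a transition
    probability, and these are at most [1 - d]. *)
Lemma equilibrium_entropy_gt0 : mean phi < p.
Proof.
have d1 : d < 1.
  by have := P_sum (I01_zero R); have := P_ge false (I01_zero R);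
     have := P_ge true (I01_zero R); lra.
have [B hB] := h_bnd.
have bln : bmeas (fun x => ln (h x)).
  split; first by apply: measurableT_comp => //; exact: (holder_bmeas g_gt0 h_holder).1.
  exists (ln B) => x; have /andP[h1 h2] := hB x.
  by rewrite ger0_norm ?ln_ge0// ler_ln ?posrE ?(lt_le_trans ltr01)// (le_trans h1).
have blnf := bmeas_comp (measurable_map alpha_gt0) bln.
have : mean (fun y => phi y + ln (h y) - ln (h (f y))) <= p + ln (1 - d).
  apply: mean_le; first exact/bmeasB/blnf/bmeasD.
  move=> y; have : P (right_half alpha y) (f y) <= 1 - d.
    have := P_sum (f y); have := P_ge false (f y); have := P_ge true (f y).
    by case: right_half; lra.
  rewrite /P branch_map// => le1; rewrite -lerBlDl.
  have P0 : 0 < expR (phi y - p) * h y / h (f y).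
    by rewrite !mulr_gt0 ?invr_gt0 ?expR_gt0.
  have := le1; rewrite -ler_ln ?posrE ?subr_gt0//.
  rewrite ln_div ?posrE ?mulr_gt0 ?expR_gt0// lnM ?posrE ?expR_gt0// expRK.
  by move: (phi y) (ln (h y)) => u v; lra.
rewrite (meanB nu (bmeasD bphi bln) blnf) (meanD nu bphi bln).
rewrite (_ : mean (fun x => ln (h (f x))) = mean (fun x => ln (h x))); last first.
  exact: (mean_comp (measurable_map alpha_gt0) nu_inv bln).
have : ln (1 - d) < 0 by rewrite ln_lt0// subr_gt0 d1 gtrBl.
by move: (mean _) (ln (1 - d)) => u v; lra.
Qed.

Lemma equilibrium_gibbs : gibbs_state alpha phi nu.
Proof.
split; first exact: nu_inv.
have [B hB] := h_bnd; rewrite /pressure equilibrium_entropy mean_EFin// -EFinD subrK.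
apply/eqP; rewrite eq_le; apply/andP; split.
  apply: ereal_sup_ubound; exists nu; first exact: nu_inv.
  by rewrite equilibrium_entropy mean_EFin// -EFinD subrK.
apply: ge_ereal_sup => _ [mu mu_inv <-]; rewrite mean_EFin//.
have := entropy_le alpha_gt0 mu_inv g_gt0 phi_holder ltr01 hB h_super.
by rewrite EFinB leeBrDr// fin_numE.
Qed.

End Equilibrium.

Theorem intermittent_gibbs : exists nu : probability I R,
  [/\ gibbs_state alpha phi nu, exponentially_mixing alpha nu &
      (0 < entropy f nu)%E].
Proof.
have [d d0 hd] := P_lower; have [_ [N hN]] := holder_P true.
have [nu [C [rho [C0 rho01 hst hmix]]]] := stationary_measure alpha_gt0 g01 d0 P_sum hd hN.
exists nu; split.
- exact: (equilibrium_gibbs d0 hd hst).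
- exists C, rho; split=> // psi psi' n mpsi bpsi.
  have hp : bmeas psi by split.
  have bP b := holder_bmeas g_gt0 (holder_P b).
  have hK x y : `|psi' x - psi' y| <= holder_seminorm 1 psi' * `|val x - val y| `^ g.
    apply: (le_trans (holder_seminorm_ge _ _ _)); rewrite ler_wpM2l//.
      exact: holder_seminorm_ge0.
    by apply: powR_exp_le => //; [case/andP: g01|rewrite normr_ge0 I01_dist1].
  have h1 : is_holder 1 psi' by have /asboolP := holder_funP psi'.
  have bp' : bmeas psi' := holder_bmeas ltr01 h1.
  have bG : bmeas (iter n (averaging alpha P) psi').
    elim: n => [//|n ih]; rewrite iterS; apply: bmeasD; apply: bmeasM => //;
      apply: (bmeas_comp _ ih); exact: measurable_branch.
  (* The dependence on [n] passes from [psi] to the Markov iterates of [psi'], which are uniformly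
     close to its mean. *)
  rewrite (mean_shift_iter alpha_gt0 d0 bP P_sum hd hst n hp bp').
  have K0 := holder_seminorm_ge0 psi'.
  rewrite [X in _ - X]mulrC -(meanZ nu _ hp) -meanB; [|exact: bmeasM|exact: bmeasZ].
  apply: norm_mean_le; first by apply: bmeasB; [exact: bmeasM|exact: bmeasZ].
  move=> x; rewrite [X in _ - X]mulrC -mulrBr normrM.
  have -> : C * supnorm psi * holder_seminorm 1 psi' * rho ^+ n =
     supnorm psi * (C * holder_seminorm 1 psi' * rho ^+ n) by ring.
  apply: ler_pM => //; last exact: hmix.
  by have [M hM] := bpsi; apply: ub_le_sup; [exists M => _ [y _ <-]|exists x].
- rewrite (equilibrium_entropy d0 hd hst) lte_fin subr_gt0.
  exact: (equilibrium_entropy_gt0 d0 hd hst).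
Qed.

End GibbsState.

(** * The critical parameter *)

Section FixedPointMeasures.
Variables (R : realType) (alpha : R).
Hypothesis alpha_gt0 : 0 < alpha.
Local Notation I := (I01 R).
Local Notation f := (@intermittent_map R alpha).

Lemma map_zero : f (I01_zero R) = I01_zero R.
Proof.
apply: val_inj; rewrite val_intermittent_map// /intermittent_fun /=.
by rewrite mul0r ler01.
Qed.

Lemma map_one : f (I01_one R) = I01_one R.
Proof.
apply: val_inj; rewrite val_intermittent_map// /intermittent_fun /= powR1 mul1r.
by rewrite ifF ?addrK//; apply/negbTE; rewrite -ltNge ltrDl.
Qed.

Lemma dirac_invariant x : f x = x -> invariant_measure f (\d_x : probability I R).
Proof.
move=> fx A mA; change ((\d_x (f @^-1` A) : \bar R) = \d_x A); rewrite !diracE.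
congr (_%:R%:E); congr nat_of_bool.
by apply/idP/idP => /set_mem h; apply/mem_set; move: h; rewrite /preimage /= fx.
Qed.

Lemma mean_dirac x (psi : I -> R) : bmeas psi ->
  \int[(\d_x : probability I R)]_y psi y = psi x.
Proof.
move=> [mp _]; rewrite /Rintegral integral_dirac//; last exact/measurable_EFinP.
by rewrite diracT mul1e.
Qed.

Lemma mean_eq0_null (nu : probability I R) (psi : I -> R) : bmeas psi ->
  (forall x, 0 <= psi x) -> \int[nu]_x psi x = 0 ->
  pr nu [set x | 0 < psi x] = 0.
Proof.
move=> hp p0 m0; have [mp _] := hp.
have mS : @measurable _ I [set x | 0 < psi x].
  rewrite (_ : [set x | _] = psi @^-1` `]0, +oo[%classic).
    by rewrite -[X in measurable X]setTI; apply: mp => //; exact: measurable_itv.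
  by apply/seteqP; split=> x; rewrite /= in_itv /= andbT.
pose chi n x : R := Num.min 1 (n%:R * psi x).
have chi0 n x : 0 <= chi n x by rewrite le_min ler01 mulr_ge0.
have chib n x : `|chi n x| <= 1 by rewrite ger0_norm// ge_min lexx.
have mchi n : measurable_fun setT (chi n).
  by apply: measurable_minr => //; exact: measurable_funM.
have cv x : chi n x @[n --> \oo] --> (\1_[set x | 0 < psi x] x : R).
  rewrite indicE; have [/set_mem /= px|px] := boolP (x \in _).
    apply: cvg_near_cst; exists (Num.truncn (psi x)^-1).+1 => // n /= hn.
    rewrite /chi min_l// -ler_pdivrMr// mul1r (le_trans (ltW (truncnS_gt _)))//.
    by rewrite ler_nat.
  have psi0 : psi x = 0.
    apply/eqP; rewrite eq_le p0 andbT leNgt; apply: contra px => px.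
    exact/mem_set.
  by apply: cvg_near_cst; apply: nearW => n; rewrite /chi psi0 mulr0 min_r.
have [_ c] := mean_cvg nu mchi chib cv.
rewrite mean_indic// in c; apply: (cvg_unique _ c) => //.
rewrite (_ : (fun n => _) = fun=> 0); first exact: cvg_cst.
apply/funext => n; apply/eqP; rewrite eq_le; apply/andP; split.
  have : \int[nu]_x chi n x <= \int[nu]_x (n%:R * psi x).
    apply: le_mean; [by split=> //; exists 1 => x|exact: bmeasZ|] => x.
    by rewrite ge_min lexx orbT.
  by rewrite meanZ// m0 mulr0.
by apply: mean_ge => //; split=> //; exists 1 => x.
Qed.

Lemma mean_power0_dirac g (nu : probability I R) : 0 < g ->
  bmeas (fun x : I => val x `^ g) -> \int[nu]_x (val x `^ g) = 0 ->
  forall A, measurable A -> nu A = delta0 R A.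
Proof.
move=> g0 bv m0 A mA.
have h := mean_eq0_null bv (fun x => powR_ge0 _ _) m0.
have hz x : x != I01_zero R -> 0 < val x `^ g.
  move=> xz; apply: powR_gt0; rewrite lt_neqAle eq_sym; have /andP[-> _] := I01P x.
  by rewrite andbT; apply: contra xz => /eqP x0; apply/eqP/val_inj.
have null B : measurable B -> ~ B (I01_zero R) -> pr nu B = 0.
  move=> mB Bz; apply/eqP; rewrite eq_le pr_ge0 andbT.
  apply: (@le_trans _ _ (pr nu [set x : I | 0 < val x `^ g])); last by rewrite h.
  apply: pr_le => //.
    rewrite (_ : [set x | _] = (fun x : I => val x `^ g) @^-1` `]0, +oo[%classic).
      by rewrite -[X in measurable X]setTI; apply: bv.1 => //; exact: measurable_itv.
    by apply/seteqP; split=> x; rewrite /= in_itv /= andbT.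
  by move=> x Bx /=; apply: hz; apply/eqP => xz; apply: Bz; rewrite -xz.
rewrite (prob_fine nu mA) -/(pr nu A) /= diracE.
have [/set_mem Az|Az] := boolP (_ \in A); last first.
  by rewrite null// => Az'; move/negP: Az; apply; exact/mem_set.
have := null _ (measurableC mA) (fun h => h Az).
rewrite -setTD pr_setD// => /eqP; rewrite subr_eq0 => /eqP <-.
by rewrite /pr [X in fine X](@probability_setT _ _ _ nu).
Qed.

Lemma entropy_dirac x : f x = x -> entropy f (\d_x : probability I R) = 0%E.
Proof.
move=> fx; apply/eqP; rewrite eq_le; apply/andP; split; last first.
  by apply: entropy_ge0 => //; exact: dirac_invariant.
apply: ge_ereal_sup => _ [k [A [partA ->]]]; rewrite lee_fin.
rewrite /partition_entropy (_ : (fun n => _) = fun=> 0) ?lim_cst//.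
apply/funext => n; rewrite /join_entropy big1 ?oppr0 ?mul0r// => s _.
rewrite (_ : fine _ = (x \in join_atom f A s)%:R).
  by case: (_ \in _); rewrite ?ln1 ?mulr0 ?mul0r.
by rewrite -[LHS]/(fine (\d_x (join_atom f A s) : \bar R)) diracE.
Qed.

Lemma entropy_ext (nu mu : probability I R) :
  (forall A, measurable A -> nu A = mu A) -> entropy f nu = entropy f mu.
Proof.
move=> h; congr ereal_sup; apply/seteqP; split=> e [k [A [partA ->]]]; exists k, A;
  split=> //; congr (_%:E); congr (limn _); apply/funext => n; congr (_ / _);
  congr (- _); apply: eq_bigr => s _; rewrite h//;
  have [a [fa _ aE]] := finite_partition_label alpha partA; rewrite aE;
  have [_ /(_ [set s])] := finmeas_names alpha_gt0 n fa; exact.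
Qed.

End FixedPointMeasures.

Section CriticalParameter.
Variables (R : realType) (alpha gamma : R).
Hypotheses (alpha_gt0 : 0 < alpha) (gamma01 : 0 < gamma <= 1) (gamma_le : gamma <= alpha).
Local Notation I := (I01 R).
Local Notation H := (holder gamma).
Local Notation f := (@intermittent_map R alpha).
Local Notation x0 := (I01_zero R).

Let gamma_gt0 : 0 < gamma. Proof. by case/andP: gamma01. Qed.

Lemma holder_fun_is_holder (phi : H) : is_holder gamma phi.
Proof. by have /asboolP := holder_funP phi. Qed.

Lemma holder_of_is_holder (phi : I -> R) : is_holder gamma phi ->
  exists psi : H, forall x, psi x = phi x.
Proof.
by move=> h; have k : (phi : I -> R^o) \in holder_pred gamma by [apply/asboolP];
  exists (Holder k).
Qed.

Lemma bmeas_holder_fun (phi : H) : bmeas phi.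
Proof. exact: holder_bmeas gamma_gt0 (holder_fun_is_holder phi). Qed.

Lemma is_holder_weight : is_holder gamma (fun x : I => val x `^ gamma).
Proof.
split; first by exists 1 => x; rewrite ger0_norm ?powR_ge0// powR_le1 ?I01P// ltW.
exists 1 => x y; rewrite mul1r; apply: powR_dist => //.
  by have /andP[] := I01P x.
by have /andP[] := I01P y.
Qed.

Let weight_in : ((fun x : I => val x `^ gamma) : I -> R^o) \in holder_pred gamma.
Proof. by apply/asboolP; exact: is_holder_weight. Qed.

Definition weight : H := Holder weight_in.
Local Notation v := weight.

Lemma weight_ge0 x : 0 <= v x. Proof. exact: powR_ge0. Qed.
Lemma weight_le1 x : v x <= 1. Proof. by rewrite powR_le1 ?I01P// ltW. Qed.
Lemma weight0 : v x0 = 0. Proof. by rewrite /= powR0// gt_eqF. Qed.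
Lemma weight1 : v (I01_one R) = 1. Proof. by rewrite /= powR1. Qed.

Lemma mean_weight (nu : probability I R) : 0 <= \int[nu]_x v x <= 1.
Proof.
have b := bmeas_holder_fun v; apply/andP; split.
  by apply: mean_ge => // x; exact: weight_ge0.
by apply: mean_le => // x; exact: weight_le1.
Qed.

Lemma meanD_weight (nu : probability I R) (phi : H) t :
  \int[nu]_x (phi + t *: v) x = \int[nu]_x phi x + t * \int[nu]_x v x.
Proof.
rewrite -(meanZ nu _ (bmeas_holder_fun v)).
by rewrite -(meanD nu (bmeas_holder_fun phi) (bmeasZ t (bmeas_holder_fun v))).
Qed.

Lemma subcritical_weightE (phi : H) t : subcritical alpha (phi + t *: v) <->
  forall nu : probability I R, invariant_measure f nu ->
  fine (entropy f nu) + \int[nu]_x phi x + t * \int[nu]_x v x <= phi x0.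
Proof.
have E : (phi + t *: v) x0 = phi x0.
  by change (phi x0 + t * v x0 = phi x0); rewrite weight0 mulr0 addr0.
by split=> h nu /h; rewrite meanD_weight E addrA.
Qed.

Let slope_set (phi : H) := [set t : R | subcritical alpha (phi + t *: v)].

Let slope_ub phi t : slope_set phi t -> t <= phi x0 - phi (I01_one R).
Proof.
move=> /subcritical_weightE /(_ _ (dirac_invariant (map_one alpha_gt0))).
rewrite entropy_dirac ?map_one// !(mean_dirac _ (bmeas_holder_fun _)).
rewrite weight1 mulr1 add0r.
by move=> h; rewrite lerBrDl.
Qed.

Lemma holder_le_weight (phi : H) x : phi x <= phi x0 + `|phi| * v x.
Proof.
rewrite -lerBlDl (le_trans (ler_norm _))//.
apply: (le_trans (holder_seminorm_ge _ _ _)); rewrite subr0 ger0_norm; last first.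
  by have /andP[] := I01P x.
rewrite ler_wpM2r ?powR_ge0// holder_normE lerDr.
by rewrite (le_trans _ (supnorm_ge phi x0)).
Qed.

Let slope_nonempty phi : slope_set phi !=set0.
Proof.
have [s s0 hs] := low_subcritical alpha_gt0.
exists (- `|phi| - s); apply: (hs gamma) => // [|x].
  exact: holder_fun_is_holder.
change (phi x + (- `|phi| - s) * v x <= phi x0 + (- `|phi| - s) * v x0 - s * val x `^ alpha).
rewrite weight0 mulr0 addr0.
have : s * val x `^ alpha <= s * v x.
  by rewrite ler_wpM2l ?(ltW s0)//; apply: powR_exp_le => //; exact: I01P.
have := holder_le_weight phi x; rewrite mulrBl mulNr.
by move: (s * v x) (s * _) => a b; lra.
Qed.

Let slope_sup phi : has_sup (slope_set phi).
Proof.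
split; first exact: slope_nonempty.
by exists (phi x0 - phi (I01_one R)) => t; exact: slope_ub.
Qed.

(** Subcriticality is a family of inequalities affine in [t] with slopes in [0, 1], so the
    admissible [t] form a closed half-line. The equivalence is the only access to [critical] in what
    follows. *)
Lemma critical_exists : exists critical : H -> R, forall (phi : H) t,
  t <= critical phi <-> subcritical alpha (phi + t *: v).
Proof.
exists (fun phi => sup (slope_set phi)) => phi t.
split=> [tc|]; last by move=> h; apply: ub_le_sup => //; case: (slope_sup phi).
apply/subcritical_weightE => nu inv; apply/ler_addgt0Pr => e e0.
have [s /subcritical_weightE/(_ _ inv) hs cs] := sup_adherent e0 (slope_sup phi).
have /andP[m0 m1] := mean_weight nu.
have : t * \int[nu]_x v x <= (s + e) * \int[nu]_x v x.
  rewrite ler_wpM2r// (le_trans tc)//; move: cs.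
  by move: (sup _) => c; lra.
have : e * \int[nu]_x v x <= e * 1 by rewrite ler_wpM2l// ltW.
move: hs; rewrite mulrDl.
move: (fine _) (\int[nu]_x phi x) (\int[nu]_x v x) (phi x0 : R) => a b m c.
by move=> *; lra.
Qed.

End CriticalParameter.

(** * The phases in terms of the critical parameter *)

Section CriticalLocus.
Variables (R : realType) (alpha gamma : R).
Hypotheses (alpha_gt0 : 0 < alpha) (gamma01 : 0 < gamma <= 1) (gamma_le : gamma <= alpha).
Local Notation I := (I01 R).
Local Notation H := (holder gamma).
Local Notation f := (@intermittent_map R alpha).
Local Notation x0 := (I01_zero R).
Local Notation v := (weight gamma01).
Variable critical : H -> R.
Hypothesis critical_le : forall (phi : H) t,
  t <= critical phi <-> subcritical alpha (phi + t *: v).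

Let gamma_gt0 : 0 < gamma. Proof. by case/andP: gamma01. Qed.

Let bmeasH (phi : H) : bmeas phi := bmeas_holder_fun gamma01 phi.

Lemma critical_bound (phi : H) (nu : probability I R) : invariant_measure f nu ->
  fine (entropy f nu) + \int[nu]_x phi x + critical phi * \int[nu]_x v x <= phi x0.
Proof. by have /critical_le/(subcritical_weightE alpha gamma01) := lexx (critical phi); exact. Qed.

Lemma criticalD (phi : H) s : critical (phi + s *: v) = critical phi - s.
Proof.
have h t : t <= critical (phi + s *: v) <-> t <= critical phi - s.
  rewrite lerBrDr; apply: iff_trans (critical_le _ _) _.
  have -> : phi + s *: v + t *: v = phi + (t + s) *: v.
    by rewrite -addrA -scalerDl [s + t]addrC.
  exact: iff_sym (critical_le _ _).
by apply/eqP; rewrite eq_le; apply/andP; split; apply/h.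
Qed.

(** [phi - psi] is at most its value at 0 plus [|phi - psi|] times the weight, so lowering the
    parameter by [|phi - psi|] preserves subcriticality. *)
Lemma critical_lipschitz (phi psi : H) : `|critical phi - critical psi| <= `|phi - psi|.
Proof.
suff le a b : critical b - `|a - b| <= critical a.
  have := le phi psi; have := le psi phi; rewrite (distrC psi) => h1 h2.
  rewrite ler_norml; move: h1 h2.
  move: (critical phi) (critical psi) `|phi - psi| => a b c *.
  by apply/andP; split; lra.
apply/critical_le/(subcritical_weightE alpha gamma01) => nu inv.
have := critical_bound b inv.
have : \int[nu]_x a x <= \int[nu]_x b x + (a x0 - b x0) + `|a - b| * \int[nu]_x v x.
  have b1 := bmeas_cst I (a x0 - b x0 : R).
  have b2 := bmeasZ `|a - b| (bmeasH v).
  have E : \int[nu]_x ((b x + (a x0 - b x0)) + `|a - b| * v x) =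
      \int[nu]_x b x + (a x0 - b x0) + `|a - b| * \int[nu]_x v x.
    rewrite (meanD nu (bmeasD (bmeasH b) b1) b2) (meanD nu (bmeasH b) b1).
    by rewrite mean_cst (meanZ nu _ (bmeasH v)).
  rewrite [leRHS](esym E); apply: le_mean => //.
    exact: bmeasD (bmeasD (bmeasH b) b1) b2.
  move=> x; have := holder_le_weight gamma01 (a - b) x.
  change ((a x - b x : R) <= (a x0 - b x0) + `|a - b| * v x ->
    (a x : R) <= (b x + (a x0 - b x0)) + `|a - b| * v x).
  move: (a x : R) (b x : R) (a x0 : R) (b x0 : R) (`|a - b| * v x) => *; lra.
rewrite mulrBl; move: (fine _) (\int[nu]_x a x) (\int[nu]_x b x) => e p q.
move: (\int[nu]_x v x) `|a - b| (critical b) (a x0 : R) (b x0 : R) => *; lra.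
Qed.

Lemma critical_gt0_gibbs (phi : H) (nu : probability I R) : 0 < critical phi ->
  gibbs_state alpha phi nu -> forall A, measurable A -> nu A = delta0 R A.
Proof.
move=> c0 [inv gib].
have d0inv := dirac_invariant (map_zero alpha_gt0).
have : ((phi x0)%:E <= entropy f nu + \int[nu]_x (phi x)%:E)%E.
  rewrite gib; apply: ereal_sup_ubound; exists (delta0 R) => //.
  by rewrite entropy_dirac ?map_zero// add0e mean_EFin// mean_dirac.
rewrite (entropy_fin alpha_gt0 inv) mean_EFin// -EFinD lee_fin => h.
have := critical_bound phi inv => h'.
have /andP[m0 _] := mean_weight gamma01 nu.
apply: (mean_power0_dirac gamma_gt0 (bmeasH v : bmeas (fun x : I => val x `^ gamma))).
apply/eqP; rewrite eq_le m0 andbT.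
rewrite -(pmulr_rle0 _ c0); move: h h'.
move: (fine _) (\int[nu]_x phi x) (critical phi * _) (phi x0 : R) => *; lra.
Qed.

Lemma subcritical_gibbs (phi : H) : 0 <= critical phi <-> gibbs_state alpha phi (delta0 R).
Proof.
have d0inv := dirac_invariant (map_zero alpha_gt0).
have d0E : (entropy f (delta0 R) + \int[delta0 R]_x (phi x)%:E = (phi x0)%:E)%E.
  by rewrite entropy_dirac ?map_zero// add0e mean_EFin// mean_dirac.
have sE : subcritical alpha (phi + 0 *: v) = subcritical alpha phi.
  by rewrite scale0r addr0.
rewrite critical_le sE; split=> [h|[_ gib] nu inv].
  split=> //; rewrite d0E; apply/eqP; rewrite eq_le; apply/andP; split.
    by apply: ereal_sup_ubound; exists (delta0 R) => //; rewrite d0E.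
  apply: ge_ereal_sup => _ [nu inv <-].
  by rewrite (entropy_fin alpha_gt0 inv) mean_EFin// -EFinD lee_fin; exact: h.
rewrite -lee_fin EFinD -(entropy_fin alpha_gt0 inv) -mean_EFin// -d0E gib.
by apply: ereal_sup_ubound; exists nu.
Qed.

Let nbhsP (phi : H) (B : set H) :
  nbhs phi B <-> exists2 e : R, 0 < e & forall psi, `|psi - phi| < e -> B psi.
Proof.
split=> [/nbhs_ballP[e e0 h]|[e e0 h]].
  by exists e => // psi k; apply: h; rewrite -ball_normE /= distrC.
apply/nbhs_ballP; exists e => // psi; rewrite -ball_normE /= distrC.
exact: h.
Qed.

Let small_shift e : 0 < e -> exists2 s : R, 0 < s & `|s *: v| < e.
Proof.
move=> e0; have v10 : 0 < `|v| + 1 by rewrite ltr_wpDl.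
exists (e / (`|v| + 1)); first by rewrite divr_gt0.
rewrite normrZ ger0_norm ?divr_ge0 ?(ltW e0) ?(ltW v10)//.
by rewrite mulrAC ltr_pdivrMr// ltr_pM2l// ltrDl.
Qed.

Lemma critical_continuous : continuous critical.
Proof.
move=> phi B /nbhs_ballP[e e0 h]; apply/nbhsP; exists e => // psi k.
by apply: h; rewrite -ball_normE /= distrC; exact: le_lt_trans (critical_lipschitz _ _) k.
Qed.

Lemma stationary_phaseE : stationary_phase alpha gamma = [set phi | 0 < critical phi].
Proof.
apply/seteqP; split=> phi /=.
  move=> /nbhsP[e e0 h]; have [s s0 se] := small_shift e0.
  (* A small shift along the weight stays in the set, which forces [critical phi >= s > 0]. *)
  have [|/subcritical_gibbs + _] := h (phi + s *: v).
    by rewrite [phi + _]addrC addrK.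
  by rewrite criticalD subr_ge0; exact: lt_le_trans.
move=> c0; apply/nbhsP; exists (critical phi) => // psi h.
have c1 : 0 < critical psi.
  have := le_lt_trans (critical_lipschitz psi phi) h.
  rewrite ltr_norml; move: (critical psi) (critical phi) => a b /andP[? _]; lra.
split; first exact/subcritical_gibbs/ltW.
by move=> nu; exact: critical_gt0_gibbs c1.
Qed.

Lemma stationary_boundaryE :
  boundary (stationary_phase alpha gamma) = [set phi | critical phi = 0].
Proof.
rewrite /boundary stationary_phaseE; apply/seteqP; split=> phi /=.
  move=> [cl ni]; apply/eqP; rewrite eq_le; apply/andP; split.
    rewrite leNgt; apply/negP => c0; apply: ni; apply/nbhsP.
    exists (critical phi) => // psi h.
    have := le_lt_trans (critical_lipschitz psi phi) h.
    rewrite ltr_norml /=; move: (critical psi) (critical phi) => a b /andP[? _]; lra.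
  rewrite leNgt; apply/negP => c0.
  have [|psi [/= c1 h]] := cl [set psi | `|psi - phi| < - critical phi].
    by apply/nbhsP; exists (- critical phi) => //; rewrite oppr_gt0.
  have := le_lt_trans (critical_lipschitz psi phi) h.
  rewrite ltr_norml; move: c0 c1.
  move: (critical psi) (critical phi) => a b ? ? /andP[_ ?]; lra.
move=> c0; split.
  move=> B /nbhsP[e e0 h]; have [s s0 se] := small_shift e0.
  exists (phi + (- s) *: v); split.
    by rewrite /= criticalD c0 sub0r opprK.
  by apply: h; rewrite [phi + _]addrC addrK scaleNr normrN.
by move=> /nbhs_singleton /=; rewrite c0 ltxx.
Qed.

Lemma critical_gt0_intermittent (phi : H) : 0 < critical phi ->
  ~ intermittent_phase alpha gamma phi.
Proof.
move=> c0 [nu [gib _]]; have h := critical_gt0_gibbs c0 gib.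
have -> : entropy f nu = 0%E.
  by rewrite (entropy_ext alpha_gt0 h); exact: entropy_dirac (map_zero alpha_gt0).
by rewrite ltxx.
Qed.

Lemma critical_lt0_intermittent (phi : H) e : critical phi < 0 -> 0 < e ->
  exists2 psi, intermittent_phase alpha gamma psi & `|psi - phi| < e.
Proof.
move=> c0 e0; have e3 : 0 < e / 3 by rewrite divr_gt0.
have super : ~ subcritical alpha phi.
  have sE : phi = phi + 0 *: v by rewrite scale0r addr0.
  by rewrite sE => /critical_le; rewrite leNgt c0.
have [u [h [p [u1 u2 hh h1 eig]]]] := eigenfunction_perturbation alpha_gt0
  gamma01 gamma_le (holder_fun_is_holder phi) super e3.
have [U UE] : exists U : H, forall x, U x = u x.
  by apply: holder_of_is_holder; split; exists (e / 3).
exists (phi + U); last first.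
  rewrite addrC addKr holder_normE (@le_lt_trans _ _ (e / 3 + e / 3))//; last lra.
  apply: lerD; first by apply: supnorm_le => x; rewrite UE.
  by apply: holder_seminorm_le => x y; rewrite !UE.
have fE : (phi + U : I -> R) = (fun y => phi y + u y).
  by apply/funext => x; rewrite -UE.
have hU : is_holder gamma (fun y => phi y + u y).
  by rewrite -fE; exact: holder_fun_is_holder.
have [nu [n1 n2 n3]] := intermittent_gibbs alpha_gt0 gamma01 hU hh h1 eig.
by exists nu; split=> //; rewrite fE.
Qed.

(** The intermittent phase is dense in [critical < 0] and disjoint from [critical > 0], and
    arbitrarily small shifts along the weight reach both sides from [critical = 0]. *)
Lemma phase_transition_locusE :
  phase_transition_locus alpha gamma = [set phi | critical phi = 0].
Proof.
rewrite /phase_transition_locus stationary_boundaryE.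
apply/seteqP; split=> phi; first by case.
move=> /= c0; split=> //; split.
  move=> B /nbhsP[e e0 h]; have e2 : 0 < e / 2 by rewrite divr_gt0.
  have [s s0 se] := small_shift e2.
  have [|psi ip hp] := @critical_lt0_intermittent (phi + s *: v) (e / 2) _ e2.
    by rewrite criticalD c0 sub0r oppr_lt0.
  exists psi; split=> //; apply: h.
  rewrite -(subrKA (phi + s *: v)) (le_lt_trans (ler_normD _ _))//.
  have -> : phi + s *: v - phi = s *: v by rewrite addrC addKr.
  by move: `|psi - _| `|s *: v| hp se => a b *; lra.
move=> /nbhsP[e e0 h]; have [s s0 se] := small_shift e0.
apply: (@critical_gt0_intermittent (phi + (- s) *: v)).
  by rewrite criticalD c0 sub0r opprK.
by apply: h; rewrite addrC addKr scaleNr normrN.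
Qed.

End CriticalLocus.

(** * Graphs over a hyperplane *)

Section GraphHypersurface.
Variables (R : realType) (X : completeNormedModType R) (v : X) (c t : X -> R).
Hypothesis c_lin : forall a x y, c (a *: x + y) = a * c x + c y.
Hypotheses (c_cont : continuous c) (cv : c v = 1).
Hypothesis t_cont : continuous t.
Hypothesis tD : forall x s, t (x + s *: v) = t x - s.

Let S : set X := [set x | t x = 0].
Let K : set X := [set x | c x = 0].
(** The height of the graph [S] above the projection of [x] to [K] along [v]. It is constant along
    [v], so the shears [g] and [h] are mutually inverse, and [g] flattens [S] onto [K]. *)
Let p x := t (x - c x *: v).
Let g x := x - p x *: v.
Let h x := x + p x *: v.

Let cD x s : c (x + s *: v) = c x + s.
Proof. by rewrite addrC c_lin cv mulr1 addrC. Qed.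

Let pD x s : p (x + s *: v) = p x.
Proof. by rewrite /p cD scalerDl opprD addrACA subrr addr0. Qed.

Let gK : cancel g h.
Proof. by move=> x; rewrite /h /g -scaleNr pD scaleNr subrK. Qed.

Let hK : cancel h g.
Proof. by move=> x; rewrite /h /g pD addrK. Qed.

Let cg x : c (g x) = - t x.
Proof. by rewrite /g /p -!scaleNr cD tD; ring. Qed.

Let p_cont : continuous p.
Proof.
move=> x; apply: (@continuous_comp _ _ _ (fun x => x - c x *: v) t); last exact: t_cont.
apply: cvgB; first exact: cvg_id.
by apply: cvgZr_tmp; exact: c_cont.
Qed.

Let g_cont : continuous g.
Proof.
move=> x; apply: cvgB; first exact: cvg_id.
by apply: cvgZr_tmp; exact: p_cont.
Qed.

Let h_cont : continuous h.
Proof.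
move=> x; apply: cvgD; first exact: cvg_id.
by apply: cvgZr_tmp; exact: p_cont.
Qed.

Let c0 : c 0 = 0.
Proof. by have := c_lin (-1) 0 0; rewrite scaler0 add0r mulN1r addNr. Qed.

Let K_codim1 : codim1_subspace K.
Proof.
split.
  split; first by rewrite inE; exact: c0.
  move=> a x y; rewrite !inE /K /= => x0 y0.
  by rewrite c_lin x0 y0 mulr0 addr0.
exists v; first by rewrite /K /= cv; apply/eqP; exact: oner_neq0.
by move=> x; exists (c x); rewrite /K /= -scaleNr cD subrr.
Qed.

Let K_closed : closed K.
Proof.
rewrite (_ : K = c @^-1` [set 0]); last by apply/seteqP; split.
apply: closed_comp => //; exact: closed_eq.
Qed.

Let image_g : g @` S = K.
Proof.
apply/seteqP; split=> [_ [x Sx <-]|x Kx].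
  by rewrite /K /= cg Sx oppr0.
exists (h x); last exact: hK.
by apply/eqP; rewrite /S /= -oppr_eq0 -cg hK Kx.
Qed.

Lemma graph_submanifold : topological_submanifold_codim1 S.
Proof.
move=> x _; exists setT, setT, K, g; split=> //.
- by split=> //; exact: openT.
- exact: openT.
- split; last 1 first.
  + by exists h => [y _|]; [exact: gK|exact: continuous_subspaceT].
  + split=> // [y z _ _ /(congr1 h)|y _]; first by rewrite !gK.
    by exists (h y) => //; exact: hK.
  + exact: continuous_subspaceT.
- by rewrite !setTI image_g.
Qed.

Lemma graph_homeomorphic : exists K' : set X, codim1_subspace K' /\ homeomorphic S K'.
Proof.
exists K; split=> //; exists g; split; last 1 first.
- by exists h => [y _|]; [exact: gK|exact: continuous_subspaceT].
- split=> [y Sy|y z _ _ /(congr1 h)|y Ky]; first by rewrite -image_g; exists y.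
    by rewrite !gK.
  by rewrite -image_g in Ky.
- exact: continuous_subspaceT.
Qed.

(** Every [y + t y *: v] lies in [S]. The affine combination of the points above 0 and above [x]
    lies above [s *: x], and its coefficient along [v] must be [t (s *: x)]. *)
Lemma graph_affine : affine_subspace S ->
  forall x s, t (s *: x) = t 0 + s * (t x - t 0).
Proof.
move=> [a [W [[W0 WL] SE]]] x s.
have St y : S (y + t y *: v) by rewrite /S /= tD subrr.
have := St x; have := St 0; rewrite SE => -[w0 Ww0 e0] [w1 Ww1 e1].
have W' : W (s *: (w1 - w0) + w0).
  have wd : w1 - w0 \in [in W].
    rewrite addrC -scaleN1r; apply: WL; rewrite ?inE//; exact/mem_set.
  have := WL s _ _ wd (mem_set Ww0); by rewrite inE.
have : S (a + (s *: (w1 - w0) + w0)) by rewrite SE; exists (s *: (w1 - w0) + w0).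
have -> : a + (s *: (w1 - w0) + w0) = s *: x + (t 0 + s * (t x - t 0)) *: v.
  have -> : w1 - w0 = x + t x *: v - t 0 *: v.
    by rewrite -e1 -[t 0 *: v]add0r -e0 opprD addrACA subrr add0r.
  rewrite addrCA e0 add0r -[x + _ - _]addrA -scalerBl scalerDr scalerA -addrA.
  by rewrite -scalerDl [_ + t 0]addrC.
by rewrite /S /= tD => /eqP; rewrite subr_eq0 => /eqP.
Qed.

End GraphHypersurface.

(** The stationary measure for constant weights 1/2. The bump vanishes only at 0 and 1, and at every
    point some branch takes a value strictly between them: the right one at 0, the left one
    elsewhere. So one averaging step makes the bump positive everywhere, and its mean cannot
    vanish. *)
Lemma bump_invariant_measure (R : realType) (alpha : R) : 0 < alpha ->
  exists nu : probability (I01 R) R, invariant_measure (@intermittent_map R alpha) nu /\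
  0 < \int[nu]_x (val x * (1 - val x)).
Proof.
move=> alpha_gt0; pose bump (x : I01 R) : R := val x * (1 - val x).
have g1 : 0 < (1 : R) <= 1 by rewrite ltr01 lexx.
have half0 : 0 < (1 / 2 : R) by rewrite divr_gt0.
pose P (b : bool) (x : I01 R) : R := 1 / 2.
have P_sum x : P false x + P true x = 1 by rewrite /P; lra.
have P_ge b x : 1 / 2 <= P b x by [].
have P_holder x y : `|P true x - P true y| <= 0 * `|val x - val y| `^ 1.
  by rewrite subrr normr0 mul0r.
have [nu [C [rho [_ _ stat _]]]] := stationary_measure alpha_gt0 g1 half0 P_sum P_ge P_holder.
have bP b : bmeas (P b) by exact: bmeas_cst.
exists nu; split.
  exact: (stationary_invariant alpha_gt0 half0 bP P_sum P_ge stat).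
have b0 x : 0 <= bump x.
  by have /andP[x0 x1] := I01P x; rewrite mulr_ge0// subr_ge0.
have bb : bmeas bump.
  apply: (holder_bmeas ltr01); apply: is_holderM; first exact: is_holder_val.
  by apply: is_holderB; [exact: is_holder_cst|exact: is_holder_val].
have E1 : lift_inv alpha 1 < 1.
  by rewrite -[ltRHS](lift_inv2 alpha_gt0) lift_inv_lt// ltr1n.
have E0 := lift_inv1_gt0 alpha_gt0.
have a_gt0 x : 0 < averaging alpha P bump x.
  have [x0|x0] := eqVneq (val x) 0.
    apply: ltr_wpDl; first by rewrite mulr_ge0// ltW.
    rewrite mulr_gt0// /bump val_branch// x0 addr0.
    by rewrite mulr_gt0// subr_gt0.
  have {}x0 : 0 < val x by rewrite lt_neqAle eq_sym x0; have /andP[] := I01P x.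
  apply: ltr_pwDl; last by rewrite mulr_ge0// ltW.
  have T0 := branch_gt0 alpha_gt0 false x0.
  rewrite mulr_gt0// /bump mulr_gt0// subr_gt0 (le_lt_trans _ E1)// val_branch//.
  by have /andP[? ?] := I01P x; rewrite lift_inv_le ?add0r// ler1n.
rewrite lt_neqAle; apply/andP; split; last exact: mean_ge.
apply/eqP => m0; have ba : bmeas (averaging alpha P bump).
  by apply: bmeasD; apply: bmeasM => //; apply: (bmeas_comp _ bb); exact: measurable_branch.
have := mean_eq0_null (nu := nu) ba (fun x => ltW (a_gt0 x)).
rewrite stat// => /(_ (esym m0)).
have -> : [set x | 0 < averaging alpha P bump x] = setT by apply/seteqP; split=> // x _ /=.
by rewrite /pr [X in fine X](@probability_setT _ _ _ nu) => /eqP; rewrite oner_eq0.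
Qed.

Theorem theoremB (R : realType) (alpha : R) (alpha_gt0 : 0 < alpha)
    (gamma : R) (gamma_gt0 : 0 < gamma) (gamma_le : gamma <= Num.min alpha 1) :
  [/\ topological_submanifold_codim1 (phase_transition_locus alpha gamma),
      exists K : set (holder gamma), codim1_subspace K /\
        homeomorphic (phase_transition_locus alpha gamma) K &
      ~ affine_subspace (phase_transition_locus alpha gamma)].
Proof.
have gamma_alpha : gamma <= alpha by move: gamma_le; rewrite le_min => /andP[].
have gamma01 : 0 < gamma <= 1.
  by rewrite gamma_gt0; move: gamma_le; rewrite le_min => /andP[].
pose v := weight gamma01; pose x0 := I01_zero R; pose x1 := I01_one R.
have [t t_le] := critical_exists alpha_gt0 gamma01 gamma_alpha.
have tD := criticalD t_le.
have t_cont := critical_continuous t_le.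
rewrite (phase_transition_locusE alpha_gt0 gamma_alpha t_le).
pose c (phi : holder gamma) : R := phi x1 - phi x0.
have c_lin a phi psi : c (a *: phi + psi) = a * c phi + c psi.
  change (a * phi x1 + psi x1 - (a * phi x0 + psi x0) =
    a * (phi x1 - phi x0) + (psi x1 - psi x0) :> R).
  by move: (phi x1 : R) (psi x1 : R) (phi x0 : R) (psi x0 : R) => p q r s; ring.
have cv : c v = 1 by rewrite /c weight1 weight0 subr0.
have c_cont : continuous c.
  move=> phi B /nbhs_ballP[e e0 hB]; apply/nbhs_ballP.
  exists (e / 2); first by rewrite /= divr_gt0.
  move=> psi; rewrite -ball_normE /= => h; apply: hB; rewrite -ball_normE /=.
  have -> : c phi - c psi = (phi - psi) x1 - (phi - psi) x0.
    change (phi x1 - phi x0 - (psi x1 - psi x0) =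
      (phi x1 - psi x1) - (phi x0 - psi x0) :> R).
    by move: (phi x1 : R) (psi x1 : R) (phi x0 : R) (psi x0 : R) => p q r s; ring.
  have b x : `|(phi - psi) x| <= `|phi - psi|.
    rewrite (le_trans (supnorm_ge (phi - psi) x))// holder_normE lerDl.
    exact: holder_seminorm_ge0.
  apply: (le_lt_trans (ler_normB _ _)); have := b x1; have := b x0; move: h.
  move: `|phi - psi| `|(phi - psi) x1| `|(phi - psi) x0| => p q r *; lra.
split.
- exact: (graph_submanifold c_lin c_cont cv t_cont tD).
- exact: (graph_homeomorphic c_lin c_cont cv t_cont tD).
move=> /(graph_affine tD) taff.
have [nu [inv m0]] := bump_invariant_measure alpha_gt0.
have [psi psiE] : exists psi : holder gamma, forall x, psi x = val x * (1 - val x).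
  apply: holder_of_is_holder; apply: is_holderM; first exact: is_holder_val.
  by apply: is_holderB; [exact: is_holder_cst|exact: is_holder_val].
have slope (mu : probability (I01 R) R) : invariant_measure (@intermittent_map R alpha) mu ->
    (t psi - t 0) * \int[mu]_x v x = psi x0 - \int[mu]_x psi x.
  (* The variational inequality at [s *: psi], with the nonnegative entropy dropped, is affine in
     [s]; holding for all real [s], it forces the slope to vanish. *)
  move=> mu_inv; have bound s : t 0 * \int[mu]_x v x +
      s * ((t psi - t 0) * \int[mu]_x v x + \int[mu]_x psi x - psi x0) <= 0.
    have ent0 : 0 <= fine (entropy (@intermittent_map R alpha) mu).
      by apply: fine_ge0; exact: entropy_ge0.
    have := critical_bound t_le (s *: psi) mu_inv.
    have -> : \int[mu]_x (s *: psi) x = s * \int[mu]_x psi x.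
      exact: (meanZ mu s (bmeas_holder_fun gamma01 psi)).
    have -> : (s *: psi) x0 = s * psi x0 by [].
    rewrite taff; move: ent0 (t psi) (t 0).
    move: (fine _) (\int[mu]_x psi x) (\int[mu]_x v x) (psi x0 : R) => e p m q.
    by move=> ? a b; nra.
  apply/eqP; rewrite -subr_eq0 opprB addrA; apply/negPn/negP => k0.
  (* This value of [s] makes the left side of [bound] equal to 1. *)
  have := bound ((1 - t 0 * \int[mu]_x v x) /
    ((t psi - t 0) * \int[mu]_x v x + \int[mu]_x psi x - psi x0)).
  by rewrite divfK// subrKC ler10.
have := slope _ (dirac_invariant (map_one alpha_gt0)).
have bH := bmeas_holder_fun gamma01.
rewrite !mean_dirac// weight1 mulr1 !psiE /= subrr mulr0 mul0r subrr => tE.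
have := slope _ inv; rewrite tE mul0r psiE /= mul0r sub0r.
rewrite (_ : \int[nu]_x psi x = \int[nu]_x (val x * (1 - val x))); last first.
  by congr (fine (integral _ _ _)); apply/funext => x; rewrite psiE.
by move: m0; move: (\int[nu]_x _) => m; lra.
Qed.
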